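(* Let $K',K$ be simplicial sets, $\mathcal{C}$ an $\infty$-category, and $f'\colon K'\to\mathcal{C}$, $i\colon K'\to K$ maps of simplicial sets. Let $\mathcal{N}\colon(\Delta_{/K})^{op}\to\mathrm{Set}_\Delta$ be a functor and $\alpha\colon\mathcal{N}\to\mathrm{Map}[K,\mathcal{C}]$ a natural transformation. Suppose (1) for every object $(n,\sigma)$ of $\Delta_{/K}$ the simplicial set $\mathcal{N}(n,\sigma)$ is weakly contractible, and (2) there exists a vertex $\omega\in\Gamma(i^*\mathcal{N})_0$ such that $\Gamma(i^*\alpha)(\omega)=f'$ (as vertices of $\Gamma(\mathrm{Map}[K',\mathcal{C}])$, i.e. as functors $K'\to\mathcal{C}$). Then there exists a map $f\colon K\to\mathcal{C}$ such that $f\circ i$ and $f'$ are equivalent objects of $\mathrm{Fun}(K',\mathcal{C})$.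
   Context: The category of simplices $\Delta_{/K}$ has objects $(n,\sigma)$ with $n\ge0$, $\sigma\in K_n$, and morphisms $(n,\sigma)\to(m,\tau)$ the maps $\theta\colon[n]\to[m]$ with $\theta^*\tau=\sigma$; a map $i\colon K'\to K$ induces a functor $\Delta_{/K'}\to\Delta_{/K}$, $(n,\sigma)\mapsto(n,i\circ\sigma)$, and $i^*$ denotes precomposition with its opposite, $(\mathrm{Set}_\Delta)^{(\Delta_{/K})^{op}}\to(\mathrm{Set}_\Delta)^{(\Delta_{/K'})^{op}}$. For an $\infty$-category $\mathcal{C}$, $\mathrm{Map}[K,\mathcal{C}]\colon(\Delta_{/K})^{op}\to\mathrm{Set}_\Delta$ sends $(n,\sigma)$ to $\mathrm{Fun}^{\cong}(\Delta^n,\mathcal{C})$, the largest Kan complex in $\mathrm{Fun}(\Delta^n,\mathcal{C})$; note $i^*\mathrm{Map}[K,\mathcal{C}]=\mathrm{Map}[K',\mathcal{C}]$. For a small category $\mathcal{J}$, the global section functor $\Gamma\colon(\mathrm{Set}_\Delta)^{\mathcal{J}}\to\mathrm{Set}_\Delta$ is given by $\Gamma(F)_n=\mathrm{Hom}(\underline{\Delta^n},F)$ where $\underline{\Delta^n}$ is the constant functor with value $\Delta^n$; equivalently $\Gamma(F)=\lim_{\mathcal{J}}F$. One has $\Gamma(\mathrm{Map}[K,\mathcal{C}])$ equal to the largest Kan complex in $\mathrm{Fun}(K,\mathcal{C})$, so its vertices are functors $K\to\mathcal{C}$. *)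

(* Defs.v *)
From Stdlib Require Import ProofIrrelevance FunctionalExtensionality.
From mathcomp Require Import all_boot.

Set Implicit Arguments.
Unset Strict Implicit.
Unset Printing Implicit Defensive.

Definition monob n m (f : {ffun 'I_n.+1 -> 'I_m.+1}) : bool :=
  [forall i : 'I_n.+1, forall j : 'I_n.+1, (i <= j) ==> (f i <= f j)].

Definition Dmap (n m : nat) := {f : {ffun 'I_n.+1 -> 'I_m.+1} | monob f}.

Definition dfun n m (t : Dmap n m) : 'I_n.+1 -> 'I_m.+1 := fun i => proj1_sig t i.

Lemma monobP n m (f : {ffun 'I_n.+1 -> 'I_m.+1}) :
  (forall i j : 'I_n.+1, i <= j -> f i <= f j) -> monob f.
Proof.
move=> H; apply/forallP => i; apply/forallP => j; apply/implyP; exact: H.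
Qed.

Lemma monobE n m (f : {ffun 'I_n.+1 -> 'I_m.+1}) :
  monob f -> forall i j : 'I_n.+1, i <= j -> f i <= f j.
Proof.
move=> /forallP H i j lij; move: (H i) => /forallP /(_ j) /implyP; exact.
Qed.

(* composition in "diagrammatic" order: dcomp t u = u o t : [n] -> [p] *)
Definition dcomp n m p (t : Dmap n m) (u : Dmap m p) : Dmap n p.
Proof.
exists [ffun i => proj1_sig u (proj1_sig t i)].
apply: monobP => i j lij; rewrite !ffunE.
apply: (monobE (proj2_sig u)); exact: (monobE (proj2_sig t)).
Defined.

Definition did n : Dmap n n.
Proof. exists [ffun i => i]; apply: monobP => i j; rewrite !ffunE. done. Defined.

Definition dconst n m (j : 'I_m.+1) : Dmap n m.
Proof. exists [ffun _ => j]; apply: monobP => i k _; rewrite !ffunE. done. Defined.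

Definition dface n (i : 'I_n.+2) : Dmap n n.+1.
Proof.
exists [ffun j => lift i j]; apply: monobP => j k ljk; rewrite !ffunE /=.
by rewrite leq_bump2.
Defined.

Definition ddeg : Dmap 1 0 := dconst 1 ord0.

Lemma dcompA n m p r (a : Dmap n m) (b : Dmap m p) (c : Dmap p r) :
  dcomp (dcomp a b) c = dcomp a (dcomp b c).
Proof. apply: val_inj; apply/ffunP => i; by rewrite /= !ffunE. Qed.

Lemma sig_ext (A : Type) (P : A -> Prop) (a b : {x | P x}) :
  proj1_sig a = proj1_sig b -> a = b.
Proof.
case: a => x Hx; case: b => y Hy /= exy; subst y; f_equal; apply: proof_irrelevance.
Qed.

Record sRaw := SRaw {
  sx : nat -> Type;
  sact : forall n m, Dmap n m -> sx m -> sx n }.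
Arguments sact s {n m} _ _.

Definition is_sSet (X : sRaw) : Prop :=
  (forall n (x : sx X n), sact X (did n) x = x) /\
  (forall n m p (t : Dmap n m) (u : Dmap m p) (x : sx X p),
      sact X (dcomp t u) x = sact X t (sact X u x)).

Record sMap (X Y : sRaw) := SMap {
  smap : forall n, sx X n -> sx Y n;
  snat : forall n m (t : Dmap n m) (x : sx X m),
      @smap n (sact X t x) = sact Y t (@smap m x) }.
Arguments smap {X Y} s n _.

Definition scomp (X Y Z : sRaw) (f : sMap X Y) (g : sMap Y Z) : sMap X Z.
Proof.
exists (fun n x => smap g n (smap f n x)) => n m t x.
by rewrite snat snat.
Defined.

Definition Delta (n : nat) : sRaw := @SRaw (fun q => Dmap q n) (fun q r t s => dcomp t s).

Definition in_horn n (k : 'I_n.+1) q (s : Dmap q n) : bool :=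
  [exists j : 'I_n.+1, (j != k) && [forall i, dfun s i != j]].

Definition horn_fill (X : sRaw) n (k : 'I_n.+1) : Prop :=
  forall h : forall q (s : Dmap q n), in_horn k s -> sx X q,
    (forall q q' (t : Dmap q' q) (s : Dmap q n) (H : in_horn k s)
            (H' : in_horn k (dcomp t s)),
        h q' (dcomp t s) H' = sact X t (h q s H)) ->
    exists c : sx X n, forall q (s : Dmap q n) (H : in_horn k s),
        sact X s c = h q s H.

Definition is_kan (X : sRaw) : Prop :=
  forall n (k : 'I_n.+1), 0 < n -> horn_fill X k.

Definition is_quasicat (X : sRaw) : Prop :=
  forall n (k : 'I_n.+1), 0 < k -> k < n -> horn_fill X k.

(* e : x -> y is an isomorphism if there is e' : y -> x with           *)
(* [e'][e] = id_x and [e][e'] = id_y in the homotopy category, i.e.    *)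
(* 2-simplices with boundary (e, e', id_x) and (e', e, id_y).          *)

Definition I2_0 : 'I_2 := @Ordinal 2 0 isT.
Definition I2_1 : 'I_2 := @Ordinal 2 1 isT.
Definition I3_0 : 'I_3 := @Ordinal 3 0 isT.
Definition I3_1 : 'I_3 := @Ordinal 3 1 isT.
Definition I3_2 : 'I_3 := @Ordinal 3 2 isT.

Definition esrc (X : sRaw) (e : sx X 1) : sx X 0 := sact X (dface I2_1) e.
Definition etgt (X : sRaw) (e : sx X 1) : sx X 0 := sact X (dface I2_0) e.
Definition eid (X : sRaw) (x : sx X 0) : sx X 1 := sact X ddeg x.

Definition qc_iso (X : sRaw) (e : sx X 1) : Prop :=
  exists e' : sx X 1,
    esrc e' = etgt e /\ etgt e' = esrc e /\
    (exists s : sx X 2, sact X (dface I3_2) s = e /\ sact X (dface I3_0) s = e' /\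
                        sact X (dface I3_1) s = eid (esrc e)) /\
    (exists t : sx X 2, sact X (dface I3_2) t = e' /\ sact X (dface I3_0) t = e /\
                        sact X (dface I3_1) t = eid (etgt e)).

Definition qc_equiv (X : sRaw) (x y : sx X 0) : Prop :=
  exists e : sx X 1, esrc e = x /\ etgt e = y /\ qc_iso e.

(* Function complexes Fun(A, C): p-simplices are maps A x Delta^p -> C *)
(* written as natural families F_q : A_q -> (Delta^p)_q -> C_q.        *)

Definition FunS (A C : sRaw) (p : nat) :=
  {F : forall q, sx A q -> Dmap q p -> sx C q |
     forall q q' (t : Dmap q' q) (x : sx A q) (s : Dmap q p),
       F q' (sact A t x) (dcomp t s) = sact C t (F q x s)}.

Definition fval (A C : sRaw) p (F : FunS A C p) := proj1_sig F.

Definition fact (A C : sRaw) p' p (t : Dmap p' p) (F : FunS A C p) : FunS A C p'.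
Proof.
exists (fun q x s => proj1_sig F q x (dcomp s t)) => q q' u x s.
by rewrite dcompA (proj2_sig F).
Defined.

Definition FunR (A C : sRaw) : sRaw := @SRaw (FunS A C) (@fact A C).

Lemma fact_comp (A C : sRaw) p p' p'' (u : Dmap p'' p') (t : Dmap p' p)
  (F : FunS A C p) : fact u (fact t F) = fact (dcomp u t) F.
Proof.
apply: sig_ext => /=.
apply: functional_extensionality_dep => q.
apply: functional_extensionality_dep => x.
apply: functional_extensionality_dep => s.
by rewrite dcompA.
Qed.

Definition fvert (A C : sRaw) (g : sMap A C) : FunS A C 0.
Proof. exists (fun q x _ => smap g q x) => q q' t x s; exact: snat. Defined.

(* Fun^~(A, C): the largest Kan complex in Fun(A, C): simplices all of whose
   edges (images under all maps [1] -> [p]) are isomorphisms. *)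
Definition CoreS (A C : sRaw) (p : nat) :=
  {F : FunS A C p | forall g : Dmap 1 p, qc_iso (X := FunR A C) (fact g F)}.

Definition core_act (A C : sRaw) p' p (t : Dmap p' p) (F : CoreS A C p) : CoreS A C p'.
Proof.
exists (fact t (proj1_sig F)) => g.
rewrite /= fact_comp; exact: (proj2_sig F).
Defined.

Definition CoreR (A C : sRaw) : sRaw := @SRaw (CoreS A C) (@core_act A C).

Definition cval (A C : sRaw) p (F : CoreS A C p) := proj1_sig (proj1_sig F).

(* Map[K, C](n, sigma) := Fun^~(Delta^n, C) *)
Definition MapKC (C : sRaw) (n : nat) : sRaw := CoreR (Delta n) C.

(* Weak contractibility: X -> Delta^0 is a weak homotopy equivalence,  *)
(* i.e. for every Kan complex Z, pi_0(Z) -> pi_0 Fun(X, Z) (constant   *)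
(* maps) is bijective.  In Kan complexes pi_0 is vertices modulo the   *)
(* edge relation.                                                      *)

Definition is_const_at (X Z : sRaw) (F : FunS X Z 0) (z : sx Z 0) : Prop :=
  forall q (x : sx X q) (s : Dmap q 0), @fval X Z 0 F q x s = sact Z (dconst q ord0) z.

Definition weakly_contractible (X : sRaw) : Prop :=
  forall Z : sRaw, is_sSet Z -> is_kan Z ->
    (forall g : sMap X Z, exists (z : sx Z 0) (H : FunS X Z 1),
        esrc (X := FunR X Z) H = fvert g /\ is_const_at (etgt (X := FunR X Z) H) z) /\
    (forall z z' : sx Z 0,
        (exists H : FunS X Z 1, is_const_at (esrc (X := FunR X Z) H) z /\
                                is_const_at (etgt (X := FunR X Z) H) z') ->
        exists e : sx Z 1, esrc e = z /\ etgt e = z').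

(* Main.v *)
Require Import Defs.
From Stdlib Require Import ProofIrrelevance FunctionalExtensionality.
From Stdlib Require Import PropExtensionality ClassicalEpsilon.
From mathcomp Require Import all_boot zify.

Set Implicit Arguments.
Unset Strict Implicit.
Unset Printing Implicit Defensive.

(* By co-Yoneda, a natural transformation from a functor B to Map[K, C] is a compatible family of
   maps B(s) x Delta^n -> C. Embed N(s) into the contractible simplicial set N+(s) of partial maps
   Delta^p -> N(s): N+ has a natural base point, and every vertex of N(s) is canonically
   isomorphic to it in N+(s). It suffices to extend alpha to N+: the value at the base point is the
   functor f, and the canonical isomorphisms from the base point to omega become the equivalence
   between f o i and f', inverse and homotopies included. Since N(s) and N+(s) are both weakly
   contractible, the extension exists because Map[K, C] is injectively fibrant. That is shown by
   Reedy induction over the simplices s of K: the union of N(s) with the degenerate part of N+(s) is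
   weakly contractible by inclusion-exclusion, and acyclic inclusions lift against
   Fun(Delta^n, C) -> Fun(bd Delta^n, C) by homotopy extension, which rests on inner horns and on
   Joyal's special outer horns. *)

(** * Monotone maps *)

Section Dmaps.
Implicit Types n m p q : nat.

(** The obstacle is strictness: a map [K -> C] asks for choices compatible over all simplices of
    [K], whereas (1) gives choices only up to homotopy, and (2) gives strict ones over [K'] alone.
    Partial maps help because they are functorial on the nose: every structure map preserves the
    empty map, and a vertex of [N(s)] with a set of vertices of [Delta^p] determines a [p]-simplex
    of [N+(s)]. Weak contractibility speaks of maps into Kan complexes, while [C] is only a
    quasi-category. Lifting problems are therefore moved into fibres of restriction maps between
    function complexes, with edges pointwise invertible; these fibres are Kan. Marked edges let one
    argument serve both the isomorphisms of [C] and all edges of a Kan complex. Homotopy extension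
    from the end 1 of [Delta^1] is the case of the end 0 in the opposite simplicial set. Degeneracy
    is expressed by the idempotents of [[n.+1]] sending [i.+1] to [i], so that the degenerate part
    of [N+(s)] is a union of retracts of [N+(s)]. *)

Lemma dmap_ext n m (t u : Dmap n m) :
  (forall i, dfun t i = dfun u i :> nat) -> t = u.
Proof. by move=> H; apply/val_inj/ffunP => i; apply/val_inj/H. Qed.

Lemma dmap_eq n m (t u : Dmap n m) i : t = u -> dfun t i = dfun u i :> nat.
Proof. by move=> ->. Qed.

Lemma dcompE n m p (t : Dmap n m) (u : Dmap m p) i :
  dfun (dcomp t u) i = dfun u (dfun t i).
Proof. by rewrite /dfun /= ffunE. Qed.

Lemma didE n i : dfun (did n) i = i.
Proof. by rewrite /dfun /= ffunE. Qed.

Lemma dconstE n m (j : 'I_m.+1) i : dfun (dconst n j) i = j.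
Proof. by rewrite /dfun /= ffunE. Qed.

Lemma dfaceE n (j : 'I_n.+2) i : dfun (dface j) i = bump j i :> nat.
Proof. by rewrite /dfun /= ffunE. Qed.

Lemma dmono n m (t : Dmap n m) (i j : 'I_n.+1) : i <= j -> dfun t i <= dfun t j.
Proof. exact: (monobE (proj2_sig t)). Qed.

(** Maps are given by functions on [nat] capped at [m]: no bound has to be proved, and identities
    between them reduce to arithmetic. *)
Lemma dmk_subproof n m (f : nat -> nat)
  (H : forall i j, i <= j -> j <= n -> f i <= f j) :
  monob [ffun i : 'I_n.+1 => inord (minn m (f i)) : 'I_m.+1].
Proof.
apply: monobP => i j ij; rewrite !ffunE !inordK ?ltnS ?geq_minl //.
by have := H _ _ ij (ltn_ord j); lia.
Qed.

Definition dmk n m f H : Dmap n m :=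
  exist (fun g => is_true (monob g)) _ (@dmk_subproof n m f H).

Lemma dmkE n m f H i : dfun (@dmk n m f H) i = minn m (f i) :> nat.
Proof. by rewrite /dfun /= ffunE inordK ?ltnS ?geq_minl. Qed.

Lemma dfc_subproof n j i k : i <= k -> k <= n -> bump j i <= bump j k.
Proof. by rewrite leq_bump2. Qed.

Definition dfc n j : Dmap n n.+1 := dmk n.+1 (@dfc_subproof n j).

Lemma dfcE n j i : dfun (dfc n j) i = bump j i :> nat.
Proof. by rewrite dmkE /bump; have := ltn_ord i; lia. Qed.

Lemma dfc_face n (j : 'I_n.+2) : dfc n j = dface j.
Proof. by apply: dmap_ext => i; rewrite dfcE dfaceE. Qed.

Lemma dpin_subproof n j i k : i <= k -> k <= n -> i - (j < i) <= k - (j < k).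
Proof. lia. Qed.

(** The codegeneracy repeating [j]. The cap makes [j = n.+1] act as [j = n], so that [dpin n j]
    retracts the coface [dfc n j] for every [j <= n.+1]. *)
Definition dpin n j : Dmap n.+1 n := dmk n (@dpin_subproof n.+1 j).

Lemma dpinE n j i : dfun (dpin n j) i = minn n (i - (j < i)) :> nat.
Proof. by rewrite dmkE. Qed.

Lemma dcomp1t n m (t : Dmap n m) : dcomp (did n) t = t.
Proof. by apply: dmap_ext => i; rewrite dcompE didE. Qed.

Lemma dcompt1 n m (t : Dmap n m) : dcomp t (did m) = t.
Proof. by apply: dmap_ext => i; rewrite dcompE didE. Qed.

Definition dE := (dcompE, didE, dfcE, dpinE, dmkE, dfaceE, dconstE).

Lemma dconst_comp n m p (t : Dmap n m) (j : 'I_p.+1) :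
  dcomp t (dconst m j) = dconst n j.
Proof. by apply: dmap_ext => i; rewrite !dE. Qed.

Lemma dconst_post n m p (j : 'I_m.+1) (t : Dmap m p) :
  dcomp (dconst n j) t = dconst n (dfun t j).
Proof. by apply: dmap_ext => i; rewrite !dE. Qed.

Lemma dfcK n j : j <= n.+1 -> dcomp (dfc n j) (dpin n j) = did n.
Proof. by move=> H; apply: dmap_ext => i; have := ltn_ord i; rewrite !dE /bump; lia. Qed.

Definition misses q n (s : Dmap q n) j := forall i, dfun s i <> j :> nat.

Lemma misses_comp q q' n (t : Dmap q' q) (s : Dmap q n) j :
  misses s j -> misses (dcomp t s) j.
Proof. by move=> H i; rewrite dcompE; exact: H. Qed.

Lemma misses_fc n j q (t : Dmap q n) : misses (dcomp t (dfc n j)) j.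
Proof. move=> i; rewrite !dE /bump; lia. Qed.

Lemma dfactor q n (s : Dmap q n.+1) j : j <= n.+1 -> misses s j ->
  s = dcomp (dcomp s (dpin n j)) (dfc n j).
Proof.
move=> Hj H; apply: dmap_ext => i; rewrite !dE /bump.
by have := H i; have := ltn_ord (dfun s i); lia.
Qed.

Lemma dfc_inj q n (s s' : Dmap q n) j : j <= n.+1 ->
  dcomp s (dfc n j) = dcomp s' (dfc n j) -> s = s'.
Proof.
move=> Hj /(congr1 (fun u => dcomp u (dpin n j))).
by rewrite !dcompA dfcK // !dcompt1.
Qed.

Lemma dfc_fc n i j : i <= j -> dcomp (dfc n i) (dfc n.+1 j.+1) = dcomp (dfc n j) (dfc n.+1 i).
Proof. by move=> H; apply: dmap_ext => k; rewrite !dE /bump; lia. Qed.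

Lemma dmap0_uniq n (t u : Dmap n 0) : t = u.
Proof. by apply: dmap_ext => i; have := ltn_ord (dfun t i); have := ltn_ord (dfun u i); lia. Qed.

End Dmaps.

(** * Faces, horns and composition of edges *)

Section Glue.
Variables (W : sRaw) (hW : is_sSet W).

Lemma sact1 n (x : sx W n) : sact W (did n) x = x.
Proof. exact: hW.1. Qed.

Lemma sactM n m p (t : Dmap n m) (u : Dmap m p) (x : sx W p) :
  sact W t (sact W u x) = sact W (dcomp t u) x.
Proof. by rewrite hW.2. Qed.

(* A horn or a boundary is given by its faces x j for the indices j in J. *)
Definition compat n (J : nat -> Prop) (x : nat -> sx W n) : Prop :=
  forall q (s s' : Dmap q n) i j, J i -> J j ->
    dcomp s (dfc n i) = dcomp s' (dfc n j) -> sact W s (x i) = sact W s' (x j).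

(** A simplex shared by the faces [i < j] misses both vertices, hence factors through their common
    face, where the simplicial identity applies. *)
Lemma compat_faces n (J : nat -> Prop) (x : nat -> sx W n.+1) :
  (forall i, J i -> i <= n.+2) ->
  (forall i j, J i -> J j -> i < j ->
     sact W (dfc n i) (x j) = sact W (dfc n j.-1) (x i)) ->
  compat J x.
Proof.
move=> HJ Hx.
have main q (s s' : Dmap q n.+1) i j : J i -> J j -> i < j ->
    dcomp s (dfc n.+1 i) = dcomp s' (dfc n.+1 j) -> sact W s (x i) = sact W s' (x j).
  move=> Ji Jj ij E.
  have E' k : bump i (dfun s k) = bump j (dfun s' k).
    have := dmap_eq k E; by rewrite !dE.
  have Hi := HJ _ Ji; have Hj := HJ _ Jj.
  have Ms : misses s j.-1.
    by move=> k; have := E' k; rewrite /bump; lia.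
  have Ms' : misses s' i.
    by move=> k; have := E' k; rewrite /bump; lia.
  rewrite (dfactor _ Ms); last by lia.
  rewrite (dfactor _ Ms'); last by lia.
  rewrite -sactM -[RHS]sactM -Hx //; congr (sact W _ _).
  apply: dmap_ext => k; have := E' k; rewrite !dE /bump.
  have := ltn_ord (dfun s k); have := ltn_ord (dfun s' k); lia.
move=> q s s' i j Ji Jj E.
case: (ltngtP i j) => ij; first exact: main.
- by apply/esym; apply: main.
- by subst j; rewrite (dfc_inj (HJ _ Ji) E).
Qed.

Lemma compat0 (J : nat -> Prop) (x : nat -> sx W 0) :
  (forall i, J i -> i <= 1) -> compat J x.
Proof.
move=> HJ q s s' i j Ji Jj E.
rewrite (dmap0_uniq s' s); suff -> : i = j by [].
have := dmap_eq ord0 E; rewrite !dE /bump.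
have := HJ _ Ji; have := HJ _ Jj; have := ltn_ord (dfun s ord0); have := ltn_ord (dfun s' ord0); lia.
Qed.

(** The value is chosen by [epsilon] among the factorisations through a face, and [compat] makes
    them all agree. Off the faces the value is arbitrary; [dfl] only inhabits the type. *)
Lemma glue_faces (dfl : forall q, sx W q) n (J : nat -> Prop) (x : nat -> sx W n) :
  compat J x ->
  exists h : forall q, Dmap q n.+1 -> sx W q,
    forall q (s : Dmap q n) j, J j -> h q (dcomp s (dfc n j)) = sact W s (x j).
Proof.
move=> Hx.
pose P q (e : Dmap q n.+1) w := exists j (s : Dmap q n),
  [/\ J j, e = dcomp s (dfc n j) & w = sact W s (x j)].
exists (fun q e => epsilon (inhabits (dfl q)) (P q e)) => q s j Jj.
have : P q (dcomp s (dfc n j)) (epsilon (inhabits (dfl q)) (P q (dcomp s (dfc n j)))).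
  by apply: epsilon_spec; exists (sact W s (x j)), j, s.
case=> i [s' [Ji E ->]]; exact: Hx (esym E).
Qed.

Lemma in_hornP n (k : 'I_n.+2) q (s : Dmap q n.+1) :
  reflect (exists j, [/\ j <= n.+1, j <> k & misses s j]) (in_horn k s).
Proof.
apply: (iffP existsP) => [[j /andP[/eqP jk /forallP H]]|[j [jn jk H]]].
  exists j; split; [by rewrite -ltnS| |].
    by move=> E; apply: jk; apply: val_inj.
  by move=> i E; have /eqP := H i; apply; apply: val_inj.
exists (Ordinal (jn : j < n.+2)); apply/andP; split; first by apply/eqP => E; apply: jk; rewrite -E.
by apply/forallP => i; apply/eqP => E; apply: (H i); rewrite E.
Qed.

Lemma fill_faces n (k : 'I_n.+2) (x : nat -> sx W n) :
  horn_fill W k -> compat (fun j => j <= n.+1 /\ j <> k) x ->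
  exists c : sx W n.+1, forall j, j <= n.+1 -> j <> k -> sact W (dfc n j) c = x j.
Proof.
move=> Hf Hx.
have dfl q : sx W q.
  exact: (sact W (dconst q ord0) (x 0)).
have [h Hh] := glue_faces dfl Hx.
have [|c Hc] := Hf (fun q s _ => h q s).
  move=> q q' t s H H'; have /in_hornP[j [jn jk jm]] := H.
  by rewrite (dfactor jn jm) -dcompA !Hh // sactM.
exists c => j jn jk.
have H : in_horn k (dfc n j).
  apply/in_hornP; exists j; split=> //.
  by move=> i; have := @misses_fc n j n (did n) i; rewrite dcomp1t.
have E : dcomp (did n) (dfc n j) = dfc n j by rewrite dcomp1t.
have := Hh n (did n) j (conj jn jk); rewrite sact1 E => <-.
exact: Hc.
Qed.

Lemma faces_fill n (k : 'I_n.+2)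
  (h : forall q (s : Dmap q n.+1), in_horn k s -> sx W q) (c : sx W n.+1) :
  (forall q q' (t : Dmap q' q) (s : Dmap q n.+1) (H : in_horn k s)
            (H' : in_horn k (dcomp t s)),
        h q' (dcomp t s) H' = sact W t (h q s H)) ->
  (forall j (H : in_horn k (dfc n j)), j <= n.+1 -> j <> k -> sact W (dfc n j) c = h n (dfc n j) H) ->
  forall q (s : Dmap q n.+1) (H : in_horn k s), sact W s c = h q s H.
Proof.
move=> Hh Hc q s H; have /in_hornP[j [jn jk jm]] := H.
have Hj : in_horn k (dfc n j).
  apply/in_hornP; exists j; split=> //.
  by move=> i; have := @misses_fc n j n (did n) i; rewrite dcomp1t.
move: H; rewrite (dfactor jn jm) => H.
by rewrite -sactM (Hc j Hj jn jk) -Hh.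
Qed.

End Glue.

Definition inner_fill (C : sRaw) : Prop :=
  forall n k (x : nat -> sx C n), 0 < k -> k < n.+1 ->
  compat (fun j => j <= n.+1 /\ j <> k) x ->
  exists c : sx C n.+1, forall j, j <= n.+1 -> j <> k -> sact C (dfc n j) c = x j.

Lemma quasi_inner_fill (C : sRaw) : is_sSet C -> is_quasicat C -> inner_fill C.
Proof.
move=> hC hq n k x k0 kn Hx; have kn' : k < n.+2 by lia.
exact: (fill_faces hC (hq n.+1 (Ordinal kn') k0 kn) Hx).
Qed.

(** * Edges up to homotopy, and isomorphisms *)

Section Comp.
Variables (C : sRaw) (hC : is_sSet C).

(** A 2-simplex witnessing [h] as [f] followed by [g]. Equations of the homotopy category are
    carried by such witnesses, without forming the quotient. *)
Definition qcomp (f g h : sx C 1) : Prop :=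
  exists s : sx C 2, [/\ sact C (dfc 1 2) s = f, sact C (dfc 1 0) s = g & sact C (dfc 1 1) s = h].

Definition src (e : sx C 1) : sx C 0 := sact C (dfc 0 1) e.
Definition tgt (e : sx C 1) : sx C 0 := sact C (dfc 0 0) e.

Lemma esrcE (e : sx C 1) : esrc e = src e.
Proof. by rewrite /esrc -dfc_face. Qed.
Lemma etgtE (e : sx C 1) : etgt e = tgt e.
Proof. by rewrite /etgt -dfc_face. Qed.

Lemma qc_isoE (e : sx C 1) :
  qc_iso e <-> exists e', [/\ src e' = tgt e, tgt e' = src e,
     qcomp e e' (eid (src e)) & qcomp e' e (eid (tgt e))].
Proof.
rewrite /qc_iso esrcE etgtE; split=> [[e' [E1 [E2 [[s [s1 [s2 s3]]] [t [t1 [t2 t3]]]]]]]|[e' [E1 E2 [s [s1 s2 s3]] [t [t1 t2 t3]]]]].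
  move: E1 E2 s1 s2 s3 t1 t2 t3; rewrite !esrcE !etgtE -!dfc_face => E1 E2 s1 s2 s3 t1 t2 t3.
  by exists e'; split=> //; [exists s|exists t].
exists e'; rewrite !esrcE !etgtE; do 2!split => //; split; [exists s|exists t]; by rewrite -!dfc_face.
Qed.

Lemma src_eid x : src (eid x) = x.
Proof. by rewrite /src /eid sactM // (dmap0_uniq (dcomp _ _) (did 0)) sact1. Qed.
Lemma tgt_eid x : tgt (eid x) = x.
Proof. by rewrite /tgt /eid sactM // (dmap0_uniq (dcomp _ _) (did 0)) sact1. Qed.

Lemma qcomp_ends f g h : qcomp f g h -> [/\ tgt f = src g, src h = src f & tgt h = tgt g].
Proof.
case=> s [<- <- <-]; rewrite /src /tgt !sactM //.
by split; congr (sact C _ _); apply: dmap_ext => i; rewrite !dE /bump /=; have := ltn_ord i; lia.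
Qed.

Lemma qcomp_id_l f : qcomp (eid (src f)) f f.
Proof.
exists (sact C (dpin 1 0) f); rewrite /eid /src /ddeg !sactM //; split;
  [|rewrite -[RHS](sact1 hC)|rewrite -[RHS](sact1 hC)];
  congr (sact C _ _); apply: dmap_ext => i; rewrite !dE /bump /=; have := ltn_ord i; lia.
Qed.

Lemma qcomp_id_r f : qcomp f (eid (tgt f)) f.
Proof.
exists (sact C (dpin 1 1) f); rewrite /eid /tgt /ddeg !sactM //; split;
  [rewrite -[RHS](sact1 hC)| |rewrite -[RHS](sact1 hC)];
  congr (sact C _ _); apply: dmap_ext => i; rewrite !dE /bump /=; have := ltn_ord i; lia.
Qed.

Lemma qc_iso_id (x : sx C 0) : qc_iso (eid x).
Proof.
apply/qc_isoE; exists (eid x); rewrite !src_eid !tgt_eid; split=> //.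
- by have := qcomp_id_l (eid x); rewrite src_eid.
- by have := qcomp_id_l (eid x); rewrite src_eid.
Qed.

Variable (hq : inner_fill C).

Lemma qcomp_ex f g : tgt f = src g -> exists h, qcomp f g h.
Proof.
move=> E; pose x j := match j with 0 => g | _ => f end.
have [|c Hc] := @hq 1 1 x isT isT.
  apply: compat_faces => //; first by move=> i [].
  by move=> [|[|[|i]]] [|[|[|j]]] [] // _ ? [] // _ ?.
by exists (sact C (dfc 1 1) c), c; rewrite (Hc 2) // (Hc 0).
Qed.

(** In a 3-simplex with spine [f], [g], [h] the faces 0, 1, 3 are given and the missing inner face 2
    is the claim. [qcomp_assoc_r] exchanges the faces 1 and 2. *)
Lemma qcomp_assoc_l f g a h b c :
  qcomp f g a -> qcomp g h b -> qcomp a h c -> qcomp f b c.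
Proof.
move=> [s [s1 s2 s3]] [t [t1 t2 t3]] [u [u1 u2 u3]].
pose x j := match j with 0 => t | 1 => u | _ => s end.
have [|w Hw] := @hq 2 2 x isT isT.
  apply: compat_faces => //; first by move=> i [].
  by move=> [|[|[|[|i]]]] [|[|[|[|j]]]] [] // _ ? [] // _ ? _ //=; congruence.
exists (sact C (dfc 2 2) w); rewrite -t3 -s1 -u3 -[t](Hw 0) // -[s](Hw 3) // -[u](Hw 1) // !sactM //.
by split; congr (sact C _ _); apply: dmap_ext => i; rewrite !dE /bump; lia.
Qed.

Lemma qcomp_assoc_r f g a h b c :
  qcomp f g a -> qcomp g h b -> qcomp f b c -> qcomp a h c.
Proof.
move=> [s [s1 s2 s3]] [t [t1 t2 t3]] [u [u1 u2 u3]].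
pose x j := match j with 0 => t | 2 => u | _ => s end.
have [|w Hw] := @hq 2 1 x isT isT.
  apply: compat_faces => //; first by move=> i [].
  by move=> [|[|[|[|i]]]] [|[|[|[|j]]]] [] // _ ? [] // _ ? _ //=; congruence.
exists (sact C (dfc 2 1) w); rewrite -t2 -s3 -u3 -[t](Hw 0) // -[s](Hw 3) // -[u](Hw 2) // !sactM //.
by split; congr (sact C _ _); apply: dmap_ext => i; rewrite !dE /bump; lia.
Qed.

Lemma qcomp_homot f g : qcomp (eid (src f)) f g -> qcomp g (eid (tgt g)) f /\ qcomp f (eid (tgt f)) g.
Proof.
move=> H; have [_ _ Et] := qcomp_ends H.
have Hg : qcomp g (eid (tgt g)) f.
  by rewrite Et; apply: qcomp_assoc_r H (qcomp_id_r f) (qcomp_id_l f).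
split=> //.
have Hid := qcomp_id_l (eid (tgt g)); rewrite src_eid in Hid.
by rewrite -Et; apply: qcomp_assoc_r Hg Hid (qcomp_id_r g).
Qed.

Lemma qc_iso_homot f g : qcomp (eid (src f)) f g -> qc_iso g -> qc_iso f.
Proof.
move=> H /qc_isoE[k [k1 k2 k3 k4]].
have [_ Es Et] := qcomp_ends H.
have [Hg Hf] := qcomp_homot H.
apply/qc_isoE; exists k.
rewrite src_eid in Es; rewrite -Et -Es; split=> //.
  apply: (qcomp_assoc_l Hf _ k3).
  by rewrite -Et -k1; exact: qcomp_id_l.
apply: (qcomp_assoc_l k4 Hg).
by have := qcomp_id_l (eid (tgt g)); rewrite src_eid.
Qed.

Lemma qc_iso_homot' f g : qcomp f (eid (tgt f)) g -> qc_iso g -> qc_iso f.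
Proof.
move=> H; have [_ Es Et] := qcomp_ends H; rewrite tgt_eid in Et.
apply: qc_iso_homot.
exact: (qcomp_assoc_l (qcomp_id_l f) (qcomp_id_r f) H).
Qed.

Lemma qc_iso_comp f g h : qcomp f g h -> qc_iso f -> qc_iso g -> qc_iso h.
Proof.
move=> H /qc_isoE[f' [f1 f2 f3 f4]] /qc_isoE[g' [g1 g2 g3 g4]].
have [E1 E2 E3] := qcomp_ends H.
have [|h' Hh'] := @qcomp_ex g' f'; first by rewrite g2 f1.
have [E4 E5 E6] := qcomp_ends Hh'.
have gh' : qcomp g h' f'.
  by apply: (qcomp_assoc_l g3 Hh'); rewrite -E1 -f1; exact: qcomp_id_l.
have f'h : qcomp f' h g.
  by apply: (qcomp_assoc_l f4 H); rewrite E1; exact: qcomp_id_l.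
apply/qc_isoE; exists h'; rewrite E5 E6 E2 E3; split=> //.
- exact: (qcomp_assoc_r H gh' f3).
- exact: (qcomp_assoc_r Hh' f'h g4).
Qed.

Lemma qc_iso_inv e : qc_iso e -> exists e', [/\ qc_iso e', qcomp e e' (eid (src e)) & qcomp e' e (eid (tgt e))].
Proof.
move=> /qc_isoE[e' [e1 e2 e3 e4]]; exists e'; split=> //.
by apply/qc_isoE; exists e; rewrite e1 e2.
Qed.

Lemma qc_iso_cancel_l f g h : qcomp f g h -> qc_iso f -> qc_iso h -> qc_iso g.
Proof.
move=> H /qc_iso_inv[f' [If' f3 f4]] Ih.
have [E1 E2 E3] := qcomp_ends H.
have [F1 _ _] := qcomp_ends f4.
have [|k Hk] := @qcomp_ex f' h; first by rewrite F1 E2.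
apply: (qc_iso_homot _ (qc_iso_comp Hk If' Ih)).
by rewrite -E1; apply: (qcomp_assoc_r f4 H Hk).
Qed.

Lemma qc_iso_cancel_r f g h : qcomp f g h -> qc_iso g -> qc_iso h -> qc_iso f.
Proof.
move=> H /qc_iso_inv[g' [Ig' g3 g4]] Ih.
have [E1 E2 E3] := qcomp_ends H.
have [F1 _ _] := qcomp_ends g3.
have [|k Hk] := @qcomp_ex h g'; first by rewrite E3 F1.
apply: (qc_iso_homot' _ (qc_iso_comp Hk Ih Ig')).
by rewrite E1; apply: (qcomp_assoc_l H g3 Hk).
Qed.

(** The edge [e'] has [e''] as inverse on one side and [e] on the other, so [e''] and [e] are
    homotopic and both are two-sided inverses. *)
Lemma qc_iso_lr e e' e'' : qcomp e' e (eid (tgt e)) -> qcomp e'' e' (eid (src e)) -> qc_iso e.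
Proof.
move=> H H'.
have [E1 E2 E3] := qcomp_ends H; have [E4 E5 E6] := qcomp_ends H'.
rewrite src_eid in E2 E5; rewrite tgt_eid in E3 E6.
have He : qcomp e'' (eid (tgt e)) e.
  exact: (qcomp_assoc_l H' H (qcomp_id_l e)).
have He2 : qcomp e (eid (tgt e)) e''.
  have Hid := qcomp_id_l (eid (tgt e)); rewrite src_eid in Hid.
  by apply: (qcomp_assoc_r He Hid); rewrite E2 -E4; exact: qcomp_id_r.
apply/qc_isoE; exists e'; split=> //.
by apply: (qcomp_assoc_l He2 _ H'); rewrite E2; exact: qcomp_id_l.
Qed.

End Comp.

(** * Special outer horns *)

Lemma dext_subproof n m (t : Dmap n m) i j : i <= j -> j <= n.+1 ->
  (if i <= n then dfun t (inord i) : nat else m.+1) <=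
  (if j <= n then dfun t (inord j) : nat else m.+1).
Proof.
move=> ij jn; case: (leqP j n) => jn'.
  by rewrite (leq_trans ij jn'); apply: dmono; rewrite !inordK //; lia.
by case: (leqP i n) => // _; exact: ltnW.
Qed.

(** The join of [t] with a point, the new last vertex going to the new last vertex. *)
Definition dext n m (t : Dmap n m) : Dmap n.+1 m.+1 := dmk m.+1 (dext_subproof t).

Lemma dextE n m (t : Dmap n m) i :
  dfun (dext t) i = (if i <= n then dfun t (inord i) : nat else m.+1) :> nat.
Proof.
rewrite dmkE; apply/minn_idPr; case: ifP => // _.
exact: ltnW.
Qed.

Lemma dext_did n : dext (did n) = did n.+1.
Proof.
apply: dmap_ext => i; rewrite dextE !dE; case: leqP => H; first by rewrite inordK.
by have := ltn_ord i; lia.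
Qed.

Lemma dext_comp n m p (t : Dmap n m) (u : Dmap m p) :
  dext (dcomp t u) = dcomp (dext t) (dext u).
Proof.
apply: dmap_ext => i; rewrite dextE !dcompE dextE; case: leqP => H.
  have E : dfun (dext t) i = dfun t (inord i) :> nat by rewrite dextE H.
  by rewrite E -ltnS ltn_ord inord_val.
by rewrite dextE (leqNgt i) H /= ltnn.
Qed.

Lemma dext_dfc n j : j <= n.+1 -> dext (dfc n j) = dfc n.+1 j.
Proof.
move=> H; apply: dmap_ext => i; rewrite dextE !dE; case: leqP => H'; first by rewrite inordK.
by have := ltn_ord i; rewrite /bump; lia.
Qed.

Lemma dfc_last n m (t : Dmap n m) : dcomp (dfc n n.+1) (dext t) = dcomp t (dfc m m.+1).
Proof.
apply: dmap_ext => i; rewrite dcompE dextE dcompE.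
have E : dfun (dfc n n.+1) i = i :> nat by rewrite dE /bump; have := ltn_ord i; lia.
rewrite E -ltnS ltn_ord inord_val dfcE /bump.
by have := ltn_ord (dfun t i); lia.
Qed.

(* The decalage; the last vertex of a simplex of X is the frozen one. *)
Definition Dec (X : sRaw) : sRaw := @SRaw (fun n => sx X n.+1) (fun n m t => sact X (dext t)).

Lemma Dec_sSet X : is_sSet X -> is_sSet (Dec X).
Proof.
move=> hX; split=> [n x|n m p t u x] /=; first by rewrite dext_did sact1.
by rewrite dext_comp sactM.
Qed.

Definition dec_last X (hX : is_sSet X) : sMap (Dec X) X.
Proof.
exists (fun n (x : sx (Dec X) n) => sact X (dfc n n.+1) x) => n m t x /=.
by rewrite !sactM // dfc_last.
Defined.

Definition PB (E B : sRaw) (q : sMap E B) n : Type :=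
  {p : sx E n * sx B n.+1 | smap q n p.1 = sact B (dfc n n.+1) p.2}.

Definition PB_act (E B : sRaw) (hB : is_sSet B) (q : sMap E B) n m (t : Dmap n m) (p : PB q m) : PB q n.
Proof.
exists (sact E t (proj1_sig p).1, sact B (dext t) (proj1_sig p).2) => /=.
by rewrite snat (proj2_sig p) !sactM // dfc_last.
Defined.

Definition PBR (E B : sRaw) (hB : is_sSet B) (q : sMap E B) : sRaw :=
  @SRaw (PB q) (@PB_act E B hB q).

Lemma PBR_sSet E B (hE : is_sSet E) (hB : is_sSet B) (q : sMap E B) : is_sSet (PBR hB q).
Proof.
split=> [n [[x y] Hx]|n m p t u [[x y] Hx]]; apply: sig_ext; rewrite /= ?dext_did ?sact1 //.
by rewrite dext_comp !sactM.
Qed.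

Definition PB_fst (E B : sRaw) (hB : is_sSet B) (q : sMap E B) : sMap (PBR hB q) E.
Proof. by exists (fun n (p : sx (PBR hB q) n) => (proj1_sig p).1). Defined.

Definition dec_map (E B : sRaw) (hE : is_sSet E) (hB : is_sSet B) (q : sMap E B) : sMap (Dec E) (PBR hB q).
Proof.
unshelve eexists.
  move=> n x; exists (sact E (dfc n n.+1) x, smap q n.+1 x) => /=; exact: snat.
move=> n m t x; apply: sig_ext => /=.
by rewrite !sactM // dfc_last snat.
Defined.

Definition right_fib (E B : sRaw) (q : sMap E B) : Prop :=
  forall n k (x : nat -> sx E n) (b : sx B n.+1), 0 < k -> k <= n.+1 ->
  compat (fun j => j <= n.+1 /\ j <> k) x ->
  (forall j, j <= n.+1 -> j <> k -> sact B (dfc n j) b = smap q n (x j)) ->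
  exists2 e : sx E n.+1,
    (forall j, j <= n.+1 -> j <> k -> sact E (dfc n j) e = x j) & smap q n.+1 e = b.

Lemma compat_map E B (q : sMap E B) n J (x : nat -> sx E n) :
  compat J x -> compat J (fun j => smap q n (x j)).
Proof. by move=> H r s s' i j Ji Jj e; rewrite -!snat (H _ _ s' _ j). Qed.

Lemma compat_dec X (hX : is_sSet X) n (J : nat -> Prop) (x : nat -> sx (Dec X) n) (e : sx X n.+1) :
  (forall i, J i -> i <= n.+1) -> (n = 0 -> forall i j, J i -> J j -> i = j) ->
  compat (W := Dec X) J x ->
  (forall i, J i -> sact X (dfc n i) e = sact X (dfc n n.+1) (x i)) ->
  compat (W := X) (fun j => j = n.+2 \/ J j) (fun j => if j == n.+2 then e else x j).
Proof.
move=> HJ HJ0 Hx He; apply: compat_faces => //.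
  by move=> i [->//|/HJ]; lia.
move=> i j Ji Jj ij.
have {}Ji : J i.
  by case: Ji => // E; case: Jj => [|/HJ]; lia.
have iN : (i == n.+2) = false by have := HJ _ Ji; lia.
rewrite iN; case: Jj => [->|Jj]; first by rewrite eqxx /= He.
have jN : (j == n.+2) = false by have := HJ _ Jj; lia.
rewrite jN; have Hi := HJ _ Ji; have Hj := HJ _ Jj.
case: n x e HJ0 Hx He Hi Hj {iN jN HJ} => [|n] x e HJ0 Hx He Hi Hj.
  by have := HJ0 erefl _ _ Ji Jj; lia.
have := Hx n (dfc n i) (dfc n j.-1) j i Jj Ji; rewrite /= !dext_dfc; [apply|lia|lia].
by rewrite -[in LHS](prednK (n := j)) ?dfc_fc //; lia.
Qed.

Section RightFib.

Lemma lt_horn n k : k <= n.+1 -> n = 0 -> forall i j,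
  i <= n.+1 /\ i <> k -> j <= n.+1 /\ j <> k -> i = j.
Proof. by move=> kn n0 i j; lia. Qed.

Lemma dec_map_RF E B (hE : is_sSet E) (hB : is_sSet B) (q : sMap E B) :
  right_fib q -> right_fib (dec_map hE hB q).
Proof.
move=> Hq n k x [[e b] /= eb] k0 kn Hx Hb.
have Hb1 j : j <= n.+1 -> j <> k -> sact E (dfc n j) e = sact E (dfc n n.+1) (x j).
  by move=> jn jk; have := congr1 (fun p => (proj1_sig p).1) (Hb j jn jk).
have Hb2 j : j <= n.+1 -> j <> k -> sact B (dfc n.+1 j) b = smap q n.+1 (x j).
  by move=> jn jk; have := congr1 (fun p => (proj1_sig p).2) (Hb j jn jk); rewrite /= dext_dfc.
have kn2 : (k == n.+2) = false by lia.
have [|j jn jk|c Hc qc] := Hq n.+1 k (fun j => if j == n.+2 then e else x j) b k0 (leqW kn).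
- have := compat_dec hE (e := e) _ (lt_horn kn) Hx; move=> H r s s' i j [i1 i2] [j1 j2].
  by apply: H => //=; [move=> i' []|move=> i' []; exact: Hb1|lia|lia].
- by case: eqP => [->|jn2]; [rewrite eb|apply: Hb2 => //; lia].
exists c => [j jn jk|].
  by rewrite /= dext_dfc // Hc //; [case: eqP => // E0; lia|lia].
apply: sig_ext; rewrite /= qc Hc ?eqxx //; lia.
Qed.

Lemma dec_last_RF X (hX : is_sSet X) : inner_fill X -> right_fib (dec_last hX).
Proof.
move=> Hq n k x b k0 kn Hx Hb.
have [|c Hc] := Hq n.+1 k (fun j => if j == n.+2 then b else x j) k0 kn.
  have := compat_dec hX (e := b) _ (lt_horn kn) Hx; move=> H r s s' i j [i1 i2] [j1 j2].
  by apply: H => //=; [move=> i' []|move=> i' []; exact: Hb|lia|lia].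
exists c => [j jn jk|].
  by rewrite /= dext_dfc // Hc //; [case: eqP => // E0; lia|lia].
by rewrite /= Hc ?eqxx //; lia.
Qed.

Lemma PB_fst_RF E B (hB : is_sSet B) (q : sMap E B) : inner_fill B -> right_fib (PB_fst hB q).
Proof.
move=> Hq n k x b k0 kn Hx Hb.
have Hx' : compat (W := Dec B) (fun j => j <= n.+1 /\ j <> k) (fun j => (proj1_sig (x j)).2).
  by move=> r s s' i j Ji Jj /(Hx r s s' i j Ji Jj) /(congr1 (fun p => (proj1_sig p).2)).
have [|c Hc] := Hq n.+1 k (fun j => if j == n.+2 then smap q _ b else (proj1_sig (x j)).2) k0 kn.
  have := compat_dec hB (e := smap q _ b) _ (lt_horn kn) Hx'; move=> H r s s' i j [i1 i2] [j1 j2].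
  apply: H => //=; [by move=> i' []| |lia|lia].
  by move=> i' [i'1 i'2]; rewrite -snat Hb //= (proj2_sig (x i')).
have Hp : smap q _ (b, c).1 = sact B (dfc n.+1 n.+2) (b, c).2.
  by rewrite /= Hc ?eqxx //; lia.
exists (exist _ (b, c) Hp : sx (PBR hB q) n.+1) => // j jn jk.
apply: sig_ext; rewrite /= Hb // dext_dfc // Hc //; last by lia.
have -> : (j == n.+2) = false by lia.
by rewrite /=; case: (proj1_sig (x j)).
Qed.

Lemma right_fib_fill E B (q : sMap E B) : right_fib q -> inner_fill B -> inner_fill E.
Proof.
move=> Hq HB n k x k0 kn Hx.
have [c Hc] := HB n k _ k0 kn (compat_map q Hx).
by have [e He _] := Hq n k x c k0 (ltnW kn) Hx Hc; exists e.
Qed.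

Section One.
Variables (E B : sRaw) (hE : is_sSet E) (hB : is_sSet B) (q : sMap E B).
Variables (Hq : right_fib q) (HB : inner_fill B).

Lemma src_map (e : sx E 1) : smap q 0 (src e) = src (smap q 1 e).
Proof. by rewrite /src snat. Qed.
Lemma tgt_map (e : sx E 1) : smap q 0 (tgt e) = tgt (smap q 1 e).
Proof. by rewrite /tgt snat. Qed.
Lemma eid_map (x : sx E 0) : smap q 1 (eid x) = eid (smap q 0 x).
Proof. by rewrite /eid snat. Qed.

Lemma lift22 (e h : sx E 1) (f : sx B 1) : tgt e = tgt h ->
  qcomp f (smap q 1 e) (smap q 1 h) -> exists2 g, qcomp g e h & smap q 1 g = f.
Proof.
move=> Et [s [s1 s2 s3]].
pose x j := match j with 0 => e | _ => h end.
have [||c Hc qc] := Hq (n := 1) (k := 2) (x := x) (b := s) isT isT.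
- apply: compat_faces => //; first by move=> i [].
  by move=> [|[|[|i]]] [|[|[|j]]] [] // _ ? [].
- by move=> [|[|[|j]]].
by exists (sact E (dfc 1 2) c); [exists c; rewrite (Hc 0) ?(Hc 1)|rewrite snat qc].
Qed.

(** [lift22] lifts an inverse of the image only to a one-sided inverse [e']. A second lift inverts
    [e'] on its other side, and [qc_iso_lr] concludes. *)
Lemma right_fib_iso e : qc_iso (smap q 1 e) -> qc_iso e.
Proof.
move=> /qc_isoE[f' [f1 f2 f3 f4]].
have [||e' He' qe'] := @lift22 e (eid (tgt e)) f'.
- by rewrite tgt_eid.
- by rewrite eid_map tgt_map.
have [E1 E2 E3] := qcomp_ends hE He'; rewrite src_eid // in E2.
have [||e'' He'' _] := @lift22 e' (eid (src e)) (smap q 1 e).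
- by rewrite tgt_eid // E1.
- by rewrite eid_map src_map qe'.
exact: (qc_iso_lr hE (right_fib_fill Hq HB) He' He'').
Qed.

(** A right fibration lifts edges with prescribed target. So the inverse of [b] is lifted first,
    ending at [x]; the triangle exhibiting [b] as its inverse then yields an edge starting at
    [x]. *)
Lemma lift_iso_edge (x : sx E 0) (b : sx B 1) : qc_iso b -> src b = smap q 0 x ->
  exists2 e, src e = x & smap q 1 e = b.
Proof.
move=> /qc_isoE[b' [b1 b2 b3 b4]] bx.
have [|j jn jk|e' He' qe'] := Hq (n := 0) (k := 1) (x := fun _ => x) (b := b') isT isT.
- by apply: compat0 => i [].
- have -> : j = 0 by lia. by rewrite -bx -b2.
have He'0 : tgt e' = x by apply: He'.
have [||e He qe] := @lift22 e' (eid x) b.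
- by rewrite tgt_eid.
- by rewrite eid_map qe' -bx.
by exists e => //; have [_ <- _] := qcomp_ends hE He; rewrite src_eid.
Qed.

End One.

Definition e01 n : Dmap 1 n.+1 := dmk n.+1 (fun i j (H : i <= j) (_ : j <= 1) => H).

Lemma e01E n i : dfun (e01 n) i = i :> nat.
Proof. by rewrite dE; have := ltn_ord i; lia. Qed.

(* Joyal's special outer horns: the outer face is peeled off by the decalage,
   which turns right fibrations into right fibrations. *)
Lemma right_fib_special n : forall E B (hE : is_sSet E) (hB : is_sSet B) (q : sMap E B)
    (x : nat -> sx E n) (b : sx B n.+1),
  right_fib q -> inner_fill B -> compat (fun j => j <= n.+1 /\ j <> 0) x ->
  (forall j, j <= n.+1 -> j <> 0 -> sact B (dfc n j) b = smap q n (x j)) ->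
  qc_iso (sact B (e01 n) b) ->
  exists2 e : sx E n.+1,
    (forall j, j <= n.+1 -> j <> 0 -> sact E (dfc n j) e = x j) & smap q n.+1 e = b.
Proof.
elim: n => [|n IH] E B hE hB q x b Hq HB Hx Hb Hi.
  have [||e He qe] := lift_iso_edge hE Hq (x := x 1) (b := b).
  - by move: Hi; congr (qc_iso _); rewrite -[RHS](sact1 hB); congr (sact B _ _);
      apply: dmap_ext => i; rewrite e01E dE.
  - exact: Hb.
  by exists e => // j jn j0; have -> : j = 1 by lia.
(* The face [x n.+2] opposite the last vertex moves into the base simplex; the remaining faces form
   a special horn one dimension lower. *)
have eb : smap q _ (x n.+2, b).1 = sact B (dfc n.+1 n.+2) (x n.+2, b).2.
  by rewrite /= Hb.
pose b' : sx (PBR hB q) n.+1 := exist _ (x n.+2, b) eb.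
have Hfst := @PB_fst_RF E B hB q HB.
have hP := PBR_sSet hE hB q.
have HE := right_fib_fill Hq HB.
have [|||j jn j0||e He qe] := IH _ _ (Dec_sSet hE) hP (dec_map hE hB q) x b'.
- exact: dec_map_RF.
- exact: (right_fib_fill Hfst HE).
- move=> r s s' i j [i1 i2] [j1 j2] /(congr1 (@dext _ _)); rewrite !dext_comp !dext_dfc //.
  by apply: Hx; lia.
- apply: sig_ext; rewrite /= dext_dfc // Hb //; last by lia.
  by congr (_, _); apply: (Hx _ _ _ n.+2 j); [lia|lia|rewrite dfc_fc].
(* Both [PB_fst] and [q] reflect isomorphisms, so the first edge need only be invertible in [B]. *)
- apply: (right_fib_iso hP Hfst HE); rewrite /=.
  apply: (right_fib_iso hE Hq HB); rewrite snat -Hb // sactM //.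
  move: Hi; congr (qc_iso _); congr (sact B _ _).
  by apply: dmap_ext => i; rewrite dE dfcE !e01E /bump; have := ltn_ord i; lia.
exists e; last by have := congr1 (fun p => (proj1_sig p).2) qe.
move=> j jn j0; case: (ltngtP j n.+2) => jn2; [|lia|].
  by rewrite -He /= ?dext_dfc //; lia.
by rewrite jn2; have := congr1 (fun p => (proj1_sig p).1) qe.
Qed.

End RightFib.

Lemma horn_vertex n (k : 'I_n.+2) q : in_horn k (dconst q k).
Proof.
apply/in_hornP; exists (if k == 0 :> nat then 1 else 0); have := ltn_ord k.
by case: eqP => k0 _; split; [lia|lia|move=> i; rewrite dE; lia|lia|lia|move=> i; rewrite dE; lia].
Qed.

Lemma horn_closed n (k : 'I_n.+2) q q' (t : Dmap q' q) (s : Dmap q n.+1) :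
  in_horn k s -> in_horn k (dcomp t s).
Proof.
move=> /in_hornP[j [j1 j2 j3]]; apply/in_hornP; exists j; split=> //; exact: misses_comp.
Qed.

(** The constant simplex at [k] lies in every horn at [k], so its value serves as the default off
    the horn. *)
Lemma horn_total (X : sRaw) n (k : 'I_n.+2) (h : forall q (s : Dmap q n.+1), in_horn k s -> sx X q) :
  exists hh : forall q, Dmap q n.+1 -> sx X q, forall q s (H : in_horn k s), hh q s = h q s H.
Proof.
exists (fun q s => match @idP (in_horn k s) with
    | ReflectT H => h q s H | ReflectF _ => h q (dconst q k) (horn_vertex k q) end) => q s H.
by case: {-}_ / idP => // H'; rewrite (bool_irrelevance H' H).
Qed.

(** The last vertex is excluded here and is reached through the opposite simplicial set. In
    dimension at least 2 the horn at 0 contains the edge [e01], so its mark can be required. *)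
Definition marked_fill (C : sRaw) (Mk : sx C 1 -> Prop) : Prop :=
  forall n (k : 'I_n.+3) (h : forall q (s : Dmap q n.+2), in_horn k s -> sx C q),
  (forall q q' (t : Dmap q' q) (s : Dmap q n.+2) (H : in_horn k s) (H' : in_horn k (dcomp t s)),
        h q' (dcomp t s) H' = sact C t (h q s H)) ->
  k < n.+2 -> (k = 0 :> nat -> forall H : in_horn k (e01 n.+1), Mk (h 1 (e01 n.+1) H)) ->
  exists c : sx C n.+2, forall q (s : Dmap q n.+2) (H : in_horn k s), sact C s c = h q s H.

Lemma kan_marked_fill Z : is_kan Z -> marked_fill (C := Z) (fun _ => True).
Proof. by move=> hZ n k h Hh _ _; exact: hZ. Qed.

(** A special horn of [Delta^n.+2] in [C] is a lifting problem one dimension lower against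
    [dec_last], whose base simplex is the face opposite the last vertex. *)
Lemma quasi_marked_fill C : is_sSet C -> is_quasicat C -> marked_fill (C := C) (@qc_iso C).
Proof.
move=> hC hq n k h Hh kn Hk.
case: (posnP k) => k0; last exact: hq.
have [hh Hhh] := horn_total h.
have hj j : j <> 0 -> j <= n.+2 -> in_horn k (dfc n.+1 j).
  move=> j0 jn; apply/in_hornP; exists j; split=> //; first by lia.
  by move=> i; rewrite -(dcomp1t (dfc n.+1 j)); exact: misses_fc.
have hj' q (s : Dmap q n.+1) j : j <> 0 -> j <= n.+2 -> in_horn k (dcomp s (dfc n.+1 j)).
  move=> j0 jn; apply/in_hornP; exists j; split=> //; first by lia.
  exact: misses_fc.
have E q (s : Dmap q n.+1) j : j <> 0 -> j <= n.+2 ->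
    hh q (dcomp s (dfc n.+1 j)) = sact C s (hh n.+1 (dfc n.+1 j)).
  by move=> j0 jn; rewrite (Hhh _ _ (hj' _ _ _ j0 jn)) (Hhh _ _ (hj _ j0 jn)); exact: Hh.
have [|||j jn j0||e He qe] :=
  @right_fib_special n _ _ (Dec_sSet hC) hC (dec_last hC) (fun j => hh n.+1 (dfc n.+1 j))
    (hh n.+1 (dfc n.+1 n.+2)).
- exact/dec_last_RF/quasi_inner_fill.
- exact: quasi_inner_fill.
- move=> r s s' i j [i1 i2] [j1 j2] /(congr1 (@dext _ _)); rewrite !dext_comp !dext_dfc //.
  by move=> Es; rewrite /= -!E; try lia; rewrite Es.
- by rewrite /= -!E; try lia; rewrite dfc_fc.
- rewrite -E //; have Ee : dcomp (e01 n) (dfc n.+1 n.+2) = e01 n.+1.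
    by apply: dmap_ext => i; rewrite dE dfcE !e01E /bump; have := ltn_ord i; lia.
  rewrite Ee; have H : in_horn k (e01 n.+1) by rewrite -Ee; exact: hj'.
  by rewrite (Hhh _ _ H); exact: Hk.
exists e; apply: faces_fill => // j H jn jk.
rewrite -(Hhh _ _ H); case: (ltngtP j n.+2) => jn2; [|lia|].
  by rewrite -[RHS]He ?dext_dfc //=; [rewrite dext_dfc|lia..].
by rewrite jn2.
Qed.

(** * Opposite simplicial sets *)

Section Opposite.

Definition drev n m (t : Dmap n m) : Dmap n m.
Proof.
exists [ffun i => rev_ord (dfun t (rev_ord i))].
apply: monobP => i j ij; rewrite !ffunE /=.
by apply: leq_sub2l; rewrite ltnS; apply: dmono; rewrite /=; lia.
Defined.

Lemma drevE n m (t : Dmap n m) i : dfun (drev t) i = rev_ord (dfun t (rev_ord i)).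
Proof. by rewrite /dfun /= ffunE. Qed.

Lemma drevK n m : involutive (@drev n m).
Proof. by move=> t; apply: dmap_ext => i; rewrite !drevE !rev_ordK. Qed.

Lemma drev_comp n m p (t : Dmap n m) (u : Dmap m p) : drev (dcomp t u) = dcomp (drev t) (drev u).
Proof. by apply: dmap_ext => i; rewrite !(dcompE, drevE) rev_ordK. Qed.

Lemma drev_id n : drev (did n) = did n.
Proof. by apply: dmap_ext => i; rewrite !(didE, drevE) rev_ordK. Qed.

Lemma drev_const n m j : drev (@dconst n m j) = dconst n (rev_ord j).
Proof. by apply: dmap_ext => i; rewrite !(dconstE, drevE). Qed.

Lemma drev_fc n j : j <= n.+1 -> drev (dfc n j) = dfc n (n.+1 - j).
Proof.
by move=> H; apply: dmap_ext => i; rewrite drevE /= !dfcE /= /bump; have := ltn_ord i; lia.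
Qed.

Definition opR (X : sRaw) : sRaw := @SRaw (sx X) (fun n m t => sact X (drev t)).

Lemma op_sSet X : is_sSet X -> is_sSet (opR X).
Proof.
move=> hX; split=> [n x|n m p t u x] /=; first by rewrite drev_id sact1.
by rewrite drev_comp sactM.
Qed.

Lemma in_horn_rev n (k : 'I_n.+1) q (s : Dmap q n) : in_horn (rev_ord k) s -> in_horn k (drev s).
Proof.
move=> /existsP[j /andP[jk /forallP H]]; apply/existsP; exists (rev_ord j); apply/andP; split.
  by apply: contra jk => /eqP <-; rewrite rev_ordK.
apply/forallP => i; rewrite drevE; apply: contra (H (rev_ord i)) => /eqP /rev_ord_inj.
by move/eqP.
Qed.

Lemma op_horn_fill X n (k : 'I_n.+1) : horn_fill X (rev_ord k) -> horn_fill (opR X) k.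
Proof.
move=> HX h Hh.
have hE q (s s' : Dmap q n) H H' : s = s' -> h q s H = h q s' H'.
  by move=> E; subst s'; rewrite (bool_irrelevance H H').
have [|c Hc] := HX (fun q s H => h q (drev s) (in_horn_rev H)).
  move=> q q' t s H H'.
  have H1 : in_horn k (dcomp (drev t) (drev s)) by rewrite -drev_comp; exact: in_horn_rev.
  by rewrite (hE _ _ _ _ H1) ?drev_comp // (Hh _ _ _ _ (in_horn_rev H)) /= drevK.
exists c => q s H /=.
have H1 : in_horn (rev_ord k) (drev s) by apply: in_horn_rev; rewrite rev_ordK.
by rewrite Hc; apply: hE; rewrite drevK.
Qed.

Lemma op_kan X : is_kan X -> is_kan (opR X).
Proof. by move=> hX n k n0; apply: op_horn_fill; exact: hX. Qed.

Lemma op_quasicat X : is_quasicat X -> is_quasicat (opR X).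
Proof.
by move=> hX n k k0 kn; apply: op_horn_fill; apply: hX => /=; have := ltn_ord k; lia.
Qed.

Lemma op_qc_iso X (e : sx X 1) : qc_iso (X := X) e <-> qc_iso (X := opR X) e.
Proof.
have S (f : sx X 1) : src (C := opR X) f = tgt (C := X) f by rewrite /src /= drev_fc.
have T (f : sx X 1) : tgt (C := opR X) f = src (C := X) f by rewrite /tgt /= drev_fc.
have I (x : sx X 0) : eid (X := opR X) x = eid (X := X) x.
  by rewrite /eid /= drev_const; congr (sact X (dconst _ _) _); apply: val_inj.
have Q (f g h : sx X 1) : qcomp (C := X) f g h <-> qcomp (C := opR X) g f h.
  by split=> -[s [s0 s1 s2]]; exists s; move: s0 s1 s2; rewrite /= !drev_fc.
split=> /qc_isoE[e' [e1 e2 e3 e4]]; apply/qc_isoE; exists e'; move: e1 e2 e3 e4;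
  by rewrite !S !T !I => e1 e2 e3 e4; split=> //; exact/Q.
Qed.

End Opposite.

(* Maps defined on a subcomplex A are total functions of which only the values on A matter. *)
Definition hep (C : sRaw) (Mk : sx C 1 -> Prop) (eps : 'I_2) : Prop :=
  forall (B : sRaw) (A : forall q, sx B q -> Prop),
  is_sSet B -> (forall q q' (t : Dmap q' q) b, A q b -> A q' (sact B t b)) ->
  forall (g : sMap B C) (h : forall q, sx B q -> Dmap q 1 -> sx C q),
  (forall q q' (t : Dmap q' q) b w, A q b -> h q' (sact B t b) (dcomp t w) = sact C t (h q b w)) ->
  (forall q b, A q b -> h q b (dconst q eps) = smap g q b) ->
  (forall b, A 0 b -> Mk (h 1 (sact B ddeg b) (did 1))) ->
  exists H : FunS B C 1,
    [/\ forall q b w, A q b -> fval H b w = h q b w,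
        forall q b, fval H b (dconst q eps) = smap g q b &
        forall b : sx B 0, Mk (fval H (sact B ddeg b) (did 1))].

Lemma hep_op C Mk : hep (C := opR C) Mk I2_0 -> hep (C := C) Mk I2_1.
Proof.
move=> HC B A hB hA g h Hh Hg Hm.
have E : rev_ord I2_0 = I2_1 by apply: val_inj.
have E' : rev_ord I2_1 = I2_0 by apply: val_inj.
have gn n m (t : Dmap n m) (x : sx (opR B) m) :
    smap g n (sact (opR B) t x) = sact (opR C) t (smap g m x) by rewrite /= snat.
have D : drev ddeg = ddeg by rewrite /ddeg drev_const; congr dconst; apply: val_inj.
have [|||||H [H1 H2 H3]] := HC (opR B) A _ _ (@SMap (opR B) (opR C) (smap g) gn) (fun q b w => h q b (drev w)).
- exact: op_sSet.
- by move=> q q' t b Ab; apply: hA.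
- by move=> q q' t b w Ab; rewrite /= drev_comp Hh.
- by move=> q b Ab; rewrite drev_const E /= Hg.
- by move=> b Ab; rewrite drev_id /= D; apply: Hm.
have Hn q q' (t : Dmap q' q) (x : sx B q) (s : Dmap q 1) :
    fval H (sact B t x) (drev (dcomp t s)) = sact C t (fval H x (drev s)).
  have := proj2_sig H q q' (drev t) x (drev s).
  by rewrite /= drevK -drev_comp.
exists (exist _ (fun q (b : sx B q) w => fval H b (drev w)) Hn); split.
- by move=> q b w Ab; rewrite /fval /= -[RHS]/(h q b w) -{2}[w]drevK; exact: H1.
- by move=> q b; rewrite /fval /= drev_const E'; exact: H2.
- by move=> b; have := H3 b; rewrite /fval /= D drev_id.
Qed.

(** * Prisms *)

Lemma FunR_sSet A C : is_sSet (FunR A C).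
Proof.
split=> [n F|n m p t u F] /=; last by rewrite fact_comp.
apply: sig_ext => /=; do 3!apply: functional_extensionality_dep => ?.
by rewrite dcompt1.
Qed.

Lemma FunS_ext A C p (F G : FunS A C p) :
  (forall q (x : sx A q) s, fval F x s = fval G x s) -> F = G.
Proof.
by move=> H; apply: sig_ext; do 3!apply: functional_extensionality_dep => ?; exact: H.
Qed.

Lemma fval_nat A C p (F : FunS A C p) q q' (t : Dmap q' q) x s :
  fval F (sact A t x) (dcomp t s) = sact C t (fval F x s).
Proof. exact: (proj2_sig F). Qed.

Lemma fval_fact A C p p' (t : Dmap p' p) (F : FunS A C p) q (x : sx A q) s :
  fval (fact t F) x s = fval F x (dcomp s t).
Proof. by []. Qed.

Lemma dth_subproof m j i k : i <= k -> k <= m -> (j < i : nat) <= (j < k).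
Proof. lia. Qed.

Definition dth m j : Dmap m 1 := dmk 1 (@dth_subproof m j).

Lemma dthE m j i : dfun (dth m j) i = (j < i) :> nat.
Proof. by rewrite dmkE; case: (j < i). Qed.

Definition dplus q m (s : Dmap q m) (w : Dmap q 1) : Dmap q m.+1.
Proof.
exists [ffun i => inord (dfun s i + dfun w i)]; apply: monobP => i j ij; rewrite !ffunE.
have := dmono s ij; have := dmono w ij; rewrite !inordK //;
  have := ltn_ord (dfun s i); have := ltn_ord (dfun w i);
  have := ltn_ord (dfun s j); have := ltn_ord (dfun w j); lia.
Defined.

Lemma dplusE q m (s : Dmap q m) (w : Dmap q 1) i :
  dfun (dplus s w) i = dfun s i + dfun w i :> nat.
Proof.
rewrite {1}/dfun /= ffunE inordK //.
have := ltn_ord (dfun s i); have := ltn_ord (dfun w i); lia.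
Qed.

Lemma dplus_comp q q' m (t : Dmap q' q) (s : Dmap q m) (w : Dmap q 1) :
  dcomp t (dplus s w) = dplus (dcomp t s) (dcomp t w).
Proof. by apply: dmap_ext => i; rewrite dplusE !dcompE dplusE. Qed.

Definition bd q n (s : Dmap q n) := exists2 j, j <= n & misses s j.

Lemma bd_comp q q' n (t : Dmap q' q) (s : Dmap q n) : bd s -> bd (dcomp t s).
Proof. by case=> j jn H; exists j => //; exact: misses_comp. Qed.

Lemma bd_fc n j q (t : Dmap q n) : j <= n.+1 -> bd (dcomp t (dfc n j)).
Proof. by move=> H; exists j => //; exact: misses_fc. Qed.

(* The prism Delta^1 x Delta^n.+1 is the union of the n.+2 simplices (s, w) with s + w = id,
   w = (dth j) and s = dpin j. *)
Section Prism.
Variables (C : sRaw) (hC : is_sSet C) (Mk : sx C 1 -> Prop) (hF : marked_fill Mk).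
Variables (n : nat) (x : nat -> FunS (Delta 1) C n) (g : sx C n.+1).
Hypothesis x_compat : compat (W := FunR (Delta 1) C) (fun j => j <= n.+1) x.
Hypothesis x_start : forall j q s, j <= n.+1 ->
  fval (x j) (dconst q I2_0 : sx (Delta 1) q) s = sact C s (sact C (dfc n j) g).
Hypothesis x_mark : Mk (fval (x n.+1) (did 1 : sx (Delta 1) 1) (dconst 1 ord0)).

Let bdry_ex : exists h : forall q, Dmap q n.+1 -> FunS (Delta 1) C q,
    forall q (s : Dmap q n) j, j <= n.+1 -> h q (dcomp s (dfc n j)) = fact s (x j).
Proof.
have dfl q : FunS (Delta 1) C q.
  exists (fun q' _ _ => sact C (dconst q' ord0) g) => q1 q2 t _ _ /=.
  by rewrite sactM // dconst_comp.
have [h Hh] := glue_faces (W := FunR (Delta 1) C) dfl x_compat; exists h => q s j jn; exact: Hh.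
Qed.

(** The given map on [Delta^1 x bd Delta^n.+1], glued from the [x j]; it is meaningful only for [s]
    in the boundary. *)
Let X q (w : Dmap q 1) (s : Dmap q n.+1) : sx C q :=
  fval (proj1_sig (constructive_indefinite_description _ bdry_ex) q s) (w : sx (Delta 1) q) (did q).

Let X_face q (w : Dmap q 1) (s : Dmap q n) j : j <= n.+1 ->
  X w (dcomp s (dfc n j)) = fval (x j) (w : sx (Delta 1) q) s.
Proof.
by move=> jn; rewrite /X; case: constructive_indefinite_description => h /= ->;
  rewrite // fval_fact dcomp1t.
Qed.

Let X_nat q q' (t : Dmap q' q) (w : Dmap q 1) (s : Dmap q n.+1) : bd s ->
  X (dcomp t w) (dcomp t s) = sact C t (X w s).
Proof.
case=> j jn js; rewrite (dfactor jn js) -dcompA !X_face //.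
exact: (fval_nat (A := Delta 1)).
Qed.

Let X_start q s : bd s -> X (dconst q I2_0) s = sact C s g.
Proof. by case=> j jn js; rewrite (dfactor jn js) X_face // x_start // sactM. Qed.

(** [c] is a candidate value on [(dth j, id)]: for [j <= n] this is the wall between the prism
    simplices [j] and [j.+1], for [j = n.+1] the start of the prism. *)
Let front j c := forall q (t : Dmap q n.+1), bd t -> sact C t c = X (dcomp t (dth _ j)) t.

(** The horn at vertex [j] has [c] as its face [j.+1], and all its other faces lie over the
    boundary. It is outer only for [j = 0]; its first edge is then [Delta^1] over the vertex 0,
    marked by [x_mark]. *)
Lemma prism_step j c : j <= n.+1 -> front j c ->
  exists e : sx C n.+2, sact C (dfc n.+1 j.+1) e = c /\
    forall q (t : Dmap q n.+2), bd (dcomp t (dpin n.+1 j)) ->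
      sact C t e = X (dcomp t (dth _ j)) (dcomp t (dpin n.+1 j)).
Proof.
move=> jn Hc.
pose h q (t : Dmap q n.+2) :=
  if excluded_middle_informative (bd (dcomp t (dpin n.+1 j))) then
    X (dcomp t (dth _ j)) (dcomp t (dpin n.+1 j)) else sact C (dcomp t (dpin n.+1 j)) c.
have jn3 : j < n.+3 by lia.
pose k := Ordinal jn3.
have hornE q (t : Dmap q n.+2) : in_horn k t -> ~ bd (dcomp t (dpin n.+1 j)) -> misses t j.+1.
  move=> /in_hornP[i [i1 i2 i3]] Hb i' E; apply: Hb.
  have ij : i <> j.+1 by move=> E'; apply: (i3 i'); rewrite E E'.
  have ij' : i <> j by exact: i2.
  exists (i - (j < i)); first by lia.
  by move=> l; rewrite !dE; have := i3 l; have := ltn_ord (dfun t l); lia.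
have [|||e He] := @hF n k (fun q t _ => h q t).
- move=> q q' t s H H'; rewrite /h.
  case: excluded_middle_informative => B1; case: excluded_middle_informative => B2 /=.
  + by rewrite !dcompA X_nat.
  + have Ms := hornE _ _ H B2.
    rewrite sactM // -dcompA Hc //.
    congr X; rewrite !dcompA; congr dcomp.
    by apply: dmap_ext => i; rewrite !dcompE !dthE dpinE; have := Ms i; have := ltn_ord (dfun s i); lia.
  + by case: B1; rewrite dcompA; exact: bd_comp.
  + by rewrite sactM // dcompA.
- by rewrite /=; lia.
- move=> j0 H; have {}j0 : j = 0 := j0; rewrite /h; case: excluded_middle_informative => B /=.
    have -> : dcomp (e01 n.+1) (dth n.+2 j) = did 1.
      by apply: dmap_ext => i; rewrite !dcompE dthE e01E didE; have := ltn_ord i; lia.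
    have -> : dcomp (e01 n.+1) (dpin n.+1 j) = dcomp (dconst 1 ord0) (dfc n n.+1).
      by apply: dmap_ext => i; rewrite !dcompE dpinE e01E dfcE dconstE /bump /=; have := ltn_ord i; lia.
    by rewrite X_face.
  case: B; exists n.+1 => // i; rewrite !dcompE dpinE e01E; have := ltn_ord i; lia.
exists e; split.
  have H : in_horn k (dfc n.+1 j.+1).
    apply/in_hornP; exists j.+1; rewrite /=; split; [lia|lia|].
    by rewrite -(dcomp1t (dfc n.+1 j.+1)); exact: misses_fc.
  rewrite (He _ _ H) /h.
  have -> : dcomp (dfc n.+1 j.+1) (dpin n.+1 j) = did n.+1.
    by apply: dmap_ext => i; rewrite dcompE dpinE dfcE didE /bump; have := ltn_ord i; lia.
  case: excluded_middle_informative => [[i i1 i2]|_] /=; last by rewrite sact1.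
  by case: (i2 (Ordinal (i1 : i < n.+2))); rewrite didE.
move=> q t B.
have H : in_horn k t.
  case: B => i i1 i2; apply/in_hornP; exists (i + (j <= i)); split=> /=; [lia|lia|].
  by move=> l E; apply: (i2 l); rewrite dcompE dpinE E; lia.
by rewrite (He _ _ H) /h; case: excluded_middle_informative.
Qed.

Lemma prism_simplices : exists e : nat -> sx C n.+2,
  [/\ forall j q (t : Dmap q n.+2), j <= n.+1 -> bd (dcomp t (dpin n.+1 j)) ->
        sact C t (e j) = X (dcomp t (dth _ j)) (dcomp t (dpin n.+1 j)),
      forall j, j <= n -> sact C (dfc n.+1 j.+1) (e j) = sact C (dfc n.+1 j.+1) (e j.+1) &
      sact C (dfc n.+1 n.+2) (e n.+1) = g].
Proof.
suff H k : k <= n.+1 -> exists e : nat -> sx C n.+2,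
  [/\ forall j q (t : Dmap q n.+2), n.+1 - k <= j -> j <= n.+1 -> bd (dcomp t (dpin n.+1 j)) ->
        sact C t (e j) = X (dcomp t (dth _ j)) (dcomp t (dpin n.+1 j)),
      forall j, n.+1 - k <= j -> j <= n -> sact C (dfc n.+1 j.+1) (e j) = sact C (dfc n.+1 j.+1) (e j.+1) &
      sact C (dfc n.+1 n.+2) (e n.+1) = g].
  by have [//|e [H1 H2 H3]] := H n.+1; exists e; split=> // *; [apply: H1 => //|apply: H2 => //]; lia.
(* The prism is filled downwards, from the simplex [n.+1] resting on [g] to the simplex 0, each
   filling providing the wall for the next. *)
elim: k => [|k IH] Hk.
  have [//|q t B|e [e1 e2]] := @prism_step n.+1 g.
    rewrite -X_start //; congr X; apply: dmap_ext => i.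
    by rewrite dconstE dcompE dthE /=; have := ltn_ord (dfun t i); lia.
  exists (fun _ => e); split=> [j q t j1 j2|j j1 j2|//]; last by lia.
  have -> : j = n.+1 by lia.
  exact: e2.
have [|e [H1 H2 H3]] := IH; first by lia.
pose j := n.+1 - k.+1.
have [||e' [e1 e2]] := @prism_step j (sact C (dfc n.+1 j.+1) (e j.+1)); first by lia.
  move=> q t B; rewrite sactM // H1; try by lia.
    have E : dcomp (dfc n.+1 j.+1) (dpin n.+1 j.+1) = did n.+1 by rewrite dfcK //; lia.
    rewrite !dcompA E dcompt1; congr X.
    by congr dcomp; apply: dmap_ext => i; rewrite dcompE !dthE dfcE /bump; lia.
  by rewrite dcompA dfcK ?dcompt1 //; lia.
exists (fun i => if i == j then e' else e i); split.
- move=> i q t i1 i2; case: eqP => [->|ij]; first exact: e2.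
  by apply: H1; lia.
- move=> i i1 i2.
  case: (i =P j) => [->|ij]; first by have -> : (j.+1 == j) = false by lia.
  by have -> : (i.+1 == j) = false; [lia|apply: H2; lia].
- by have -> : (n.+1 == j) = false by lia.
Qed.

(** Under this condition [(w, s)] factors through the simplex [j] of the prism by [dplus s w]. The
    choice [cut] is not natural in [q], so independence of [j] has to be shown. *)
Let valid q (w : Dmap q 1) (s : Dmap q n.+1) j :=
  forall i, (dfun w i = 0 :> nat -> dfun s i <= j) /\ (dfun w i <> 0 :> nat -> j <= dfun s i).

Let cut q (w : Dmap q 1) (s : Dmap q n.+1) : nat :=
  \max_(i < q.+1 | dfun w i == 0 :> nat) dfun s i.

Let cut_valid q (w : Dmap q 1) (s : Dmap q n.+1) : valid w s (cut w s) /\ cut w s <= n.+1.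
Proof.
split; last by apply/bigmax_leqP => i _; rewrite -ltnS.
move=> i; split=> Hi.
  by rewrite /cut (bigD1 i) /= ?leq_maxl //; apply/eqP.
apply/bigmax_leqP => l /eqP Hl; apply: dmono.
have H := @dmono _ _ w i l.
by case: (leqP l i) => // /ltnW /H; lia.
Qed.

Lemma prism_fill : exists phi : FunS (Delta 1) C n.+1,
  (forall j, j <= n.+1 -> fact (dfc n j) phi = x j) /\
  (forall q s, fval phi (dconst q I2_0 : sx (Delta 1) q) s = sact C s g).
Proof.
have [e [H1 H2 H3]] := prism_simplices.
(* If both [j] and [j.+1] are valid, [dplus s w] misses [j.+1] and factors through the wall on which
   the two simplices agree. *)
have indep q (w : Dmap q 1) s j k : valid w s j -> valid w s (j + k) -> j + k <= n.+1 ->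
    sact C (dplus s w) (e j) = sact C (dplus s w) (e (j + k)).
  elim: k => [|k IH] V1 V2 Hk; first by rewrite addn0.
  rewrite IH; [|done| |lia]; last first.
    by move=> i; have := V1 i; have := V2 i; lia.
  have M : misses (dplus s w) (j + k).+1.
    move=> i; rewrite dplusE; have := V1 i; have := V2 i; have := ltn_ord (dfun w i); lia.
  rewrite (dfactor _ M); last by lia.
  by rewrite -sactM // H2 ?sactM ?addnS //; lia.
have indep' q (w : Dmap q 1) s j k : valid w s j -> valid w s k -> j <= n.+1 -> k <= n.+1 ->
    sact C (dplus s w) (e j) = sact C (dplus s w) (e k).
  move=> V1 V2 jn kn; case/orP: (leq_total j k) => jk.
    by have := @indep q w s j (k - j); rewrite subnKC //; apply.
  by symmetry; have := @indep q w s k (j - k); rewrite subnKC //; apply.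
have Gn q q' (t : Dmap q' q) (w : sx (Delta 1) q) (s : Dmap q n.+1) :
    sact C (dplus (dcomp t s) (sact (Delta 1) t w)) (e (cut (sact (Delta 1) t w) (dcomp t s))) =
    sact C t (sact C (dplus s w) (e (cut w s))).
  rewrite sactM // dplus_comp; apply: indep'.
  - exact: (cut_valid _ _).1.
  - by move=> i /=; rewrite !dcompE; exact: (cut_valid w s).1.
  - exact: (cut_valid _ _).2.
  - exact: (cut_valid _ _).2.
pose phi : FunS (Delta 1) C n.+1 :=
  exist _ (fun q (w : sx (Delta 1) q) s => sact C (dplus s w) (e (cut w s))) Gn.
exists phi; split=> [j jn|q s].
  apply: FunS_ext => q w s; rewrite fval_fact -X_face // /fval /=.
  have [V Hn] := cut_valid w (dcomp s (dfc n j)).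
  set s' := dcomp s (dfc n j) in V Hn *.
  have E1 : dcomp (dplus s' w) (dpin n.+1 (cut w s')) = s'.
    apply: dmap_ext => i; rewrite dcompE dpinE dplusE; have := V i.
    by have := ltn_ord (dfun w i); have := ltn_ord (dfun s' i); lia.
  rewrite H1 ?E1 //; last by exact: bd_fc.
  congr X; apply: dmap_ext => i; rewrite dcompE dthE dplusE; have := V i.
  by have := ltn_ord (dfun w i); lia.
rewrite /fval /=.
rewrite (@indep' _ _ _ _ n.+1) //; first last.
- exact: (cut_valid _ _).2.
- by move=> i; rewrite dconstE /=; split=> //; rewrite -ltnS.
- exact: (cut_valid _ _).1.
rewrite -H3 sactM //; congr (sact C _ _).
apply: dmap_ext => i; rewrite dplusE dcompE dfcE dconstE /bump /=.
by have := ltn_ord (dfun s i); lia.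
Qed.

End Prism.

(** * Reedy induction over the simplices of a simplicial set *)

Lemma onto_le n m (t : Dmap n m) : (forall j, j <= m -> ~ misses t j) -> forall i, dfun t i <= i.
Proof.
move=> H [k Hk]; elim: k Hk => [|k IH] Hk /=.
  rewrite leqNgt; apply/negP => H0; apply: (H 0) => // i.
  by have := @dmono _ _ t (Ordinal Hk) i isT; lia.
have Hk' : k < n.+1 by lia.
have {}IH : dfun t (Ordinal Hk') <= k := IH Hk'; rewrite leqNgt; apply/negP => H0.
have Hm := ltn_ord (dfun t (Ordinal Hk)).
apply: (H (dfun t (Ordinal Hk')).+1); first by lia.
move=> i; case: (leqP i k) => ik.
  by have := @dmono _ _ t i (Ordinal Hk') ik; lia.
by have := @dmono _ _ t (Ordinal Hk) i ik; lia.
Qed.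

Lemma small_misses n m (t : Dmap n m) : n < m -> exists2 j, j <= m & misses t j.
Proof.
move=> nm; apply: NNPP => H.
have Ht : forall i, dfun t i <= i by apply: onto_le => j jm Hj; apply: H; exists j.
by apply: H; exists m => // i E; have := Ht i; have := ltn_ord i; lia.
Qed.

Lemma endo_misses n (t : Dmap n n) : t <> did n -> exists2 j, j <= n & misses t j.
Proof.
move=> tn; apply: NNPP => H; apply: tn; apply: dmap_ext => i; rewrite didE.
have Ht : forall i, dfun t i <= i by apply: onto_le => j jm Hj; apply: H; exists j.
apply/eqP; rewrite eqn_leq Ht /= leqNgt; apply/negP => Hi.
(* If [l] were the last index with [dfun t l < l], then [t] would miss the value [l]: smaller below
   by monotonicity, larger above. *)
suff IH k : k <= n -> exists2 i : 'I_n.+1, i >= k & dfun t i < i.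
  by have [//|l ln Hl] := IH n; apply: H; exists n => // l' E; have := Ht l'; have := @dmono _ _ t l' l; have := ltn_ord l; have := ltn_ord l'; lia.
elim: k => [|k IH] kn; first by exists i.
have [|l kl Hl] := IH; first by lia.
case: (ltngtP k l) kl => // kl _; first by exists l.
apply: NNPP => H1; apply: H; exists k; first by lia.
move=> l' E; case: (leqP l' k) => l'k.
  by have := @dmono _ _ t l' l; lia.
by apply: H1; exists l' => //; lia.
Qed.

(** The idempotent sending [i.+1] to [i]. Being fixed by it means being the degeneracy along
    [dpin n i] of the face [i.+1]. *)
Definition dphi n i : Dmap n.+1 n.+1 := dcomp (dpin n i) (dfc n i.+1).

Lemma dphiE n i k : i <= n -> dfun (dphi n i) k = (if k == i.+1 :> nat then i else k) :> nat.
Proof.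
move=> H; rewrite !dE /bump; have := ltn_ord k; case: eqP; lia.
Qed.

Lemma collapse n m (t : Dmap n.+1 m) : m <= n -> exists2 i, i <= n & dcomp (dphi n i) t = t.
Proof.
move=> mn; apply: NNPP => H.
suff IH k : forall Hk : k < n.+2, k <= dfun t (Ordinal Hk).
  by have := IH n.+1 (ltnSn _); have := ltn_ord (dfun t (Ordinal (ltnSn n.+1))); lia.
elim: k => [|k IH] Hk //.
have Hk' : k < n.+2 by lia.
rewrite ltn_neqAle; have {}IH := IH Hk'.
have := @dmono _ _ t (Ordinal Hk') (Ordinal Hk) (leqnSn k).
case: (ltngtP (dfun t (Ordinal Hk')) (dfun t (Ordinal Hk))) => // [|E _]; first by lia.
case: H; exists k; first by lia.
apply: dmap_ext => i; rewrite dcompE.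
case: (i =P k.+1 :> nat) => ik.
  have -> : dfun (dphi n k) i = Ordinal Hk' by apply: ord_inj; rewrite dphiE ?ik ?eqxx //; lia.
  by rewrite E; congr (nat_of_ord (dfun t _)); apply: val_inj.
have -> // : dfun (dphi n k) i = i.
by apply: ord_inj; rewrite dphiE; [case: eqP|lia].
Qed.

(** Since [i < j], [dphi n j] fixes [i] and [i.+1], which [dpin n i] then identifies. With [i] and
    [j = i.+1] exchanged this fails, whence the ordering of the degeneracy directions below. *)
Lemma dphi_pin n i j : i < j -> j <= n ->
  dcomp (dphi n i) (dcomp (dphi n j) (dpin n i)) = dcomp (dphi n j) (dpin n i).
Proof.
move=> ij jn; apply: dmap_ext => k; rewrite [in LHS]dcompE (dcompE _ (dpin n i)) (dcompE _ (dpin n i)) !dpinE !dphiE //; last by lia.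
by do ![case: ifP]; have := ltn_ord k; lia.
Qed.

Section Reedy.
Variables (K : sRaw) (I : Type).
Variable Y : forall n, sx K n -> I -> Type.
Variable Ymap : forall n m (t : Dmap n m) (s : sx K n) (r : sx K m),
  sact K t r = s -> forall p, Y r p -> Y s p.
Hypothesis hK : is_sSet K.
Hypothesis Yirr : forall n m (t : Dmap n m) s r (h h' : sact K t r = s) p (y : Y r p),
  Ymap h y = Ymap h' y.
Hypothesis Yid : forall n (s : sx K n) (h : sact K (did n) s = s) p (y : Y s p), Ymap h y = y.
Hypothesis Ycomp : forall n m l (t : Dmap n m) (u : Dmap m l)
    (s : sx K n) (r : sx K m) (o : sx K l)
    (h1 : sact K t r = s) (h2 : sact K u o = r) (h3 : sact K (dcomp t u) o = s) p (y : Y o p),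
  Ymap h3 y = Ymap h1 (Ymap h2 y).
Variable X : I -> sRaw.
Hypothesis hX : forall p, is_sSet (X p).

(** With [I] and [Y] trivial, a natural family is a map from [K] to [X]. With [I] the dimensions and
    [Y s p] the [p]-simplices of a functor at [s], it is the co-Yoneda form of a transformation, up
    to naturality in [p], which is left to [Ok]. *)
Definition fam_at n := forall s p, @Y n s p -> sx (X p) n.
Definition fam := forall n, fam_at n.
Variable dfl : fam.
Variable Ok : forall n (s : sx K n), (forall p, Y s p -> sx (X p) n) -> Prop.

Definition nat_upto N (F : fam) := forall n m (t : Dmap n m) s r (h : sact K t r = s) p (y : Y r p),
  n < N -> m < N -> F n s p (Ymap h y) = sact (X p) t (F m r p y).
Definition ok_upto N (F : fam) := forall n s, n < N -> Ok (F n s).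

Definition yface n j (s : sx K n.+1) p (y : Y s p) : Y (sact K (dfc n j) s) p :=
  Ymap (erefl (sact K (dfc n j) s)) y.

Definition fixes n i (s : sx K n.+1) p (y : Y s p) :=
  exists h : sact K (dphi n i) s = s, Ymap h y = y.

Lemma Ymap_eq n m (t t' : Dmap n m) s r (h : sact K t r = s) (h' : sact K t' r = s) p (y : Y r p) :
  t = t' -> Ymap h y = Ymap h' y.
Proof. by move=> E; subst t'; exact: Yirr. Qed.

Lemma sact_comp n m l (t : Dmap n m) (u : Dmap m l) s r o :
  sact K t r = s -> sact K u o = r -> sact K (dcomp t u) o = s.
Proof. by move=> <- <-; rewrite sactM. Qed.

Lemma YmapM n m l (t : Dmap n m) (u : Dmap m l) s r o (h1 : sact K t r = s) (h2 : sact K u o = r) p (y : Y o p) :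
  Ymap h1 (Ymap h2 y) = Ymap (sact_comp h1 h2) y.
Proof. by rewrite (Ycomp h1 h2). Qed.

Definition latching n (F : fam) (s : sx K n.+1) (lam : forall p, Y s p -> sx (X p) n.+1) : Prop :=
  (forall i p (y : Y s p), i <= n -> fixes i y ->
     lam p y = sact (X p) (dpin n i) (F n _ p (yface i.+1 y))) /\
  (forall i p (y : Y s p), i <= n -> fixes i y -> forall j, j <= n.+1 ->
     sact (X p) (dfc n j) (lam p y) = F n _ p (yface j y)).

(* On a degenerate y the value is forced; two degeneracy directions i < j give the same value
   because of the relation dphi_pin. *)
Lemma latching_ex n F : nat_upto n.+1 F -> forall s : sx K n.+1, exists lam, latching F (s := s) lam.
Proof.
move=> HF s.
have fixface i p (y : Y s p) j : i <= n -> fixes i y ->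
    F n _ p (yface j y) = sact (X p) (dcomp (dfc n j) (dpin n i)) (F n _ p (yface i.+1 y)).
  move=> Hi [h Hy].
  have h1 : sact K (dcomp (dfc n j) (dpin n i)) (sact K (dfc n i.+1) s) = sact K (dfc n j) s.
    by rewrite -[in RHS]h !sactM // !dcompA.
  rewrite -(HF _ _ _ _ _ h1) //; congr F; rewrite -{1}Hy /yface !YmapM.
  by apply: Ymap_eq; rewrite !dcompA.
have indep i j p (y : Y s p) : i < j -> j <= n -> fixes i y -> fixes j y ->
    sact (X p) (dpin n i) (F n _ p (yface i.+1 y)) = sact (X p) (dpin n j) (F n _ p (yface j.+1 y)).
  move=> ij jn fi fj.
  have Ej := fixface i _ y j.+1 (ltnW (leq_trans ij jn)) fi.
  have Ei := fixface j _ y i.+1 jn fj.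
  rewrite {1}Ei Ej !sactM //; congr (sact _ _ _).
  by rewrite -[RHS]dcompA -/(dphi n j) -dphi_pin // /dphi !dcompA.
have indep' i j p (y : Y s p) : i <= n -> j <= n -> fixes i y -> fixes j y ->
    sact (X p) (dpin n i) (F n _ p (yface i.+1 y)) = sact (X p) (dpin n j) (F n _ p (yface j.+1 y)).
  by move=> Hi Hj fi fj; case: (ltngtP i j) => [ij|ji|->//]; [exact: indep|symmetry; exact: indep].
exists (fun p y => epsilon (inhabits (dfl y)) (fun w => exists i, [/\ i <= n, fixes i y &
  w = sact (X p) (dpin n i) (F n _ p (yface i.+1 y))])).
have E i p (y : Y s p) : i <= n -> fixes i y -> 
   epsilon (inhabits (dfl y)) (fun w => exists i, [/\ i <= n, fixes i y &
  w = sact (X p) (dpin n i) (F n _ p (yface i.+1 y))]) = sact (X p) (dpin n i) (F n _ p (yface i.+1 y)).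
  move=> Hi fi; set P := fun w => _.
  have : P (epsilon (inhabits (dfl y)) P) by apply: epsilon_spec; eexists; exists i.
  by case=> j [jn fj ->]; exact: indep'.
split=> [i p y Hi fi|i p y Hi fi j jn]; first exact: E.
by rewrite (E i) // sactM // -fixface.
Qed.

Hypothesis step0 : forall s : sx K 0, exists phi : (forall p, Y s p -> sx (X p) 0), Ok phi.
Hypothesis stepS : forall n F, nat_upto n.+1 F -> ok_upto n.+1 F ->
  forall (s : sx K n.+1) lam, latching F (s := s) lam ->
  exists phi : forall p, Y s p -> sx (X p) n.+1,
   [/\ Ok phi,
       forall j p (y : Y s p), j <= n.+1 -> sact (X p) (dfc n j) (phi p y) = F n _ p (yface j y) &
       forall i p (y : Y s p), i <= n -> fixes i y -> phi p y = lam p y].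

Definition upd (F : fam) n (phi : fam_at n) : fam := fun m =>
  match PeanoNat.Nat.eq_dec n m with
  | left e => match e in _ = m return fam_at m with erefl => phi end
  | right _ => F m
  end.

Arguments upd : clear implicits.

Lemma upd_eq F n (phi : fam_at n) : upd F n phi n = phi.
Proof.
rewrite /upd; case: PeanoNat.Nat.eq_dec => // e.
by rewrite (eq_irrelevance e erefl).
Qed.

Lemma upd_neq F n (phi : fam_at n) m : n <> m -> upd F n phi m = F m.
Proof. by rewrite /upd; case: PeanoNat.Nat.eq_dec. Qed.

(** Naturality is checked by kinds of maps: those from a lower dimension miss a value and pass
    through a face; those to a lower dimension repeat a value and absorb some [dphi n i]; an
    endomorphism other than the identity passes through a face, which reduces it to the second
    kind. *)
Lemma reedy_next N F : nat_upto N F -> ok_upto N F ->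
  exists F' : fam, [/\ nat_upto N.+1 F', ok_upto N.+1 F' & forall m, m < N -> F' m = F m].
Proof.
case: N => [|n] HF OF.
  pose c s := constructive_indefinite_description _ (step0 s).
  exists (upd F 0 (fun s => proj1_sig (c s))); split=> //.
    move=> [|//] [|//] t s r h p y _ _.
    have tE : t = did 0 by exact: dmap0_uniq.
    subst t; have rs : r = s by rewrite -h sact1.
    by subst r; rewrite Yid sact1.
  by move=> [|//] s _; rewrite upd_eq; exact: (proj2_sig (c s)).
pose lam s := proj1_sig (constructive_indefinite_description _ (latching_ex HF s)).
have lamP s : latching F (lam s) := proj2_sig (constructive_indefinite_description _ (latching_ex HF s)).
pose c s := constructive_indefinite_description _ (stepS HF OF (lamP s)).
pose phi s := proj1_sig (c s).
have phi1 s : Ok (phi s) by rewrite /phi; case: (c s) => f /= [].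
have phi2 s j p (y : Y s p) : j <= n.+1 -> sact (X p) (dfc n j) (phi s p y) = F n _ p (yface j y).
  by rewrite /phi; case: (c s) => f /= [_ H _]; exact: H.
have phi3 s i p (y : Y s p) : i <= n -> fixes i y ->
    phi s p y = sact (X p) (dpin n i) (F n _ p (yface i.+1 y)).
  move=> Hi fi; rewrite /phi; case: (c s) => f /= [_ _ H]; rewrite (H i) //.
  exact: (lamP s).1.
have updE m : m < n.+1 -> upd F n.+1 phi m = F m by move=> mn; apply: upd_neq; lia.
have down m (t : Dmap m n.+1) s r (h : sact K t r = s) p (y : Y r p) : m < n.+1 ->
    F m s p (Ymap h y) = sact (X p) t (phi r p y).
  move=> mn; have [j jn jt] := small_misses t mn.
  have h1 : sact K (dcomp t (dpin n j)) (sact K (dfc n j) r) = s.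
    by rewrite sactM // -dfactor.
  rewrite {2}(dfactor jn jt) -sactM // phi2 // -(HF _ _ _ _ _ h1) //; congr F.
  by rewrite /yface YmapM; apply: Ymap_eq; rewrite -dfactor.
have up m (t : Dmap n.+1 m) s r (h : sact K t r = s) p (y : Y r p) : m < n.+1 ->
    phi s p (Ymap h y) = sact (X p) t (F m r p y).
  move=> mn; have [i Hi it] := collapse t mn.
  have h1 : sact K (dphi n i) s = s by rewrite -h sactM // it.
  have fi : fixes i (Ymap h y) by exists h1; rewrite YmapM; exact: Ymap_eq.
  rewrite (phi3 _ i) // /yface YmapM HF //.
  by rewrite sactM // -dcompA -/(dphi n i) it.
exists (upd F n.+1 phi); split=> //.
- move=> a b t s r h p y an bn.
  have {}an : a < n.+1 \/ a = n.+1 by lia.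
  have {}bn : b < n.+1 \/ b = n.+1 by lia.
  case: an => an; case: bn => bn.
  + by rewrite !updE //; apply HF.
  + by subst b; rewrite updE // upd_eq; exact: down.
  + by subst a; rewrite upd_eq updE //; exact: up.
  + subst a; subst b; rewrite upd_eq; case: (classic (t = did n.+1)) => [tE|tn].
      subst t; have rs : r = s by rewrite -h sact1.
      by subst r; rewrite Yid sact1.
    have [j jn jt] := endo_misses tn.
    have h1 : sact K (dcomp t (dpin n j)) (sact K (dfc n j) r) = s.
      by rewrite sactM // -dfactor.
    rewrite {2}(dfactor jn jt) -sactM // phi2 // -(up _ _ _ _ h1) //; congr phi.
    by rewrite /yface YmapM; apply: Ymap_eq; rewrite -dfactor.
- move=> a s an; have {an} [an|an] : a < n.+1 \/ a = n.+1 by lia.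
    by rewrite updE //; apply OF.
  by subst a; rewrite upd_eq.
Qed.

Theorem reedy_ext : exists F : fam,
  (forall n m (t : Dmap n m) s r (h : sact K t r = s) p (y : Y r p),
     F n s p (Ymap h y) = sact (X p) t (F m r p y)) /\
  (forall n s, Ok (F n s)).
Proof.
pose S N := {F : fam | nat_upto N F /\ ok_upto N F}.
have nxt N (F : S N) : {F' : S N.+1 | forall m, m < N -> proj1_sig F' m = proj1_sig F m}.
  apply: constructive_indefinite_description; case: F => F [F1 F2].
  have [F' [F1' F2' E]] := reedy_next F1 F2.
  by exists (exist _ F' (conj F1' F2')).
have S0 : S 0 by exists dfl.
pose G := fix G N : S N := match N with 0 => S0 | M.+1 => proj1_sig (nxt M (G M)) end.
have GE k N m : m < N -> proj1_sig (G (N + k)) m = proj1_sig (G N) m.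
  move=> mN; elim: k => [|k IH]; first by rewrite addn0.
  rewrite addnS -IH /=; apply: (proj2_sig (nxt (N + k) (G (N + k)))); lia.
exists (fun n => proj1_sig (G n.+1) n); split=> [n m t s r h p y|n s].
  rewrite -(GE m n.+1 n) // -(GE n m.+1 m) // (_ : m.+1 + n = n.+1 + m); last by lia.
  by apply: (proj2_sig (G (n.+1 + m))).1; lia.
exact: (proj2_sig (G n.+1)).2.
Qed.

End Reedy.

(** * Homotopy extension *)

(** A homotopy is built as a map [B -> Fun(Delta^1, C)]: forced on [A] and on degenerate simplices,
    a prism filling elsewhere. [Ok] carries the marks at the vertices, which the next prism
    requires. *)
Lemma marked_fill_hep C (hC : is_sSet C) (Mk : sx C 1 -> Prop) :
  marked_fill Mk -> (forall x : sx C 0, Mk (eid x)) -> hep Mk I2_0.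
Proof.
move=> hF Mid B A hB hA g h Hh Hg Hm.
have gconst n (b : sx B n) : exists G : FunS (Delta 1) C n,
    forall q w s, @fval (Delta 1) C n G q w s = sact C s (smap g n b).
  unshelve eexists; first exists (fun q _ s => sact C s (smap g n b)); last by [].
  by move=> q q' t w s; rewrite sactM.
have hconst n (b : sx B n) : A n b -> exists G : FunS (Delta 1) C n,
    forall q w s, @fval (Delta 1) C n G q w s = h q (sact B s b) w.
  move=> Ab; unshelve eexists; first exists (fun q w s => h q (sact B s b) w); last by [].
  by move=> q q' t w s /=; rewrite -sactM // Hh //; exact: hA.
pose Ok n (b : sx B n) (phi : unit -> unit -> FunS (Delta 1) C n) :=
  [/\ A n b -> forall q w s, @fval (Delta 1) C n (phi tt tt) q w s = h q (sact B s b) w,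
      forall q s, @fval (Delta 1) C n (phi tt tt) q (dconst q I2_0) s = sact C s (smap g n b) &
      forall v : Dmap 0 n, Mk (@fval (Delta 1) C n (phi tt tt) 1 (did 1) (dcomp ddeg v))].
have OkA n (b : sx B n) (Ab : A n b) (G : FunS (Delta 1) C n) :
    (forall q w s, @fval (Delta 1) C n G q w s = h q (sact B s b) w) ->
    Ok n b (fun _ _ => G).
  move=> HG; split=> [_|q s|v]; first exact: HG.
    by rewrite HG Hg ?snat //; exact: hA.
  by rewrite HG -sactM //; apply: Hm; exact: hA.
have [||||||F [F1 F2]] := @reedy_ext B unit (fun _ _ _ => unit) (fun _ _ _ _ _ _ _ y => y) hB
  _ _ _ (fun _ => FunR (Delta 1) C) _ (fun n b _ _ => proj1_sig (constructive_indefinite_description _ (gconst n b))) Ok.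
- by [].
- by [].
- by [].
- by move=> _; exact: FunR_sSet.
- move=> b; case: (classic (A 0 b)) => Ab.
    have [G HG] := hconst _ _ Ab; exists (fun _ _ => G); exact: OkA.
  have [G HG] := gconst _ b; exists (fun _ _ => G); split=> [//|q s|v]; rewrite HG //.
  by rewrite (dmap0_uniq v (did 0)) dcompt1; exact: Mid.
- move=> n F HF OF b lam [L1 L2].
  have OFn j := OF n (sact B (dfc n j) b) (ltnSn n).
  case: (classic (A n.+1 b)) => Ab.
    have [G HG] := hconst _ _ Ab; exists (fun _ _ => G); split; first exact: OkA.
      move=> j [] [] jn; apply: FunS_ext => q w s; have [O1 _ _] := OFn j.
      by rewrite O1 ?fval_fact ?HG ?sactM //; exact: hA.
    move=> i [] [] Hi fi; rewrite (L1 i) //.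
    apply: FunS_ext => q w s; have [O1 _ _] := OFn i.+1.
    have [hi _] := fi.
    rewrite fval_fact O1 ?HG; last exact: hA.
    by rewrite sactM // dcompA -sactM // hi.
  case: (classic (exists2 i, i <= n & sact B (dphi n i) b = b)) => [[i Hi Ei]|ND].
    have fi : fixes (fun _ _ _ _ _ _ _ y => y) (Y := fun _ _ _ => unit) i (s := b) (p := tt) tt by exists Ei.
    have [O1 O2 O3] := OFn i.+1.
    have El := L1 i tt tt Hi fi.
    exists lam; split=> //; last by move=> j [] [] jn; exact: (L2 i).
    split=> [//|q s|v]; rewrite El fval_fact.
      by rewrite O2 snat !sactM // dcompA -/(dphi n i) -[in RHS]Ei snat sactM.
    by rewrite dcompA; exact: O3.
  have [|j q s jn||phi [P1 P2]] := @prism_fill C hC Mk hF n (fun j => F n (sact B (dfc n j) b) tt tt) (smap g _ b).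
  + case: n F HF OF b lam L1 L2 OFn Ab ND => [|n] F HF OF b lam L1 L2 OFn Ab ND.
      exact: compat0.
    apply: compat_faces => //; first exact: FunR_sSet.
    move=> i j Hi Hj ij.
    have hs : sact B (dfc n j.-1) (sact B (dfc n.+1 i) b) = sact B (dfc n i) (sact B (dfc n.+1 j) b).
      by rewrite !sactM // -[j in RHS](prednK (n := j)) ?dfc_fc //; lia.
    by rewrite -(HF _ _ _ _ _ hs) // -(HF _ _ _ _ _ erefl).
  + by have [_ O2 _] := OFn j; rewrite O2 snat.
  + have [_ _ O3] := OFn n.+1; have := O3 (dconst 0 ord0).
    by rewrite dconst_comp.
  exists (fun _ _ => phi); split.
  + split=> // v; have [j jn jv] := @small_misses 0 n.+1 v isT.
    rewrite (dfactor jn jv) -dcompA -fval_fact P1 //.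
    by have [_ _ O3] := OFn j; exact: O3.
  + by move=> j [] [] jn; exact: P1.
  + by move=> i [] [] Hi [hi _]; case: ND; exists i.
have Hn q q' (t : Dmap q' q) (b : sx B q) (w : Dmap q 1) :
    @fval (Delta 1) C q' (F q' (sact B t b) tt tt) q' (dcomp t w) (did q') =
    sact C t (@fval (Delta 1) C q (F q b tt tt) q w (did q)).
  rewrite (F1 _ _ t _ b erefl tt tt) fval_fact dcomp1t -{2}(dcompt1 t).
  exact: (fval_nat (A := Delta 1)).
exists (exist _ (fun q b w => @fval (Delta 1) C q (F q b tt tt) q w (did q)) Hn).
split=> [q b w Ab|q b|b]; rewrite /fval /=.
- by have [O1 _ _] := F2 q b; have := O1 Ab q w (did q); rewrite sact1.
- by have [_ O2 _] := F2 q b; have := O2 q (did q); rewrite sact1.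
- have [_ _ O3] := F2 1 (sact B ddeg b); have := O3 (dconst 0 ord0).
  rewrite (F1 _ _ ddeg _ b erefl tt tt) !fval_fact dcompA.
  rewrite (dmap0_uniq (dcomp (dconst 0 ord0) ddeg) (did 0)) dcompt1.
  by rewrite /= dcomp1t.
Qed.

Definition square_closed (C : sRaw) (Mk : sx C 1 -> Prop) : Prop :=
  forall S : FunS (Delta 1) C 1,
  Mk (@fval (Delta 1) C 1 S 1 (dconst 1 I2_0) (did 1)) ->
  Mk (@fval (Delta 1) C 1 S 1 (dconst 1 I2_1) (did 1)) ->
  (Mk (@fval (Delta 1) C 1 S 1 (did 1) (dconst 1 I2_0)) <->
   Mk (@fval (Delta 1) C 1 S 1 (did 1) (dconst 1 I2_1))).

(* Two instances: the equivalences of a quasi-category, and all the edges of a Kan complex. *)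
Definition equifibrant (C : sRaw) (Mk : sx C 1 -> Prop) : Prop :=
  (forall eps : 'I_2, hep Mk eps) /\ square_closed Mk.

Lemma hep_both C (Mk : sx C 1 -> Prop) : hep Mk I2_0 -> hep Mk I2_1 -> forall eps : 'I_2, hep Mk eps.
Proof.
move=> H0 H1 [[|[|//]] H].
- by rewrite (_ : Ordinal H = I2_0) //; apply: ord_inj.
- by rewrite (_ : Ordinal H = I2_1) //; apply: ord_inj.
Qed.

Lemma kan_equifibrant Z : is_sSet Z -> is_kan Z -> equifibrant (C := Z) (fun _ => True).
Proof.
move=> hZ kZ; split; last by [].
apply: hep_both; first by apply: marked_fill_hep => //; exact: kan_marked_fill.
apply: hep_op; apply: marked_fill_hep => //; first exact: op_sSet.
by apply: kan_marked_fill; exact: op_kan.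
Qed.

Lemma quasi_equifibrant C : is_sSet C -> is_quasicat C -> equifibrant (@qc_iso C).
Proof.
move=> hC qC; split.
  apply: hep_both.
    by apply: marked_fill_hep => //; [exact: quasi_marked_fill|exact: qc_iso_id].
  have hO := op_sSet hC.
  have EO (e : sx C 1) : qc_iso (X := opR C) e = qc_iso (X := C) e.
    by apply: propositional_extensionality; split; [exact: (@op_qc_iso C e).2|exact: (@op_qc_iso C e).1].
  apply: hep_op.
  have -> : (@qc_iso C) = (@qc_iso (opR C)) by apply: functional_extensionality => e; rewrite EO.
  apply: marked_fill_hep => //; [|exact: qc_iso_id].
  by apply: quasi_marked_fill => //; exact: op_quasicat.
have hq := quasi_inner_fill hC qC.
move=> S Il Ir.
set l := fval S _ _ in Il; set r := fval S _ _ in Ir.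
set b := fval S _ _; set t := fval S _ (dconst 1 I2_1).
(* The diagonal of the square: [b] then [r] and [l] then [t] both compose to [d], so
   two-out-of-three for isomorphisms applies. *)
pose d : sx C 1 := @fval (Delta 1) C 1 S 1 (did 1) (did 1).
have tri (u v : Dmap 2 1) : qcomp (C := C)
    (@fval (Delta 1) C 1 S 1 (dcomp (dfc 1 2) u) (dcomp (dfc 1 2) v))
    (@fval (Delta 1) C 1 S 1 (dcomp (dfc 1 0) u) (dcomp (dfc 1 0) v))
    (@fval (Delta 1) C 1 S 1 (dcomp (dfc 1 1) u) (dcomp (dfc 1 1) v)).
  by exists (@fval (Delta 1) C 1 S 2 u v); rewrite -!(fval_nat (A := Delta 1)).
have E1 : dcomp (dfc 1 2) (dpin 1 1) = did 1.
  by apply: dmap_ext => i; have := ltn_ord i; rewrite !dE /bump /=; lia.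
have E2 : dcomp (dfc 1 2) (dpin 1 0) = dconst 1 I2_0.
  by apply: dmap_ext => i; have := ltn_ord i; rewrite !dE /bump /=; lia.
have E3 : dcomp (dfc 1 0) (dpin 1 1) = dconst 1 I2_1.
  by apply: dmap_ext => i; have := ltn_ord i; rewrite !dE /bump /=; lia.
have E4 : dcomp (dfc 1 0) (dpin 1 0) = did 1.
  by apply: dmap_ext => i; have := ltn_ord i; rewrite !dE /bump /=; lia.
have E5 : dcomp (dfc 1 1) (dpin 1 1) = did 1.
  by apply: dmap_ext => i; have := ltn_ord i; rewrite !dE /bump /=; lia.
have E6 : dcomp (dfc 1 1) (dpin 1 0) = did 1.
  by apply: dmap_ext => i; have := ltn_ord i; rewrite !dE /bump /=; lia.
have T1 : qcomp b r d by have := tri (dpin 1 1) (dpin 1 0); rewrite E1 E2 E3 E4 E5 E6.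
have T2 : qcomp l t d by have := tri (dpin 1 0) (dpin 1 1); rewrite E1 E2 E3 E4 E5 E6.
split=> H.
- exact: qc_iso_cancel_l T2 Il (qc_iso_comp hC hq T1 H Ir).
- exact: qc_iso_cancel_r T1 Ir (qc_iso_comp hC hq T2 Il H).
Qed.

(** * Relative function complexes *)

Definition prodR (A B : sRaw) : sRaw :=
  @SRaw (fun n => sx A n * sx B n)%type (fun n m t x => (sact A t x.1, sact B t x.2)).

Lemma prodR_sSet A B : is_sSet A -> is_sSet B -> is_sSet (prodR A B).
Proof.
by move=> hA hB; split=> [n [x y]|n m p t u [x y]] /=; rewrite ?sact1 // !sactM.
Qed.

Lemma Delta_sSet n : is_sSet (Delta n).
Proof. by split=> [m x|m p q t u x] /=; rewrite ?dcomp1t ?dcompA. Qed.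

Definition sclosed (X : sRaw) (P : forall n, sx X n -> Prop) :=
  forall n m (t : Dmap n m) x, P m x -> P n (sact X t x).

Definition subR (X : sRaw) (P : forall n, sx X n -> Prop) (hP : sclosed P) : sRaw :=
  @SRaw (fun n => {x : sx X n | P n x})
    (fun n m t x => exist _ (sact X t (proj1_sig x)) (hP n m t _ (proj2_sig x))).

Lemma subR_sSet X (P : forall n, sx X n -> Prop) (hP : sclosed P) : is_sSet X -> is_sSet (subR hP).
Proof.
by move=> hX; split=> [n x|n m p t u x]; apply: sig_ext; rewrite /= ?sact1 ?sactM.
Qed.

(* The existence half of weakly_contractible: it suffices here, and passes to retracts and to suitable unions. *)
Definition wc (X : sRaw) : Prop :=
  forall Z, is_sSet Z -> is_kan Z -> forall g : sMap X Z,
  exists (z : sx Z 0) (H : FunS X Z 1),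
    (forall q (x : sx X q), fval H x (dconst q I2_0) = smap g q x) /\
    (forall q (x : sx X q), fval H x (dconst q I2_1) = sact Z (dconst q ord0) z).

Lemma weakly_contractible_wc X : weakly_contractible X -> wc X.
Proof.
move=> hX Z hZ kZ g; have [null _] := hX Z hZ kZ; have [z [H [H1 H2]]] := null g.
exists z, H; split=> q x.
  have := congr1 (fun F : FunS X Z 0 => fval F x (dconst q ord0)) H1.
  rewrite /esrc /= dconst_post => <-; congr fval.
  by congr dconst; apply: ord_inj; rewrite dfaceE.
have := H2 q x (dconst q ord0); rewrite /etgt /= dconst_post => <-; congr fval.
by congr dconst; apply: ord_inj; rewrite dfaceE.
Qed.

Lemma wc_vertex X : is_sSet X -> wc X -> inhabited (sx X 0).
Proof.
move=> hX wX; apply: NNPP => H.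
have no q (x : sx X q) : False by apply: H; exact: (inhabits (sact X (dconst 0 ord0) x)).
(* The empty simplicial set is Kan because every horn has a vertex. An empty [X] would map to it,
   and the contraction would then produce a vertex of it. *)
pose Z := @SRaw (fun _ => False) (fun _ _ _ x => x).
have kZ : is_kan Z.
  move=> [//|n] k _ h Hh; exfalso; apply: (h 0 (dconst 0 k)).
  apply/in_hornP; exists (if k == 0 :> nat then 1 else 0); have := ltn_ord k.
  by case: eqP => k0 _; split; [lia|lia|move=> i; rewrite dE; lia|lia|lia|move=> i; rewrite dE; lia].
have gn n m (t : Dmap n m) (x : sx X m) : no n (sact X t x) = sact Z t (no m x) by case: (no m x).
by have [[]] := wX Z (conj (fun n x => erefl) (fun n m p t u x => erefl)) kZ (@SMap X Z no gn).
Qed.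

Section Rel.
Variables (C : sRaw) (hC : is_sSet C) (Mk : sx C 1 -> Prop) (hM : equifibrant Mk).

(** Over an edge [v] and a vertex [e] the homotopy sweeps out a square whose two tracks are marked;
    [square_closed] then moves marks between its two ends. *)
Lemma slice_square V E (hV : is_sSet V) (hE : is_sSet E) (G : FunS (prodR V E) C 1) :
  (forall b : sx (prodR V E) 0, Mk (fval G (sact (prodR V E) ddeg b) (did 1))) ->
  forall (v : sx V 1) (e : sx E 0),
  Mk (fval G ((v, sact E ddeg e) : sx (prodR V E) 1) (dconst 1 I2_0)) <->
  Mk (fval G ((v, sact E ddeg e) : sx (prodR V E) 1) (dconst 1 I2_1)).
Proof.
move=> HG v e.
have Sn q q' (t : Dmap q' q) (a : sx (Delta 1) q) (w : Dmap q 1) :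
   fval G ((sact V (sact (Delta 1) t a) v, sact E (dconst q' ord0) e) : sx (prodR V E) q') (dcomp t w) =
   sact C t (fval G ((sact V a v, sact E (dconst q ord0) e) : sx (prodR V E) q) w).
  by rewrite -fval_nat /= !sactM // dconst_comp.
pose S : FunS (Delta 1) C 1 := exist _ (fun q (a : sx (Delta 1) q) w =>
  fval G ((sact V a v, sact E (dconst q ord0) e) : sx (prodR V E) q) w) Sn.
have side j : Mk (@fval (Delta 1) C 1 S 1 (dconst 1 j) (did 1)).
  have := HG (sact V (dconst 0 j) v, e); rewrite /= sactM //.
  by rewrite /ddeg dconst_comp.
have := hM.2 S (side _) (side _).
by rewrite /fval /= sact1.
Qed.

(** The fibre of [Fun(E, C) -> Fun(D, C)] over [d], restricted to simplices with pointwise marked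
    edges. It is Kan, so weak contractibility can be tested against it. *)
Definition RelS (E : sRaw) (D : forall n, sx E n -> Prop) (d : forall n, sx E n -> sx C n) (p : nat) :=
  {F : FunS E C p | (forall q (e : sx E q) s, D q e -> fval F e s = d q e) /\
     (forall (e : sx E 0) (g : Dmap 1 p), Mk (fval F (sact E ddeg e) g))}.

Definition rel_act E D d p' p (t : Dmap p' p) (F : @RelS E D d p) : RelS D d p'.
Proof.
exists (fact t (proj1_sig F)); split=> [q e s De|e g]; rewrite fval_fact.
- by apply: (proj2_sig F).1.
- by apply: (proj2_sig F).2.
Defined.

Definition RelR E D d : sRaw := @SRaw (@RelS E D d) (@rel_act E D d).

Lemma RelR_sSet E D d : is_sSet (@RelR E D d).
Proof.
split=> [n F|n m p t u F]; apply: sig_ext => /=.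
- exact: (sact1 (FunR_sSet E C)).
- by rewrite fact_comp.
Qed.

Section RelKan.
Variables (E : sRaw) (hE : is_sSet E) (D : forall n, sx E n -> Prop) (d : forall n, sx E n -> sx C n).
Hypothesis hD : sclosed D.
Hypothesis d_nat : forall n m (t : Dmap n m) e, D e -> d (sact E t e) = sact C t (d e).

Section Push.
Variables (n : nat) (k : 'I_n.+2) (c : Dmap n.+1 n.+1) (eps : 'I_2).
Hypothesis c_order : forall x, if eps == 0 :> nat then dfun c x <= x else x <= dfun c x.
Hypothesis c_fix : forall x, dfun c x = x \/ dfun c x = k.
Hypothesis c_miss : exists2 j, j <> k :> nat & j <= n.+1 /\ misses c j.

(** A homotopy between [c], at the end [eps], and the identity. [c_order] makes it monotone, and it
    preserves the horn because by [c_fix] it can only move vertices to [k], which every face of the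
    horn contains. *)
Definition dmix q (s : Dmap q n.+1) (w : Dmap q 1) : Dmap q n.+1.
Proof.
exists [ffun i => if dfun w i == eps then dfun c (dfun s i) else dfun s i].
apply: monobP => i j ij; rewrite !ffunE.
have Hs := dmono s ij; have Hw := dmono w ij; have Hc := dmono c Hs.
have := c_order (dfun s i); have := c_order (dfun s j).
have := ltn_ord (dfun w i); have := ltn_ord (dfun w j); have := ltn_ord eps.
have E1 : (dfun w i == eps) = (dfun w i == eps :> nat) by [].
have E2 : (dfun w j == eps) = (dfun w j == eps :> nat) by [].
rewrite E1 E2; case: eqP => e1; case: eqP => e2; case: eqP => e3; lia.
Defined.

Lemma dmixE q (s : Dmap q n.+1) (w : Dmap q 1) i :
  dfun (dmix s w) i = if dfun w i == eps then dfun c (dfun s i) else dfun s i.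
Proof. by rewrite {1}/dfun /= ffunE. Qed.

Lemma dmix_comp q q' (t : Dmap q' q) (s : Dmap q n.+1) (w : Dmap q 1) :
  dcomp t (dmix s w) = dmix (dcomp t s) (dcomp t w).
Proof. by apply: dmap_ext => i; rewrite dcompE !dmixE !dcompE. Qed.

Lemma dmix_start q (s : Dmap q n.+1) : dmix s (dconst q eps) = dcomp s c.
Proof. by apply: dmap_ext => i; rewrite dmixE dconstE eqxx dcompE. Qed.

Lemma dmix_end q (s : Dmap q n.+1) eps' : eps' != eps -> dmix s (dconst q eps') = s.
Proof. by move=> H; apply: dmap_ext => i; rewrite dmixE dconstE (negbTE H). Qed.

Lemma dmix_horn q (s : Dmap q n.+1) w : in_horn k s -> in_horn k (dmix s w).
Proof.
move=> /in_hornP[j [jn jk jm]]; apply/in_hornP; exists j; split=> // i; rewrite dmixE.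
case: ifP => _; last exact: jm.
by case: (c_fix (dfun s i)) => ->; [exact: jm|exact: nesym].
Qed.

Lemma push_horn q (s : Dmap q n.+1) : in_horn k (dcomp s c).
Proof.
case: c_miss => j jk [jn jm]; apply/in_hornP; exists j; split=> //; exact: misses_comp.
Qed.

(* Pushing Delta^n along c retracts Delta^n onto a face of the horn, so the horn
   inclusion is a retract of an inclusion handled by homotopy extension. *)
Lemma rel_horn_fill : horn_fill (RelR D d) k.
Proof.
move=> h Hh; have [hh Hhh] := horn_total h.
have [eps' He'] : exists eps' : 'I_2, eps' != eps.
  by exists (rev_ord eps); rewrite -val_eqE /=; have := ltn_ord eps; lia.
pose V q (s : Dmap q n.+1) (e : sx E q) := fval (proj1_sig (hh q s)) e (did q).
have V_D q s (e : sx E q) : D e -> V q s e = d e by move=> De; exact: (proj2_sig (hh q s)).1.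
have V_nat q q' (t : Dmap q' q) s (e : sx E q) : in_horn k s \/ D e ->
    V q' (dcomp t s) (sact E t e) = sact C t (V q s e).
  case=> [H|De]; last by rewrite !V_D ?d_nat //; exact: hD.
  have H' := horn_closed t H.
  rewrite /V (Hhh _ _ H') (Hh _ _ _ _ H) -(Hhh _ _ H) -fval_nat dcompt1 /=.
  by rewrite -[LHS]/(fval _ _ (dcomp (did q') t)) dcomp1t.
pose B := prodR (Delta n.+1) E.
pose A q (b : sx B q) := in_horn k (b.1 : Dmap q n.+1) \/ D b.2.
pose g q (b : sx B q) := V q (dcomp b.1 c) b.2.
have g_nat q q' (t : Dmap q' q) b : g q' (sact B t b) = sact C t (g q b).
  by rewrite /g /= dcompA V_nat //; left; exact: push_horn.
pose hom q (b : sx B q) (w : Dmap q 1) := V q (dmix b.1 w) b.2.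
have hA : sclosed A.
  by move=> q q' t b [H|H]; [left; exact: horn_closed|right; exact: hD].
have [|||H [H1 H2 H3]] := hM.1 eps B A (prodR_sSet (Delta_sSet _) hE) (fun q q' t => hA q' q t)
    (@SMap B C g (fun q' q t b => g_nat q q' t b)) hom.
- move=> q q' t b w Ab; rewrite /hom /= -dmix_comp V_nat //.
  by case: Ab; [left; exact: dmix_horn|right].
- by move=> q b _; rewrite /hom dmix_start.
- by move=> b _; apply: (proj2_sig (hh _ _)).2.
have Fn q q' (t : Dmap q' q) (e : sx E q) (s : Dmap q n.+1) :
    fval H ((dcomp t s, sact E t e) : sx B q') (dconst q' eps') =
    sact C t (fval H ((s, e) : sx B q) (dconst q eps')).
  by rewrite -fval_nat dconst_comp.
pose F : FunS E C n.+1 := exist _ (fun q e s => fval H ((s, e) : sx B q) (dconst q eps')) Fn.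
have FV q (e : sx E q) s : in_horn k s \/ D e -> fval F e s = V q s e.
  by move=> Hse; rewrite -[LHS]/(fval H _ _) H1 // /hom /= dmix_end.
have FR : (forall q (e : sx E q) s, D e -> fval F e s = d e) /\
     (forall (e : sx E 0) (g : Dmap 1 n.+1), Mk (fval F (sact E ddeg e) g)).
  split=> [q e s De|e s]; first by rewrite FV ?V_D //; right.
  have Sq := slice_square (Delta_sSet n.+1) hE H3 s e.
  have St : Mk (fval H ((s, sact E ddeg e) : sx B 1) (dconst 1 eps)).
    by rewrite H2 /= /g /V; apply: (proj2_sig (hh _ _)).2.
  move: He' St; rewrite -[fval F _ _]/(fval H _ _).
  have eq2 (a : 'I_2) : a = I2_0 \/ a = I2_1.
    by case: a => [[|[|//]] Ha]; [left|right]; apply: ord_inj.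
  by case: (eq2 eps) => ->; case: (eq2 eps') => -> // _ ?; exact/Sq.
exists (exist _ F FR : RelS D d n.+1) => q s Hs; rewrite -Hhh.
apply: sig_ext; apply: FunS_ext => r e s'.
rewrite [LHS]FV; last by left; exact: horn_closed.
rewrite /V (Hhh _ _ (horn_closed s' Hs)) (Hh _ _ _ _ Hs) -Hhh /=.
by rewrite -[LHS]/(fval _ _ (dcomp (did r) s')) dcomp1t.
Qed.

End Push.

(** A neighbour of [k] is pushed onto [k]: the vertex [k.+1] downwards, or the vertex [n] upwards
    when [k] is the last one. The two directions use the two ends of homotopy extension. *)
Lemma RelR_kan : is_kan (RelR D d).
Proof.
move=> [//|n] k _; have kn := ltn_ord k.
case: (ltnP k n.+1) => Hk.
- have [c Hc] : exists c : Dmap n.+1 n.+1, forall x, dfun c x = (if x == k.+1 :> nat then k : nat else x) :> nat.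
    by exists (dphi n k) => x; rewrite dphiE.
  apply: (@rel_horn_fill n k c I2_0) => [x|x|].
  + by rewrite /= Hc; case: eqP; lia.
  + case: (nat_of_ord x =P k.+1) => E0; [right|left]; apply: ord_inj; rewrite Hc.
      by rewrite E0 eqxx.
    by case: eqP.
  + exists k.+1; [lia|split; [lia|]].
    by move=> x; rewrite Hc; case: eqP; lia.
- have Ek : nat_of_ord k = n.+1 by lia.
  have Hm i j : i <= j -> j <= n.+1 -> i + (i == n) <= j + (j == n).
    by move=> ij jn; case: eqP; case: eqP; lia.
  have Hc (x : 'I_n.+2) : dfun (dmk n.+1 Hm) x = x + (x == n :> nat) :> nat.
    by rewrite dmkE; have := ltn_ord x; case: eqP; lia.
  apply: (@rel_horn_fill n k (dmk n.+1 Hm) I2_1) => [x|x|].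
  + by rewrite /= Hc; lia.
  + case: (nat_of_ord x =P n) => E0; [right|left]; apply: ord_inj; rewrite Hc.
      by rewrite E0 eqxx Ek addn1.
    by case: eqP => //; rewrite addn0.
  + exists n; [lia|split; [lia|]].
    by move=> x; rewrite Hc; case: eqP; lia.
Qed.

End RelKan.
End Rel.

(** * Acyclic inclusions *)

(** [g] is homotopic to a constant map, which extends to [V]; homotopy extension from the constant
    end carries the extension back to [g]. *)
Lemma wc_extend V (hV : is_sSet V) (U : forall n, sx V n -> Prop) (hU : sclosed U) :
  wc (subR hU) -> forall Z, is_sSet Z -> is_kan Z -> forall g : sMap (subR hU) Z,
  exists g' : sMap V Z, forall q (u : sx (subR hU) q), smap g' q (proj1_sig u) = smap g q u.
Proof.
move=> wU Z hZ kZ g; have [z [H [H0 H1]]] := wU Z hZ kZ g.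
pose h q (v : sx V q) (w : Dmap q 1) := match excluded_middle_informative (U q v) with
  | left Uv => fval H (exist _ v Uv : sx (subR hU) q) w
  | right _ => sact Z (dconst q ord0) z end.
have hE q (u : sx (subR hU) q) w : h q (proj1_sig u) w = fval H u w.
  rewrite /h; case: excluded_middle_informative => [Uv|nU]; last by case: nU; exact: proj2_sig u.
  by congr fval; apply: sig_ext.
have zn q q' (t : Dmap q' q) (v : sx V q) : sact Z (dconst q' ord0) z = sact Z t (sact Z (dconst q ord0) z).
  by rewrite sactM // dconst_comp.
have [|||G [G1 G2 _]] := (kan_equifibrant hZ kZ).1 I2_1 V U hV (fun q q' t => @hU q' q t)
  (@SMap V Z (fun q _ => sact Z (dconst q ord0) z) (fun q' q t v => zn q q' t v)) h.
- move=> q q' t v w Uv; rewrite -[v]/(proj1_sig (exist _ v Uv : sx (subR hU) q)) hE.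
  rewrite -fval_nat -hE //.
- by move=> q v Uv; rewrite -[v]/(proj1_sig (exist _ v Uv : sx (subR hU) q)) hE H1.
- by [].
have Gn n m (t : Dmap n m) (v : sx V m) :
    fval G (sact V t v) (dconst n I2_0) = sact Z t (fval G v (dconst m I2_0)).
  by rewrite -fval_nat dconst_comp.
exists (SMap Gn) => q u /=; rewrite G1 ?hE ?H0 //; exact: proj2_sig u.
Qed.

Section RelExtend.
Variables (C : sRaw) (hC : is_sSet C) (Mk : sx C 1 -> Prop) (hM : equifibrant Mk).
Variables (V E : sRaw) (hV : is_sSet V) (hE : is_sSet E).
Variables (U : forall n, sx V n -> Prop) (hU : sclosed U).
Variables (D : forall n, sx E n -> Prop) (hD : sclosed D).
Hypotheses (wV : wc V) (wU : wc (subR hU)).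
Variable Phi : forall q, sx V q -> sx E q -> sx C q.
Hypothesis Phi_nat : forall q q' (t : Dmap q' q) v e, U v \/ D e ->
  Phi (sact V t v) (sact E t e) = sact C t (Phi v e).
Hypothesis Phi_mark : forall (v : sx V 1) (e : sx E 0), U v \/ D e -> Mk (Phi v (sact E ddeg e)).

(* Acyclic inclusions lift against the restriction Fun(E, C) -> Fun(D, C): contract V in Fun(D, C),
   lift the contraction over U, extend over V inside the fibre, and come back along the contraction. *)
Lemma rel_extend : exists Psi : sMap (prodR V E) C,
  (forall q (v : sx V q) (e : sx E q), U v \/ D e -> smap Psi q (v, e) = Phi v e) /\
  (forall (v : sx V 1) (e : sx E 0), Mk (smap Psi 1 (v, sact E ddeg e))).
Proof.
have [v0] := wc_vertex hV wV.
pose vq q := sact V (dconst q ord0) v0.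
have hD' : is_sSet (subR hD) by exact: subR_sSet.
(* The relative part is empty, so [R1] consists of maps [D -> C] with marked edges, and the last
   argument is a placeholder built from the vertex [v0]. *)
pose R1 := RelR Mk (E := subR hD) (fun _ _ => False) (fun q (e : sx (subR hD) q) => Phi (vq q) (proj1_sig e)).
have kR1 : is_kan R1 by apply: RelR_kan.
have gS p (v : sx V p) : exists F : sx R1 p, forall q (e : sx (subR hD) q) s,
    fval (proj1_sig F) e s = Phi (sact V s v) (proj1_sig e).
  have Fn q q' (t : Dmap q' q) (e : sx (subR hD) q) (s : Dmap q p) :
      Phi (sact V (dcomp t s) v) (proj1_sig (sact (subR hD) t e)) =
      sact C t (Phi (sact V s v) (proj1_sig e)).
    by rewrite -sactM //= Phi_nat //; right; exact: proj2_sig e.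
  unshelve eexists; first exists (exist _ (fun q e s => Phi (sact V s v) (proj1_sig e)) Fn); last by [].
  split=> // e g; rewrite -[fval _ _ _]/(Phi _ _) /=.
  by apply: Phi_mark; right; exact: proj2_sig e.
pose gf p v := proj1_sig (constructive_indefinite_description _ (gS p v)).
have gfE p (v : sx V p) q e s : fval (proj1_sig (gf p v)) e s = @Phi q (sact V s v) (proj1_sig e).
  by rewrite /gf; case: constructive_indefinite_description.
have gn n m (t : Dmap n m) (v : sx V m) : gf n (sact V t v) = sact R1 t (gf m v).
  apply: sig_ext; apply: FunS_ext => q e s.
  by rewrite gfE -[RHS]/(fval (proj1_sig (gf m v)) e (dcomp s t)) gfE sactM.
have [z [H [H0 H1]]] := wV (RelR_sSet (E := subR hD) _ _ _) kR1 (@SMap V R1 gf gn).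
pose hh q (v : sx V q) (e : sx (subR hD) q) (w : Dmap q 1) := fval (proj1_sig (fval H v w)) e (did q).
pose m q (e : sx (subR hD) q) := fval (proj1_sig z) e (dconst q ord0).
have hh_nat q q' (t : Dmap q' q) (v : sx V q) e w :
    hh q' (sact V t v) (sact (subR hD) t e) (dcomp t w) = sact C t (hh q v e w).
  rewrite /hh fval_nat -[LHS]/(fval (proj1_sig (fval H v w)) _ (dcomp _ _)).
  by rewrite dcomp1t -fval_nat dcompt1.
have hh0 q (v : sx V q) e : hh q v e (dconst q I2_0) = Phi v (proj1_sig e).
  by rewrite /hh H0 gfE sact1.
have hh1 q (v : sx V q) e : hh q v e (dconst q I2_1) = m q e.
  by rewrite /hh H1 -[LHS]/(fval (proj1_sig z) e (dcomp _ _)) dcomp1t.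
have m_nat q q' (t : Dmap q' q) e : m q' (sact (subR hD) t e) = sact C t (m q e).
  by rewrite /m -fval_nat dconst_comp.
have hh_mark (v : sx V 1) (e : sx (subR hD) 0) : Mk (hh 1 v (sact (subR hD) ddeg e) (did 1)).
  exact: (proj2_sig (fval H v (did 1))).2.
have hUs := subR_sSet hU hV.
pose B2 := prodR (subR hU) E.
pose h2 q (b : sx B2 q) w := match excluded_middle_informative (D b.2) with
  | left De => hh q (proj1_sig b.1) (exist _ b.2 De) w
  | right _ => Phi (proj1_sig b.1) b.2 end.
have h2E q (b : sx B2 q) w (De : D b.2) : h2 q b w = hh q (proj1_sig b.1) (exist _ b.2 De) w.
  rewrite /h2; case: excluded_middle_informative => // De'.
  by congr hh; apply: sig_ext.
have PhiU q q' (t : Dmap q' q) (b : sx B2 q) :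
    Phi (proj1_sig (sact B2 t b).1) (sact B2 t b).2 = sact C t (Phi (proj1_sig b.1) b.2).
  by apply: Phi_nat; left; exact: proj2_sig b.1.
have [|||H2 [H2a H2b H2c]] := hM.1 I2_0 B2 (fun q b => D b.2) (prodR_sSet hUs hE)
   (fun q q' t b => @hD q' q t b.2)
   (@SMap B2 C (fun q b => Phi (proj1_sig b.1) b.2) (fun q' q t b => PhiU q q' t b)) h2.
- move=> q q' t b w Db; rewrite (h2E _ _ _ Db) (h2E _ (sact B2 t b) _ (hD t Db)) -hh_nat.
  by congr hh; apply: sig_ext.
- by move=> q b Db; rewrite (h2E _ _ _ Db) hh0.
- move=> b Db; rewrite (h2E _ (sact B2 ddeg b) _ (hD ddeg Db)).
  have := hh_mark (proj1_sig (sact B2 ddeg b).1) (exist _ b.2 Db).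
  by congr (Mk (hh _ _ _ _)); apply: sig_ext.
pose m3 q (e : sx E q) := match excluded_middle_informative (D e) with
  | left De => m q (exist _ e De) | right _ => Phi (vq q) e end.
have m3E q (e : sx E q) (De : D e) : m3 q e = m q (exist _ e De).
  rewrite /m3; case: excluded_middle_informative => // De'.
  by congr m; apply: sig_ext.
pose R3 := RelR Mk D m3.
have kR3 : is_kan R3.
  apply: RelR_kan => // q q' t e De.
  rewrite (m3E _ (sact E t e) (hD t De)) (m3E _ _ De) -m_nat; congr m; exact: sig_ext.
have uS p (u : sx (subR hU) p) : exists F : sx R3 p, forall q (e : sx E q) s,
    fval (proj1_sig F) e s = fval H2 ((sact (subR hU) s u, e) : sx B2 q) (dconst q I2_1).
  have Fn q q' (t : Dmap q' q) (e : sx E q) (s : Dmap q p) :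
      fval H2 ((sact (subR hU) (dcomp t s) u, sact E t e) : sx B2 q') (dconst q' I2_1) =
      sact C t (fval H2 ((sact (subR hU) s u, e) : sx B2 q) (dconst q I2_1)).
    by rewrite -fval_nat dconst_comp -sactM.
  unshelve eexists; first exists (exist _ (fun q (e : sx E q) s =>
     fval H2 ((sact (subR hU) s u, e) : sx B2 q) (dconst q I2_1)) Fn); last by [].
  split=> [q e s De|e s]; rewrite -[fval _ _ _]/(fval H2 _ _).
    by rewrite H2a // (h2E q ((sact (subR hU) s u, e) : sx B2 q) _ De) hh1 (m3E _ _ De).
  (* At the start the edge is given by [Phi] over [U], hence marked; the square moves the mark to
     the end. *)
  apply/(slice_square hM hUs hE H2c (sact (subR hU) s u) e); rewrite H2b /=.
  by apply: Phi_mark; left; apply: hU; exact: proj2_sig u.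
pose uf p u := proj1_sig (constructive_indefinite_description _ (uS p u)).
have ufE p (u : sx (subR hU) p) q (e : sx E q) s :
    fval (proj1_sig (uf p u)) e s = fval H2 ((sact (subR hU) s u, e) : sx B2 q) (dconst q I2_1).
  by rewrite /uf; case: constructive_indefinite_description.
have un n m' (t : Dmap n m') (u : sx (subR hU) m') : uf n (sact (subR hU) t u) = sact R3 t (uf m' u).
  apply: sig_ext; apply: FunS_ext => q e s.
  by rewrite ufE -[RHS]/(fval (proj1_sig (uf m' u)) e (dcomp s t)) ufE sactM.
have [v3 Hv3] := wc_extend hV wU (RelR_sSet _ _ _) kR3 (@SMap (subR hU) R3 uf un).
pose B4 := prodR V E.
(* The return path is [H2] over [U] and [hh] over [D]; the two agree on [U x D] by [H2a]. The last
   branch is a default off both. *)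
pose h4 q (b : sx B4 q) w := match excluded_middle_informative (U b.1) with
  | left Ub => fval H2 ((exist _ b.1 Ub, b.2) : sx B2 q) w
  | right _ => match excluded_middle_informative (D b.2) with
    | left De => hh q b.1 (exist _ b.2 De) w | right _ => Phi b.1 b.2 end end.
have h4U q (b : sx B4 q) w (Ub : U b.1) : h4 q b w = fval H2 ((exist _ b.1 Ub, b.2) : sx B2 q) w.
  rewrite /h4; case: excluded_middle_informative => // Ub'.
  by congr (fval H2 (_, _)); apply: sig_ext.
have h4D q (b : sx B4 q) w (De : D b.2) : h4 q b w = hh q b.1 (exist _ b.2 De) w.
  rewrite /h4; case: excluded_middle_informative => [Ub|_].
    by rewrite H2a //= (h2E _ _ _ De).
  by case: excluded_middle_informative => // De'; congr hh; apply: sig_ext.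
have g4n q q' (t : Dmap q' q) (b : sx B4 q) :
    fval (proj1_sig (smap v3 q' (sact V t b.1))) (sact E t b.2) (did q') =
    sact C t (fval (proj1_sig (smap v3 q b.1)) b.2 (did q)).
  rewrite snat -[LHS]/(fval (proj1_sig (smap v3 q b.1)) _ (dcomp _ _)).
  by rewrite dcomp1t -fval_nat dcompt1.
have hA4 q q' (t : Dmap q' q) (b : sx B4 q) : U b.1 \/ D b.2 -> U (sact B4 t b).1 \/ D (sact B4 t b).2.
  by case=> [H'|H']; [left; exact: hU|right; exact: hD].
have [|||H4 [H4a H4b H4c]] := hM.1 I2_1 B4 (fun q b => U b.1 \/ D b.2) (prodR_sSet hV hE) hA4
   (@SMap B4 C (fun q b => fval (proj1_sig (smap v3 q b.1)) b.2 (did q)) (fun q' q t b => g4n q q' t b)) h4.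
- move=> q q' t b w [Ub|Db].
    rewrite (h4U _ _ _ Ub) (h4U _ (sact B4 t b) _ (hU t Ub)) -fval_nat /=.
    by congr (fval H2 (_, _)); apply: sig_ext.
  rewrite (h4D _ _ _ Db) (h4D _ (sact B4 t b) _ (hD t Db)) -hh_nat.
  by congr hh; apply: sig_ext.
- move=> q b [Ub|Db].
    rewrite (h4U _ _ _ Ub) /= -[b.1]/(proj1_sig (exist _ b.1 Ub : sx (subR hU) q)) Hv3 /= ufE.
    by rewrite sact1.
  by rewrite (h4D _ _ _ Db) hh1 /= (proj2_sig (smap v3 q b.1)).1 // (m3E _ _ Db).
- move=> b [Ub|Db].
    rewrite (h4U _ (sact B4 ddeg b) _ (hU ddeg Ub)).
    have := H2c (exist _ b.1 Ub, b.2).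
    by congr (Mk (fval H2 (_, _) _)); apply: sig_ext.
  rewrite (h4D _ (sact B4 ddeg b) _ (hD ddeg Db)).
  have := hh_mark (sact B4 ddeg b).1 (exist _ b.2 Db).
  by congr (Mk (hh _ _ _ _)); apply: sig_ext.
have Psn n m' (t : Dmap n m') (b : sx B4 m') :
    fval H4 (sact B4 t b) (dconst n I2_0) = sact C t (fval H4 b (dconst m' I2_0)).
  by rewrite -fval_nat dconst_comp.
exists (SMap Psn); split=> [q v e Hve|v e] /=.
  rewrite H4a //; case: Hve => [Uv|De].
    by rewrite (h4U q ((v, e) : sx B4 q) _ Uv) H2b.
  by rewrite (h4D q ((v, e) : sx B4 q) _ De) hh0.
apply/(slice_square hM hV hE H4c v e); rewrite H4b /=.
by have := (proj2_sig (smap v3 1 v)).2 e (did 1).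
Qed.

End RelExtend.

(** * Contractibility of unions *)

Lemma wc_retract X Y (i : sMap X Y) (r : sMap Y X) :
  (forall q (x : sx X q), smap r q (smap i q x) = x) -> wc Y -> wc X.
Proof.
move=> ri wY Z hZ kZ g; have [z [H [H0 H1]]] := wY Z hZ kZ (scomp r g).
have Hn q q' (t : Dmap q' q) (x : sx X q) (w : Dmap q 1) :
    fval H (smap i q' (sact X t x)) (dcomp t w) = sact Z t (fval H (smap i q x) w).
  by rewrite snat fval_nat.
exists z, (exist _ (fun q x w => fval H (smap i q x) w) Hn); split=> q x.
- by rewrite -[LHS]/(fval H _ _) H0 /= ri.
- by rewrite -[LHS]/(fval H _ _) H1.
Qed.

Definition sub_incl X (P : forall n, sx X n -> Prop) (hP : sclosed P) : sMap (subR hP) X :=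
  @SMap (subR hP) X (fun n x => proj1_sig x) (fun _ _ _ _ => erefl).

Definition corestr X Y (Q : forall n, sx Y n -> Prop) (hQ : sclosed Q) (f : sMap X Y)
  (H : forall n x, Q n (smap f n x)) : sMap X (subR hQ).
Proof.
exists (fun n x => exist _ (smap f n x) (H n x)).
by move=> n m t x; apply: sig_ext; rewrite /= snat.
Defined.

Definition sub_map X Y (P : forall n, sx X n -> Prop) (hP : sclosed P) (Q : forall n, sx Y n -> Prop) (hQ : sclosed Q)
  (f : sMap X Y) (H : forall n x, P n x -> Q n (smap f n x)) : sMap (subR hP) (subR hQ) :=
  corestr hQ (f := scomp (sub_incl hP) f) (fun n x => H n _ (proj2_sig x)).

Definition sid X : sMap X X := @SMap X X (fun _ x => x) (fun _ _ _ _ => erefl).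

Lemma wc_sub_ext X (P Q : forall n, sx X n -> Prop) (hP : sclosed P) (hQ : sclosed Q) :
  (forall n x, P n x <-> Q n x) -> wc (subR hP) -> wc (subR hQ).
Proof.
move=> PQ; apply: (@wc_retract _ _
  (@sub_map X X Q hQ P hP (sid X) (fun n x => proj2 (PQ n x)))
  (@sub_map X X P hP Q hQ (sid X) (fun n x => proj1 (PQ n x)))) => q x.
exact: sig_ext.
Qed.

Lemma sclosedU X (P Q : forall n, sx X n -> Prop) : sclosed P -> sclosed Q -> sclosed (fun n x => P n x \/ Q n x).
Proof. by move=> hP hQ n m t x [H|H]; [left; exact: hP|right; exact: hQ]. Qed.

Lemma sclosedI X (P Q : forall n, sx X n -> Prop) : sclosed P -> sclosed Q -> sclosed (fun n x => P n x /\ Q n x).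
Proof. by move=> hP hQ n m t x [H H']; split; [exact: hP|exact: hQ]. Qed.

(** A contraction of [P] to [z] is fixed first. A contraction of [Q] to the same [z], agreeing with
    it on the intersection, is an instance of [rel_extend] with [E = Delta 1] and [D] its two
    ends. *)
Lemma wc_union X (hX : is_sSet X) (P Q : forall n, sx X n -> Prop) (hP : sclosed P) (hQ : sclosed Q) :
  wc (subR hP) -> wc (subR hQ) -> wc (subR (sclosedI hP hQ)) -> wc (subR (sclosedU hP hQ)).
Proof.
move=> wP wQ wPQ Z hZ kZ g.
pose iP := @sub_map X X P hP _ (sclosedU hP hQ) (sid X) (fun n x => @or_introl _ _).
pose iQ := @sub_map X X Q hQ _ (sclosedU hP hQ) (sid X) (fun n x => @or_intror _ _).
have [z [H [H0 H1]]] := wP Z hZ kZ (scomp iP g).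
pose U n (x : sx (subR hQ) n) := P n (proj1_sig x).
have hU : sclosed U by move=> n m t x; exact: hP.
have wU : wc (subR hU).
  have cn n (x : sx (subR hU) n) : P n (proj1_sig (proj1_sig x)) /\ Q n (proj1_sig (proj1_sig x)).
    by split; [exact: proj2_sig x|exact: proj2_sig (proj1_sig x)].
  pose f := corestr (sclosedI hP hQ) (f := scomp (sub_incl hU) (sub_incl hQ)) cn.
  pose f0 := corestr hQ (f := sub_incl (sclosedI hP hQ)) (fun n x => (proj2_sig x).2).
  pose f' := corestr hU (f := f0) (fun n x => (proj2_sig x).1).
  by apply: (@wc_retract _ _ f f') wPQ => q x; apply: sig_ext; exact: sig_ext.
pose D n (s : sx (Delta 1) n) := s = dconst n I2_0 \/ s = dconst n I2_1.
have hD : sclosed D.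
  by move=> n m t x [->|->]; [left|right]; rewrite /= dconst_comp.
pose Phi q (x : sx (subR hQ) q) (s : sx (Delta 1) q) := match excluded_middle_informative (P q (proj1_sig x)) with
  | left Px => fval H (exist _ (proj1_sig x) Px : sx (subR hP) q) s
  | right _ => if excluded_middle_informative (s = dconst q I2_0) then smap g q (smap iQ q x)
               else sact Z (dconst q ord0) z end.
have PhiP q x s (Px : P q (proj1_sig x)) : Phi q x s = fval H (exist _ (proj1_sig x) Px : sx (subR hP) q) s.
  by rewrite /Phi; case: excluded_middle_informative => // Px'; congr fval; exact: sig_ext.
have Phi0 q x : Phi q x (dconst q I2_0) = smap g q (smap iQ q x).
  rewrite /Phi; case: excluded_middle_informative => [Px|_]; last by case: excluded_middle_informative.
  by rewrite H0 /=; congr smap; exact: sig_ext.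
have Phi1 q x : Phi q x (dconst q I2_1) = sact Z (dconst q ord0) z.
  rewrite /Phi; case: excluded_middle_informative => [Px|_]; first by rewrite H1.
  by case: excluded_middle_informative => // E; have := dmap_eq ord0 E; rewrite !dconstE.
have [|//|Psi [Psi1 _]] := @rel_extend Z (fun _ => True) (kan_equifibrant hZ kZ) (subR hQ) (Delta 1)
  (subR_sSet hQ hX) (Delta_sSet 1) U hU D hD wQ wU Phi.
  move=> q q' t x s [Px|[->|->]].
  - rewrite (PhiP _ _ _ Px) (PhiP _ (sact (subR hQ) t x) _ (hP _ _ t _ Px)) -fval_nat.
    by congr fval; exact: sig_ext.
  - by rewrite /= dconst_comp !Phi0 !snat.
  - by rewrite /= dconst_comp !Phi1 sactM // dconst_comp.
pose h q (x : sx (subR (sclosedU hP hQ)) q) (w : Dmap q 1) : sx Z q :=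
  match excluded_middle_informative (P q (proj1_sig x)), excluded_middle_informative (Q q (proj1_sig x)) with
  | left Px, _ => fval H (exist _ (proj1_sig x) Px : sx (subR hP) q) w
  | right _, left Qx => smap Psi q ((exist _ (proj1_sig x) Qx, w) : sx (prodR (subR hQ) (Delta 1)) q)
  | right _, right _ => smap g q x end.
have hhP q (x : sx (subR (sclosedU hP hQ)) q) w (Px : P q (proj1_sig x)) :
    h q x w = fval H (exist _ (proj1_sig x) Px : sx (subR hP) q) w.
  by rewrite /h; case: excluded_middle_informative => // Px'; congr fval; exact: sig_ext.
have hhQ q (x : sx (subR (sclosedU hP hQ)) q) w (Qx : Q q (proj1_sig x)) :
    h q x w = smap Psi q ((exist _ (proj1_sig x) Qx, w) : sx (prodR (subR hQ) (Delta 1)) q).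
  rewrite /h; case: excluded_middle_informative => [Px|_].
    rewrite Psi1; last by left.
    by rewrite (PhiP q (exist _ (proj1_sig x) Qx) w Px).
  by case: excluded_middle_informative => // Qx'; congr (smap Psi q (_, _)); exact: sig_ext.
have hn q q' (t : Dmap q' q) (x : sx (subR (sclosedU hP hQ)) q) (w : Dmap q 1) :
    h q' (sact (subR (sclosedU hP hQ)) t x) (dcomp t w) = sact Z t (h q x w).
  case: (proj2_sig x) => [Px|Qx].
    rewrite (hhP _ _ _ Px) (hhP _ (sact (subR (sclosedU hP hQ)) t x) _ (hP _ _ t _ Px)) -fval_nat.
    by congr fval; exact: sig_ext.
  rewrite (hhQ _ _ _ Qx) (hhQ _ (sact (subR (sclosedU hP hQ)) t x) _ (hQ _ _ t _ Qx)) -snat.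
  by congr (smap Psi q' (_, _)); exact: sig_ext.
exists z, (exist _ h hn); split=> q x; rewrite -[LHS]/(h q x _); case: (proj2_sig x) => [Px|Qx].
- by rewrite (hhP _ _ _ Px) H0 /=; congr smap; exact: sig_ext.
- by rewrite (hhQ _ _ _ Qx) Psi1 ?Phi0; [congr smap; exact: sig_ext|right; left].
- by rewrite (hhP _ _ _ Px) H1.
- by rewrite (hhQ _ _ _ Qx) Psi1 ?Phi1 //; right; right.
Qed.

Section Latching.
Variables (V : sRaw) (hV : is_sSet V) (m : nat) (act : nat -> Prop) (psi : nat -> sMap V V).
Hypothesis psi_idem : forall i q x, act i -> smap (psi i) q (smap (psi i) q x) = smap (psi i) q x.
Hypothesis psi_band : forall i j q x, act i -> act j -> i < j -> smap (psi i) q x = x ->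
  smap (psi i) q (smap (psi j) q x) = smap (psi j) q x.

Definition degen k q (x : sx V q) := exists i, [/\ k <= i, i < m, act i & smap (psi i) q x = x].

Lemma degen_closed k : sclosed (degen k).
Proof. by move=> n l t x [i [i1 i2 i3 i4]]; exists i; rewrite snat i4. Qed.

Lemma fix_closed i : sclosed (fun q x => smap (psi i) q x = x).
Proof. by move=> n l t x H; rewrite snat H. Qed.

(* Inclusion-exclusion over the idempotents psi k, ..., psi (m - 1): all the intersections are
   retracts, because psi j preserves the fixed points of psi i for i < j. *)
Lemma wc_degen k (Q : forall q, sx V q -> Prop) (hQ : sclosed Q) : wc (subR hQ) ->
  (forall i q x, k <= i -> act i -> Q q x -> Q q (smap (psi i) q x)) ->
  (exists i, [/\ k <= i, i < m & act i]) ->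
  wc (subR (sclosedI hQ (@degen_closed k))).
Proof.
move: {2}(m - k) (leqnn (m - k)) => l.
elim: l k Q hQ => [|l IH] k Q hQ lk wQ sQ [i [i1 i2 i3]]; first by lia.
have more q x : Q q x /\ degen k.+1 x -> Q q x /\ degen k x.
  by move=> [Qx [a [a1 a2 a3 a4]]]; split=> //; exists a; split=> //; lia.
case: (classic (act k)) => ak; last first.
  have ik : k < i by case: (ltngtP k i) i1 => // E; subst k.
  apply: (wc_sub_ext (hP := sclosedI hQ (@degen_closed k.+1))).
    move=> q x; split; first exact: more.
    move=> [Qx [a [a1 a2 a3 a4]]]; split=> //; exists a; split=> //.
    by case: (ltngtP k a) a1 => // E; subst k.
  apply: IH => //; first by lia.
  by move=> j q x kj; apply: sQ; lia.
  by exists i.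
have wk : wc (subR (sclosedI hQ (@fix_closed k))).
  apply: (wc_retract (i := @sub_map V V _ (sclosedI hQ (@fix_closed k)) _ hQ (sid V) (fun n x => @proj1 _ _))
    (r := @sub_map V V _ hQ _ (sclosedI hQ (@fix_closed k)) (psi k)
      (fun n x Qx => conj (sQ k n x (leqnn k) ak Qx) (psi_idem x ak)))) wQ => q [x [Qx fx]].
  by apply: sig_ext.
have km : k < m by lia.
have fk q x : Q q x /\ smap (psi k) q x = x -> Q q x /\ degen k x.
  by move=> [Qx fx]; split=> //; exists k.
case: (classic (exists j, [/\ k.+1 <= j, j < m & act j])) => [ex|nex]; last first.
  apply: (wc_sub_ext _ wk) => q x; split; first exact: fk.
  move=> [Qx [a [a1 a2 a3 a4]]]; split=> //.
  by case: (ltngtP k a) a1 => [ka _|//|-> //]; case: nex; exists a.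
have sQ' j q x : k.+1 <= j -> act j -> Q q x -> Q q (smap (psi j) q x).
  by move=> kj; apply: sQ; exact: ltnW.
have wW := IH k.+1 Q hQ ltac:(lia) wQ sQ' ex.
(* The intersection of the two pieces is again of the form treated, with [Q] cut down to the fixed
   points of [psi k]; [psi_band] keeps this smaller [Q] stable. *)
have wW' := IH k.+1 _ (sclosedI hQ (@fix_closed k)) ltac:(lia) wk _ ex.
have {}wW' := wW' (fun j q x kj aj H => conj (sQ' j q x kj aj H.1) (psi_band ak aj kj H.2)).
have wI : wc (subR (sclosedI (sclosedI hQ (@fix_closed k)) (sclosedI hQ (@degen_closed k.+1)))).
  by apply: wc_sub_ext wW' => q x; split; tauto.
apply: wc_sub_ext (wc_union hV wk wW wI) => q x; split=> [[|]|].
- exact: fk.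
- exact: more.
- move=> [Qx [a [a1 a2 a3 a4]]]; case: (ltngtP k a) a1 => [ka _|//|ka _].
    by right; split=> //; exists a.
  by left; rewrite ka.
Qed.

Lemma wc_with_degen (A : forall q, sx V q -> Prop) (hA : sclosed A) : wc V -> wc (subR hA) ->
  (forall i q x, act i -> A q x -> A q (smap (psi i) q x)) ->
  wc (subR (sclosedU hA (@degen_closed 0))).
Proof.
move=> wV wA sA.
(* With no active index the degenerate part is empty, hence not contractible, and the union is just
   [A]. *)
case: (classic (exists i, [/\ 0 <= i, i < m & act i])) => [ex|nex]; last first.
  apply: wc_sub_ext wA => q x; split=> [|[//|[i [i1 i2 i3 _]]]]; first by left.
  by case: nex; exists i.
have hT : sclosed (fun q (x : sx V q) => True) by [].
have wT : wc (subR hT).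
  pose f := corestr hT (f := sid V) (fun _ _ => I).
  by apply: (@wc_retract _ _ (sub_incl hT) f) wV => q x; exact: sig_ext.
have wD : wc (subR (@degen_closed 0)).
  apply: wc_sub_ext (wc_degen (k := 0) wT _ ex) => // q x; split=> [[]//|H]; by split.
apply: wc_union => //; apply: wc_degen => //.
by move=> i q x _; exact: sA.
Qed.

End Latching.

(** * Partial maps *)

(* The p-simplices of [PcR X] are the maps to X from the subcomplexes of Delta^p (None outside
   the subcomplex). It is a contractible enlargement of X with a base point, the empty map,
   canonically isomorphic to every vertex. *)
Definition PcS (X : sRaw) p := {b : forall q, Dmap q p -> option (sx X q) |
  forall q q' (t : Dmap q' q) s x, b q s = Some x -> b q' (dcomp t s) = Some (sact X t x)}.

Lemma pc_ext X p (b b' : PcS X p) : (forall q s, proj1_sig b q s = proj1_sig b' q s) -> b = b'.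
Proof.
by move=> H; apply: sig_ext; do 2!apply: functional_extensionality_dep => ?; exact: H.
Qed.

Definition pc_act X p' p (t : Dmap p' p) (b : PcS X p) : PcS X p'.
Proof.
exists (fun q s => proj1_sig b q (dcomp s t)) => q q' u s x H.
by rewrite dcompA; exact: (proj2_sig b).
Defined.

Definition PcR X : sRaw := @SRaw (PcS X) (@pc_act X).

Lemma PcR_sSet X : is_sSet (PcR X).
Proof.
by split=> [n b|n m p t u b]; apply: pc_ext => q s /=; rewrite ?dcompt1 ?dcompA.
Qed.

Definition pc_map X Y (f : sMap X Y) : sMap (PcR X) (PcR Y).
Proof.
unshelve eexists.
  move=> n b; exists (fun q s => omap (smap f q) (proj1_sig b q s)) => q q' t s y.
  case E: (proj1_sig b q s) => [x|//] /= [<-].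
  by rewrite (proj2_sig b _ _ t _ _ E) /= snat.
by move=> n m t b; apply: pc_ext.
Defined.

Definition pc_emb X (hX : is_sSet X) : sMap X (PcR X).
Proof.
unshelve eexists.
  move=> n y; exists (fun q s => Some (sact X s y)) => q q' t s x [<-].
  by rewrite sactM.
by move=> n m t y; apply: pc_ext => q s /=; rewrite sactM.
Defined.

Lemma pc_emb_inj X (hX : is_sSet X) n : injective (smap (pc_emb hX) n).
Proof.
move=> x y /(congr1 (fun b : PcS X n => proj1_sig b n (did n))) /=.
by rewrite !sact1 // => -[].
Qed.

Lemma pc_map_emb X Y (hX : is_sSet X) (hY : is_sSet Y) (f : sMap X Y) n x :
  smap (pc_map f) n (smap (pc_emb hX) n x) = smap (pc_emb hY) n (smap f n x).
Proof. by apply: pc_ext => q s /=; rewrite snat. Qed.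

Definition pc_restr X p (S : 'I_p.+1 -> bool) (b : PcS X p) : PcS X p.
Proof.
exists (fun q s => if [forall i, S (dfun s i)] then proj1_sig b q s else None) => q q' t s x.
case: ifP => // /forallP HS H; have -> : [forall i, S (dfun (dcomp t s) i)].
  by apply/forallP => i; rewrite dcompE.
exact: (proj2_sig b).
Defined.

Lemma pc_restr_act X p' p (t : Dmap p' p) (S : 'I_p.+1 -> bool) (b : PcS X p) :
  pc_act t (pc_restr S b) = pc_restr (fun i => S (dfun t i)) (pc_act t b).
Proof.
apply: pc_ext => q s /=; congr (if _ then _ else _).
by apply: eq_forallb => i; rewrite dcompE.
Qed.

Lemma pc_restr_map X Y (f : sMap X Y) p (S : 'I_p.+1 -> bool) b :
  smap (pc_map f) p (pc_restr S b) = pc_restr S (smap (pc_map f) p b).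
Proof. by apply: pc_ext => q s /=; case: ifP. Qed.

Lemma pc_restr_true X p (S : 'I_p.+1 -> bool) (b : PcS X p) : (forall i, S i) -> pc_restr S b = b.
Proof.
by move=> H; apply: pc_ext => q s /=; rewrite (_ : [forall i, S (dfun s i)]) //; apply/forallP => i; exact: H.
Qed.

Lemma pc_restr_eq X p (S S' : 'I_p.+1 -> bool) (b : PcS X p) : S =1 S' -> pc_restr S b = pc_restr S' b.
Proof. by move=> H; congr pc_restr; apply: functional_extensionality. Qed.

Definition pc_pt X p : PcS X p.
Proof. by exists (fun q s => None). Defined.

Lemma pc_restr_false X p (S : 'I_p.+1 -> bool) (b : PcS X p) : (forall i, ~~ S i) -> pc_restr S b = pc_pt X p.
Proof.
by move=> H; apply: pc_ext => q s /=; case: forallP => // /(_ ord0) E; have := H (dfun s ord0); rewrite E.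
Qed.

(** The contraction restricts a partial map to the vertices where [w] is still 0, so that it ends at
    the empty map. *)
Lemma PcR_wc X : wc (PcR X).
Proof.
move=> Z hZ kZ g.
have Hn q q' (t : Dmap q' q) (b : sx (PcR X) q) (w : Dmap q 1) :
    smap g q' (pc_restr (fun i => dfun (dcomp t w) i == I2_0) (pc_act t b)) =
    sact Z t (smap g q (pc_restr (fun i => dfun w i == I2_0) b)).
  rewrite -snat /= pc_restr_act; congr smap; apply: pc_restr_eq => i; by rewrite dcompE.
exists (smap g 0 (pc_pt X 0)),
  (exist _ (fun q (b : sx (PcR X) q) (w : Dmap q 1) => smap g q (pc_restr (fun i => dfun w i == I2_0) b)) Hn).
split=> q b; rewrite -[LHS]/(smap g q _).
- by rewrite pc_restr_true // => i; rewrite dconstE.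
- rewrite pc_restr_false => [|i]; last by rewrite dconstE.
  by rewrite -snat; congr smap; apply: pc_ext.
Qed.

(** * Extension of natural transformations *)

Section Main.
Variables (C : sRaw) (hC : is_sSet C) (Mk : sx C 1 -> Prop) (hM : equifibrant Mk).
Variables (K : sRaw) (hK : is_sSet K).
Variable B : forall n, sx K n -> sRaw.
Variable Bmap : forall n m (t : Dmap n m) (s : sx K n) (r : sx K m),
  sact K t r = s -> sMap (B r) (B s).
Hypothesis hB : forall n (s : sx K n), is_sSet (B s).
Hypothesis Birr : forall n m (t : Dmap n m) (s : sx K n) (r : sx K m)
  (h h' : sact K t r = s) p (y : sx (B r) p), smap (Bmap h) p y = smap (Bmap h') p y.
Hypothesis Bid : forall n (s : sx K n) (h : sact K (did n) s = s) p (y : sx (B s) p),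
  smap (Bmap h) p y = y.
Hypothesis Bcomp : forall n m l (t : Dmap n m) (u : Dmap m l)
  (s : sx K n) (r : sx K m) (o : sx K l)
  (h1 : sact K t r = s) (h2 : sact K u o = r) (h3 : sact K (dcomp t u) o = s) p (y : sx (B o) p),
  smap (Bmap h3) p y = smap (Bmap h1) p (smap (Bmap h2) p y).
Variable A : forall n (s : sx K n) p, sx (B s) p -> Prop.
Hypothesis hA : forall n (s : sx K n), sclosed (@A n s).
Hypothesis A_map : forall n m (t : Dmap n m) (s : sx K n) (r : sx K m) (h : sact K t r = s) p y,
  @A m r p y -> @A n s p (smap (Bmap h) p y).
Hypothesis wB : forall n (s : sx K n), wc (B s).
Hypothesis wA : forall n (s : sx K n), wc (subR (@hA n s)).
Variable c0 : forall n, sx K n -> sx C 0.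

(** A map [B s x Delta^n -> C] cut into blocks [Delta^p x Delta^n]. Reading a block as an
    [n]-simplex of [Fun(Delta^p, C)] puts naturality in [s] into the form of [reedy_ext]; [dnat] is
    naturality in [p]. *)
Definition blockmap n (s : sx K n) p := sx (B s) p -> FunS (Delta p) C n.

Definition dnat n (s : sx K n) (P : forall p, sx (B s) p -> Prop) (phi : forall p, blockmap s p) :=
  forall p p' (t : Dmap p' p) y, P p y -> forall q (w : sx (Delta p') q) x,
    fval (phi p' (sact (B s) t y)) w x = fval (phi p y) (dcomp w t : sx (Delta p) q) x.

Variable alpha : forall n (s : sx K n) p, blockmap s p.
Hypothesis alpha_dnat : forall n (s : sx K n), dnat (@A n s) (@alpha n s).
Hypothesis alpha_nat : forall n m (t : Dmap n m) (s : sx K n) (r : sx K m) (h : sact K t r = s) p y,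
  A y -> @alpha n s p (smap (Bmap h) p y) = fact t (@alpha m r p y).
Hypothesis alpha_mark : forall n (s : sx K n) (y : sx (B s) 1) (v : Dmap 0 n), A y ->
  Mk (fval (alpha y) (did 1 : sx (Delta 1) 1) (dcomp ddeg v)).

Definition Ok n (s : sx K n) (phi : forall p, blockmap s p) :=
  [/\ dnat (fun _ _ => True) phi,
      forall p y, A y -> phi p y = alpha y &
      forall (y : sx (B s) 1) (v : Dmap 0 n), Mk (fval (phi 1 y) (did 1 : sx (Delta 1) 1) (dcomp ddeg v))].

Lemma block_ext n (s : sx K n) (U : forall p, sx (B s) p -> Prop) (hU : sclosed U)
  (D : forall q, Dmap q n -> Prop)
  (Phi : forall q, sx (B s) q -> Dmap q n -> sx C q) :
  sclosed (X := Delta n) D -> wc (subR hU) -> 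
  (forall q q' (t : Dmap q' q) v (e : Dmap q n), U q v \/ D q e ->
      Phi q' (sact (B s) t v) (dcomp t e) = sact C t (Phi q v e)) ->
  (forall v (e : Dmap 0 n), U 1 v \/ D 0 e -> Mk (Phi 1 v (dcomp ddeg e))) ->
  exists phi : forall p, blockmap s p,
    [/\ dnat (fun _ _ => True) phi,
        forall p (y : sx (B s) p) q (w : sx (Delta p) q) x, U p y \/ D q x ->
           fval (phi p y) w x = Phi q (sact (B s) w y) x &
        forall (y : sx (B s) 1) (v : Dmap 0 n), Mk (fval (phi 1 y) (did 1 : sx (Delta 1) 1) (dcomp ddeg v))].
Proof.
move=> hD wU Phin Phim.
have [||Psi [P1 P2]] := @rel_extend C Mk hM (B s) (Delta n) (hB s) (Delta_sSet n) U hU D hD (@wB n s) wU Phi.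
- by move=> q q' t v e; exact: Phin.
- by move=> v e; exact: Phim.
have phin p (y : sx (B s) p) q q' (t : Dmap q' q) (w : sx (Delta p) q) (x : Dmap q n) :
    smap Psi q' ((sact (B s) (sact (Delta p) t w) y, dcomp t x) : sx (prodR (B s) (Delta n)) q') =
    sact C t (smap Psi q ((sact (B s) w y, x) : sx (prodR (B s) (Delta n)) q)).
  by rewrite -snat /= sactM.
exists (fun p y => exist _ (fun q (w : sx (Delta p) q) x =>
   smap Psi q ((sact (B s) w y, x) : sx (prodR (B s) (Delta n)) q)) (phin p y)); split.
- by move=> p p' t y _ q w x; rewrite /fval /= sactM.
- move=> p y q w x H; rewrite -[LHS]/(smap Psi q _) P1 //.
  by case: H => H; [left; apply: (hU)|right].
- by move=> y v; rewrite /fval /= sact1 //; exact: P2.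
Qed.

Lemma block_step0 (s : sx K 0) : exists phi : forall p, blockmap s p, Ok phi.
Proof.
have [||||phi [F1 F2 F3]] := @block_ext 0 s (@A 0 s) (@hA _ s) (fun _ _ => False)
   (fun q v e => fval (alpha v) (did q : sx (Delta q) q) e).
- by move=> ? ? ? ?.
- exact: wA.
- move=> q q' t v e [Av|//]; rewrite (alpha_dnat _ Av) dcomp1t -{1}(dcompt1 t).
  exact: (fval_nat (A := Delta q)).
- by move=> v e [Av|//]; exact: alpha_mark.
exists phi; split=> // p y Ay; apply: FunS_ext => q w x.
by rewrite F2; [rewrite (alpha_dnat _ Ay) dcomp1t|left].
Qed.

Let Y n (s : sx K n) p := sx (B s) p.
Let Ymap n m (t : Dmap n m) (s : sx K n) (r : sx K m) (h : sact K t r = s) p (y : Y r p) : Y s p :=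
  smap (Bmap h) p y.
Let X p := FunR (Delta p) C.

Lemma dflt n (s : sx K n) r p : FunS (Delta p) C r.
Proof.
exists (fun q _ _ => sact C (dconst q ord0) (c0 s)) => q q' t _ _.
by rewrite sactM // dconst_comp.
Qed.

Lemma Yirr n m (t : Dmap n m) (s : sx K n) (r : sx K m) (h h' : sact K t r = s) p (y : Y r p) :
  Ymap h y = Ymap h' y.
Proof. exact: Birr. Qed.

Lemma Ycomp n m l (t : Dmap n m) (u : Dmap m l) (s : sx K n) (r : sx K m) (o : sx K l)
  (h1 : sact K t r = s) (h2 : sact K u o = r) (h3 : sact K (dcomp t u) o = s) p (y : Y o p) :
  Ymap h3 y = Ymap h1 (Ymap h2 y).
Proof. exact: Bcomp. Qed.

Lemma faces_compat n (F : fam Y X) : nat_upto Ymap n.+1 F -> forall (s : sx K n.+1) q (v : Y s q),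
  compat (W := X q) (fun j => j <= n.+1) (fun j => F n _ q (yface Ymap j v)).
Proof.
case: n => [|n] HF s q v; first exact: compat0.
apply: compat_faces => //; first exact: FunR_sSet.
move=> i j Hi Hj ij.
have Ed : dcomp (dfc n j.-1) (dfc n.+1 i) = dcomp (dfc n i) (dfc n.+1 j).
  by rewrite -[j in RHS](prednK (n := j)) ?dfc_fc //; lia.
have hs : sact K (dfc n j.-1) (sact K (dfc n.+1 i) s) = sact K (dfc n i) (sact K (dfc n.+1 j) s).
  by rewrite !sactM // Ed.
rewrite -(HF _ _ _ _ _ hs) // -(HF _ _ _ _ _ erefl) //; congr F.
by rewrite /yface !(YmapM hK Yirr Ycomp); apply: (Ymap_eq Yirr).
Qed.

Section Step.
Variables (n : nat) (F : fam Y X).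
Hypotheses (HF : nat_upto Ymap n.+1 F) (OF : ok_upto (Y := Y) (X := X) Ok n.+1 F).
Variable (s : sx K n.+1) (lam : forall p, blockmap s p).
Hypothesis Hlam : latching Ymap F (s := s) lam.

(** A simplex over [s] can be degenerate along [i] only if [s] is. For the other [i], [psi i] is set
    to the identity and [act] excludes it. *)
Let act i := i <= n /\ sact K (dphi n i) s = s.
Let psi i : sMap (B s) (B s) := match excluded_middle_informative (sact K (dphi n i) s = s) with
  | left h => Bmap h | right _ => sid (B s) end.

Lemma psiE i (h : sact K (dphi n i) s = s) p y : smap (psi i) p y = smap (Bmap h) p y.
Proof. by rewrite /psi; case: excluded_middle_informative. Qed.

Lemma psi_idem i q x : act i -> smap (psi i) q (smap (psi i) q x) = smap (psi i) q x.
Proof.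
move=> [Hi h]; rewrite !(psiE h).
have E : dcomp (dphi n i) (dphi n i) = dphi n i.
  apply: dmap_ext => k; rewrite (dcompE (dphi n i) (dphi n i)) !dphiE //.
  by do ![case: ifP]; lia.
have h2 : sact K (dcomp (dphi n i) (dphi n i)) s = s by rewrite E.
rewrite -(Bcomp h h h2); move: h2; rewrite E => h2; exact: Birr.
Qed.

Lemma psi_band i j q x : act i -> act j -> i < j -> smap (psi i) q x = x ->
  smap (psi i) q (smap (psi j) q x) = smap (psi j) q x.
Proof.
move=> [Hi hi] [Hj hj] ij E; rewrite -E !(psiE hi) !(psiE hj).
have hji : sact K (dcomp (dphi n j) (dphi n i)) s = s by rewrite -sactM // hi.
have hiji : sact K (dcomp (dphi n i) (dcomp (dphi n j) (dphi n i))) s = s by rewrite -sactM // hji.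
rewrite -(Bcomp hj hi hji) -(Bcomp hi hji hiji).
have Ed : dcomp (dphi n i) (dcomp (dphi n j) (dphi n i)) = dcomp (dphi n j) (dphi n i).
  by rewrite {2 3}/dphi -!(dcompA _ _ (dfc n i.+1)) !dphi_pin // -(dcompA _ _ (dfc n i.+1)) dphi_pin.
by move: hiji; rewrite Ed => hiji; exact: Birr.
Qed.

Let degenP p (y : sx (B s) p) : degen n.+1 act psi 0 y <-> exists2 i, i <= n & fixes Ymap i (y : Y s p).
Proof.
split=> [[i [_ i2 [i3 h] i4]]|[i Hi [h E]]].
  by exists i => //; exists h; rewrite -[RHS]i4 (psiE h).
by exists i; split=> //; rewrite (psiE h).
Qed.

Let face j p (y : sx (B s) p) := F (yface Ymap j (y : Y s p)).

Lemma face_dnat j p p' (t : Dmap p' p) y q (w : sx (Delta p') q) x :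
  fval (face j (sact (B s) t y)) w x = fval (face j y) (dcomp w t : sx (Delta p) q) x.
Proof.
have [H _ _] := OF (sact K (dfc n j) s) (ltnSn n).
by rewrite /face /yface /Ymap snat H.
Qed.

Lemma lam_dnat : dnat (fun p y => exists2 i, i <= n & fixes Ymap i (y : Y s p)) lam.
Proof.
move=> p p' t y [i Hi [h fi]] q w x.
have fy : fixes Ymap i (y : Y s p) by exists h.
have fty : fixes Ymap i (sact (B s) t y : Y s p') by exists h; rewrite /Ymap snat; congr sact.
rewrite (Hlam.1 _ _ _ Hi fy) (Hlam.1 _ _ _ Hi fty) -[LHS]/(fval (face _ _) _ (dcomp _ _)).
by rewrite face_dnat.
Qed.

Let phiU p (y : sx (B s) p) : FunS (Delta p) C n.+1 :=
  if excluded_middle_informative (A y) then alpha y else lam y.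

Lemma phiU_A p y : A y -> @phiU p y = alpha y.
Proof. by rewrite /phiU; case: excluded_middle_informative. Qed.

(** Where [A] meets the degenerate part, [lam] is the degeneracy of a face value, which is [alpha]
    of the face by [OF]; naturality of [alpha] and invariance under [dphi n i] lead back to
    [alpha y]. *)
Lemma phiU_lam p y i : i <= n -> fixes Ymap i (y : Y s p) -> phiU y = lam y.
Proof.
move=> Hi fi; rewrite /phiU; case: excluded_middle_informative => //= Ay.
have [h E] := fi; rewrite (Hlam.1 _ _ _ Hi fi).
have [_ H _] := OF (sact K (dfc n i.+1) s) (ltnSn n).
rewrite H; last exact: A_map.
rewrite /yface /Ymap alpha_nat //= fact_comp -/(dphi n i) -(alpha_nat h) //.
by congr alpha.
Qed.

Let U p (y : sx (B s) p) := A y \/ degen n.+1 act psi 0 y.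

Lemma phiU_dnat : dnat U phiU.
Proof.
move=> p p' t y [Ay|/degenP[i Hi fi]] q w x.
  rewrite !phiU_A //; [exact: alpha_dnat|exact: hA].
have fti : fixes Ymap i (sact (B s) t y : Y s p').
  by case: fi => h E; exists h; rewrite /Ymap snat; congr sact.
rewrite (phiU_lam Hi fi) (phiU_lam Hi fti); apply: lam_dnat; by exists i.
Qed.

Lemma phiU_face p (y : sx (B s) p) j : j <= n.+1 -> U y -> fact (dfc n j) (phiU y) = face j y.
Proof.
move=> jn [Ay|/degenP[i Hi fi]].
  rewrite phiU_A // -(alpha_nat (erefl (sact K (dfc n j) s))) //.
  have [_ H _] := OF (sact K (dfc n j) s) (ltnSn n).
  by rewrite /face H //; exact: A_map.
by rewrite (phiU_lam Hi fi); exact: (Hlam.2 i).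
Qed.

Lemma phiU_mark (y : sx (B s) 1) (v : Dmap 0 n.+1) : U y ->
  Mk (fval (phiU y) (did 1 : sx (Delta 1) 1) (dcomp ddeg v)).
Proof.
case=> [Ay|/degenP[i Hi fi]]; first by rewrite phiU_A //; exact: alpha_mark.
rewrite (phiU_lam Hi fi) (Hlam.1 _ _ _ Hi fi).
have [_ _ H] := OF (sact K (dfc n i.+1) s) (ltnSn n).
rewrite -[fval _ _ _]/(fval (face i.+1 y) (did 1 : sx (Delta 1) 1) (dcomp _ _)) dcompA; exact: H.
Qed.

Lemma faces_glue q (v : sx (B s) q) : exists h : forall r, Dmap r n.+1 -> FunS (Delta q) C r,
  forall r (e : Dmap r n) j, j <= n.+1 -> h r (dcomp e (dfc n j)) = fact e (face j v).
Proof.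
have [h Hh] := @glue_faces (X q) (fun r => dflt s r q) n _ _ (faces_compat HF (v : Y s q)).
by exists h => r e j jn; exact: Hh.
Qed.

(** [block_ext] is applied with [U] the union of [A] and the degenerate part, acyclic by
    [wc_with_degen], and [D] the boundary of [Delta^n.+1]; the data on the two agree by
    [phiU_face]. *)
Lemma block_step : exists phi : forall p, blockmap s p,
   [/\ Ok phi,
       forall j p (y : Y s p), j <= n.+1 -> sact (X p) (dfc n j) (phi p y) = F (yface Ymap j y) &
       forall i p (y : Y s p), i <= n -> fixes Ymap i y -> phi p y = lam y].
Proof.
pose G q (v : sx (B s) q) := proj1_sig (constructive_indefinite_description _ (faces_glue v)).
have GE q (v : sx (B s) q) r (e : Dmap r n) j : j <= n.+1 ->
    G q v r (dcomp e (dfc n j)) = fact e (face j v).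
  by rewrite /G; case: constructive_indefinite_description => h /= Hh; exact: Hh.
pose Phi q (v : sx (B s) q) (e : Dmap q n.+1) : sx C q :=
  if excluded_middle_informative (U v) then fval (phiU v) (did q : sx (Delta q) q) e
  else fval (G q v q e) (did q : sx (Delta q) q) (did q).
have PhiU q v e : U v -> Phi q v e = fval (phiU v) (did q : sx (Delta q) q) e.
  by rewrite /Phi; case: excluded_middle_informative.
have PhiD q v e j : j <= n.+1 -> Phi q v (dcomp e (dfc n j)) = fval (face j v) (did q : sx (Delta q) q) e.
  move=> jn; rewrite /Phi; case: excluded_middle_informative => Uv /=.
    by rewrite -(phiU_face jn Uv).
  by rewrite GE // fval_fact dcomp1t.
have hU : sclosed U by exact: (sclosedU (@hA _ s) (@degen_closed _ _ _ _ 0)).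
have [||||phi [F1 F2 F3]] := @block_ext n.+1 s U hU (fun q e => bd e) Phi.
- by move=> q q' t e; exact: bd_comp.
- have := @wc_with_degen (B s) (hB s) n.+1 act psi psi_idem psi_band (@A _ s) (@hA _ s) (@wB _ s) (@wA _ s).
  move=> H; apply: (wc_sub_ext _ (H _)) => // i q x [Hi h]; rewrite (psiE h); exact: A_map.
- move=> q q' t v e [Uv|[j jn je]].
    rewrite !PhiU //; last exact: hU.
    rewrite (phiU_dnat _ Uv) dcomp1t -{1}(dcompt1 t); exact: (fval_nat (A := Delta q)).
  rewrite (dfactor jn je) -dcompA !PhiD // face_dnat dcomp1t -{1}(dcompt1 t).
  exact: (fval_nat (A := Delta q)).
- move=> v e [Uv|[j jn je]]; first by rewrite PhiU //; exact: phiU_mark.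
  rewrite (dfactor jn je) -dcompA PhiD //.
  by have [_ _ H] := OF (sact K (dfc n j) s) (ltnSn n); exact: H.
have FU p (y : sx (B s) p) : U y -> phi p y = phiU y.
  move=> Uy; apply: FunS_ext => q w x; rewrite F2; last by left.
  by rewrite PhiU; [rewrite (phiU_dnat _ Uy) dcomp1t|exact: hU].
exists phi; split.
- by split=> // p y Ay; rewrite FU ?phiU_A //; left.
- move=> j p y jn; apply: FunS_ext => q w x; rewrite fval_fact F2; last by right; exact: bd_fc.
  by rewrite PhiD // face_dnat dcomp1t.
- move=> i p y Hi fi; rewrite FU; first exact: (phiU_lam Hi fi).
  by right; apply/degenP; exists i.
Qed.

End Step.

Theorem acyclic_ext : exists F : forall n (s : sx K n) p, blockmap s p,
  [/\ forall n m (t : Dmap n m) (s : sx K n) (r : sx K m) (h : sact K t r = s) p y,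
        F n s p (smap (Bmap h) p y) = fact t (F m r p y),
      forall n (s : sx K n), dnat (fun _ _ => True) (F n s) &
      forall n (s : sx K n) p y, A y -> F n s p y = alpha y].
Proof.
have [||||||F [F1 F2]] := @reedy_ext K nat Y Ymap hK _ _ _ X _ (fun n s p _ => dflt s n p) Ok.
- exact: Yirr.
- exact: Bid.
- exact: Ycomp.
- by move=> p; exact: FunR_sSet.
- exact: block_step0.
- by move=> n F HF OF s lam Hlam; exact: block_step Hlam.
exists F; split=> // n s; first by case: (F2 n s).
by case: (F2 n s).
Qed.

End Main.

(** * From the extended transformation to [f] and the equivalence *)

Lemma qcomp_map C D (f : sMap C D) e g h : qcomp e g h -> qcomp (smap f 1 e) (smap f 1 g) (smap f 1 h).
Proof. by case=> s [<- <- <-]; exists (smap f 2 s); rewrite !snat. Qed.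

Lemma qc_iso_map C D (f : sMap C D) e : qc_iso e -> qc_iso (smap f 1 e).
Proof.
move=> /qc_isoE[e' [e1 e2 e3 e4]]; apply/qc_isoE; exists (smap f 1 e').
rewrite -!src_map -!tgt_map -!eid_map e1 e2; split=> //; exact: qcomp_map.
Qed.

Definition eval_at A (hA : is_sSet A) C (a : sx A 0) : sMap (FunR A C) C.
Proof.
exists (fun m (G : sx (FunR A C) m) => fval G (sact A (dconst m ord0) a) (did m)) => n m t G.
by rewrite -fval_nat dcompt1 sactM // dconst_comp /= /fval /= dcomp1t.
Defined.

Definition swapF C n p (F : FunS (Delta n) C p) : FunS (Delta p) C n.
Proof.
exists (fun q (w : sx (Delta p) q) x => fval F (x : sx (Delta n) q) w) => q q' t w x.
exact: (fval_nat F).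
Defined.

Definition pc_image X (hX : is_sSet X) p (b : sx (PcR X) p) := exists y, b = smap (pc_emb hX) p y.

Lemma pc_image_closed X (hX : is_sSet X) : sclosed (@pc_image X hX).
Proof. by move=> n m t b [y ->]; exists (sact X t y); rewrite snat. Qed.

Lemma pc_image_wc X (hX : is_sSet X) : wc X -> wc (subR (pc_image_closed (hX := hX))).
Proof.
have [r rE] : exists r : forall p, sx (subR (pc_image_closed (hX := hX))) p -> sx X p,
    forall p b, smap (pc_emb hX) p (r p b) = proj1_sig b.
  exists (fun p b => proj1_sig (constructive_indefinite_description
    (fun y => proj1_sig b = smap (pc_emb hX) p y) (proj2_sig b))) => p b.
  by case: constructive_indefinite_description.
have rn n m (t : Dmap n m) b : r n (sact _ t b) = sact X t (r m b).
  by apply: (pc_emb_inj (hX := hX)); rewrite (rE n) snat (rE m).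
apply: (@wc_retract _ _ (SMap rn)
  (corestr (pc_image_closed (hX := hX)) (f := pc_emb hX) (fun p y => ex_intro _ y erefl))) => q b.
by apply: sig_ext; exact: rE.
Qed.

Theorem theorem4p1
  (K' K C : sRaw)
  (hK' : is_sSet K') (hK : is_sSet K) (hC : is_sSet C) (hCq : is_quasicat C)
  (f' : sMap K' C) (i : sMap K' K)
  (* the functor N : (Delta_{/K})^op -> Set_Delta *)
  (N : forall n, sx K n -> sRaw)
  (Nmap : forall n m (t : Dmap n m) (s : sx K n) (r : sx K m),
            sact K t r = s -> sMap (N m r) (N n s))
  (hN : forall n (s : sx K n), is_sSet (N n s))
  (Nirr : forall n m (t : Dmap n m) (s : sx K n) (r : sx K m)
            (h h' : sact K t r = s) p (y : sx (N m r) p),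
            smap (Nmap n m t s r h) p y = smap (Nmap n m t s r h') p y)
  (Nid : forall n (s : sx K n) (h : sact K (did n) s = s) p (y : sx (N n s) p),
            smap (Nmap n n (did n) s s h) p y = y)
  (Ncomp : forall n m l (t : Dmap n m) (u : Dmap m l)
             (s : sx K n) (r : sx K m) (o : sx K l)
             (h1 : sact K t r = s) (h2 : sact K u o = r)
             (h3 : sact K (dcomp t u) o = s) p (y : sx (N l o) p),
             smap (Nmap n l (dcomp t u) s o h3) p y
             = smap (Nmap n m t s r h1) p (smap (Nmap m l u r o h2) p y))
  (* the natural transformation alpha : N -> Map[K, C] *)
  (alpha : forall n (s : sx K n), sMap (N n s) (MapKC C n))
  (alpha_nat : forall n m (t : Dmap n m) (s : sx K n) (r : sx K m)
                 (h : sact K t r = s) p (y : sx (N m r) p)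
                 q (x : Dmap q n) (w : Dmap q p),
      @cval (Delta n) C p (smap (alpha n s) p (smap (Nmap n m t s r h) p y)) q x w
      = @cval (Delta m) C p (smap (alpha m r) p y) q (dcomp x t) w)
  (* (1) *)
  (H1 : forall n (s : sx K n), weakly_contractible (N n s))
  (* (2) *)
  (H2 : exists omega : forall n (s' : sx K' n), sx (N n (smap i n s')) 0,
      (forall n m (t : Dmap n m) (s' : sx K' n) (r' : sx K' m)
              (ht : sact K' t r' = s')
              (h : sact K t (smap i m r') = smap i n s'),
          smap (Nmap n m t (smap i n s') (smap i m r') h) 0 (omega m r') = omega n s') /\
      (forall n (s' : sx K' n) q (x : Dmap q n) (w : Dmap q 0),
          @cval (Delta n) C 0 (smap (alpha n (smap i n s')) 0 (omega n s')) q x w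
          = smap f' q (sact K' x s'))) :
  exists f : sMap K C,
    qc_equiv (X := FunR K' C) (fvert (scomp i f)) (fvert f').
Proof.
have wN n s := weakly_contractible_wc (H1 n s).
(* [C] may be empty when [K] is, so the default vertex is drawn from [N n s] for each simplex
   [s]. *)
have c0S n (s : sx K n) : inhabited (sx C 0).
  have [y] : inhabited (sx (N n s) 0) by exact: wc_vertex.
  exact: inhabits (cval (smap (alpha n s) 0 y) (dconst 0 ord0 : sx (Delta n) 0) (did 0)).
have c0 n (s : sx K n) : sx C 0 by exact: epsilon (c0S n s) (fun _ => True).
pose B n (s : sx K n) := PcR (N n s).
pose Bmap n m (t : Dmap n m) (s : sx K n) (r : sx K m) (h : sact K t r = s) : sMap (B m r) (B n s) :=
  pc_map (Nmap n m t s r h).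
pose emb n (s : sx K n) : sMap (N n s) (B n s) := pc_emb (hN n s).
have Bmap_emb n m (t : Dmap n m) (s : sx K n) (r : sx K m) (h : sact K t r = s) p y :
    smap (Bmap n m t s r h) p (smap (emb m r) p y) = smap (emb n s) p (smap (Nmap n m t s r h) p y).
  exact: pc_map_emb.
pose A n (s : sx K n) := pc_image (hN n s).
have [a aE] : exists a : forall n (s : sx K n) p, sx (B n s) p -> FunS (Delta p) C n,
    forall n s p y, a n s p (smap (emb n s) p y) = swapF (proj1_sig (smap (alpha n s) p y)).
  exists (fun n s p b => match excluded_middle_informative (A n s p b) with
    | left Ab => swapF (proj1_sig (smap (alpha n s) p
          (proj1_sig (constructive_indefinite_description _ Ab))))
    | right _ => dflt hC c0 s n p end) => n s p y.
  case: excluded_middle_informative => [Ab|[]]; last by exists y.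
  by case: constructive_indefinite_description => y' /= /pc_emb_inj ->.
have [|||||||F [F1 F2 F3]] := @acyclic_ext C hC _ (quasi_equifibrant hC hCq) K hK B Bmap
  (fun n s => PcR_sSet (N n s)) _ _ _ A (fun n s => pc_image_closed (hX := hN n s)) _
  (fun n s => @PcR_wc (N n s)) (fun n s => pc_image_wc (hX := hN n s) (@wN n s)) c0 a _ _ _.
- move=> n m t s r h h' p y; apply: pc_ext => q w /=.
  by case: (proj1_sig y q w) => //= z; rewrite (Nirr _ _ _ _ _ h h').
- move=> n s h p y; apply: pc_ext => q w /=.
  by case: (proj1_sig y q w) => //= z; rewrite Nid.
- move=> n m l t u s r o h1 h2 h3 p y; apply: pc_ext => q w /=.
  by case: (proj1_sig y q w) => //= z; rewrite (Ncomp _ _ _ _ _ _ _ _ h1 h2 h3).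
- by move=> n m t s r h p y [z ->]; rewrite Bmap_emb; exists (smap (Nmap n m t s r h) p z).
- by move=> n s p p' t y [z ->] q w x; rewrite -snat !aE snat.
- move=> n m t s r h p y [z ->]; rewrite Bmap_emb !aE; apply: FunS_ext => q w x.
  exact: alpha_nat.
(* An edge of the core is an isomorphism of [Fun(Delta^n, C)], and evaluation at the vertex [v]
   preserves isomorphisms. *)
- move=> n s y v [z ->]; rewrite aE.
  have := qc_iso_map (eval_at (Delta_sSet n) C v) (proj2_sig (smap (alpha n s) 1 z) (did 1)).
  by rewrite /= /fval /= !dcompt1.
(* Evaluation on the diagonal of [Delta^n x Delta^n]: this turns a compatible family of simplices of
   [B] into a simplicial map to [C]. *)
pose val n (s : sx K n) (b : sx (B n s) n) : sx C n := fval (F n s n b) (did n : sx (Delta n) n) (did n).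
have val_nat n m (t : Dmap n m) (s : sx K n) (r : sx K m) (h : sact K t r = s) (b : sx (B m r) m) :
    val n s (smap (Bmap n m t s r h) n (sact (B m r) t b)) = sact C t (val m r b).
  rewrite /val F1 fval_fact (F2 _ _ _ _ t) // !dcomp1t -{1 2}(dcompt1 t).
  exact: (fval_nat (A := Delta m)).
have fn n m (t : Dmap n m) (r : sx K m) :
    val n (sact K t r) (pc_pt _ n) = sact C t (val m r (pc_pt _ m)).
  by rewrite -(val_nat _ _ _ _ _ erefl); congr val; apply: pc_ext.
pose f := @SMap K C (fun n s => val n s (pc_pt _ n)) fn; exists f.
case: H2 => om [om_nat om_val].
(* The constant simplex at [omega], defined only on the vertices in [S]: all of them give [omega],
   none the base point. *)
pose el n (x : sx K' n) (S : 'I_n.+1 -> bool) : sx (B n (smap i n x)) n :=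
  pc_restr S (smap (emb n (smap i n x)) n (sact _ (dconst n ord0) (om n x))).
have Gn p (S : 'I_p.+1 -> bool) q q' (t : Dmap q' q) (x : sx K' q) (s : Dmap q p) :
    val q' _ (el q' (sact K' t x) (fun j => S (dfun (dcomp t s) j))) =
    sact C t (val q _ (el q x (fun j => S (dfun s j)))).
  have h : sact K t (smap i q x) = smap i q' (sact K' t x) by rewrite snat.
  have Er : sact (B _ _) t (el q x (fun j => S (dfun s j))) =
      pc_restr (fun j => S (dfun s (dfun t j))) (sact (B _ _) t (smap (emb _ _) q (sact _ (dconst q ord0) (om q x)))).
    exact: pc_restr_act.
  rewrite -(val_nat _ _ t _ _ h) Er; congr val; rewrite -snat.
  have -> : smap (Bmap _ _ _ _ _ h) q' (pc_restr (fun j => S (dfun s (dfun t j)))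
       (smap (emb _ _) q' (sact _ t (sact _ (dconst q ord0) (om q x))))) =
     pc_restr (fun j => S (dfun s (dfun t j))) (smap (emb _ _) q'
       (smap (Nmap _ _ _ _ _ h) q' (sact _ t (sact _ (dconst q ord0) (om q x))))).
    by rewrite -Bmap_emb; exact: pc_restr_map.
  rewrite sactM // dconst_comp /el.
  have -> : sact _ (dconst q' ord0) (om q' (sact K' t x)) =
     smap (Nmap _ _ _ _ _ h) q' (sact _ (dconst q' ord0) (om q x)).
    by rewrite [RHS]snat (om_nat _ _ t _ _ erefl h).
  by apply: pc_restr_eq => j; rewrite dcompE.
pose G p (S : 'I_p.+1 -> bool) : FunS K' C p :=
  exist _ (fun q x s => val q _ (el q x (fun j => S (dfun s j)))) (Gn p S).
have G_act p p' (t : Dmap p' p) (S : 'I_p.+1 -> bool) (S' : 'I_p'.+1 -> bool) :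
    (forall j, S (dfun t j) = S' j) -> fact t (G p S) = G p' S'.
  move=> E; apply: FunS_ext => q x s; rewrite -[LHS]/(val q _ _) -[RHS]/(val q _ _); congr val.
  by apply: pc_restr_eq => j; rewrite dcompE.
have G_false p (S : 'I_p.+1 -> bool) : (forall j, ~~ S j) ->
    forall q x s, fval (G p S) x s = smap f q (smap i q x).
  by move=> HS q x s; rewrite -[LHS]/(val q _ _) /el pc_restr_false.
have G_true p (S : 'I_p.+1 -> bool) : (forall j, S j) ->
    forall q x s, fval (G p S) x s = smap f' q x.
  move=> HS q x s; rewrite -[LHS]/(val q _ _) /el pc_restr_true // /val F3; last by eexists.
  rewrite aE snat -[LHS]/(cval (smap (alpha q (smap i q x)) 0 (om q x)) _ _).
  by rewrite om_val sact1.
have FS := FunR_sSet K' C.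
pose e := G 1 (fun j => j == 1 :> nat); pose e' := G 1 (fun j => j == 0 :> nat).
(* Any subset [S] of the vertices of [Delta^2] gives a triangle of [Fun(K', C)] with vertices [f']
   on [S] and [f o i] off it; the subsets [{1}] and [{0, 2}] witness the two inverse laws. *)
have two (S : 'I_3 -> bool) (S1 S2 S3 : 'I_2 -> bool) :
    (forall j, S (dfun (dfc 1 2) j) = S1 j) -> (forall j, S (dfun (dfc 1 0) j) = S2 j) ->
    (forall j, S (dfun (dfc 1 1) j) = S3 j) -> qcomp (C := FunR K' C) (G 1 S1) (G 1 S2) (G 1 S3).
  by move=> E1 E2 E3; exists (G 2 S); split; exact: G_act.
have Ef (S : 'I_1 -> bool) : (forall j, ~~ S j) -> G 0 S = fvert (scomp i f).
  by move=> HS; apply: FunS_ext => q x s; rewrite G_false.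
have Ef' (S : 'I_1 -> bool) : (forall j, S j) -> G 0 S = fvert f'.
  by move=> HS; apply: FunS_ext => q x s; rewrite G_true.
have se : src (C := FunR K' C) e = fvert (scomp i f).
  rewrite -(Ef (fun _ => false)) //; apply: G_act => j; rewrite dfcE /bump; have := ltn_ord j; lia.
have te : tgt (C := FunR K' C) e = fvert f'.
  rewrite -(Ef' (fun _ => true)) //; apply: G_act => j; rewrite dfcE /bump; have := ltn_ord j; lia.
have se' : src (C := FunR K' C) e' = fvert f'.
  rewrite -(Ef' (fun _ => true)) //; apply: G_act => j; rewrite dfcE /bump; have := ltn_ord j; lia.
have te' : tgt (C := FunR K' C) e' = fvert (scomp i f).
  rewrite -(Ef (fun _ => false)) //; apply: G_act => j; rewrite dfcE /bump; have := ltn_ord j; lia.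
exists e; rewrite esrcE etgtE se te; do 2!split=> //; apply/qc_isoE; exists e'.
rewrite se te se' te'; split=> //.
- have -> : eid (X := FunR K' C) (fvert (scomp i f)) = G 1 (fun _ => false).
    by rewrite -(Ef (fun _ => false)) //; exact: G_act.
  by apply: (two (fun j => j == 1 :> nat)) => j; rewrite dfcE /bump; have := ltn_ord j; lia.
- have -> : eid (X := FunR K' C) (fvert f') = G 1 (fun _ => true).
    by rewrite -(Ef' (fun _ => true)) //; exact: G_act.
  by apply: (two (fun j => j != 1 :> nat)) => j; rewrite dfcE /bump; have := ltn_ord j; lia.
Qed.
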